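(* Up to isomorphism there is exactly one connected symmetric configuration $21_3$ having no blocking set; it is the configuration obtained from three copies of the Fano plane by the cyclic three-configuration construction described below.
   Context: A symmetric configuration $v_3$ consists of a set of $v$ points and a collection of $v$ blocks, each block being a 3-element subset of the points, such that every point lies in exactly 3 blocks and any two distinct points lie in at most one common block; it is connected if it is not the union of two configurations on disjoint nonempty point sets. A blocking set is a subset $Q$ of the points such that every block contains at least one point of $Q$ and at least one point not in $Q$. The Fano plane is the unique $7_3$ configuration. Construction: take three configurations on pairwise disjoint point sets $V^1,V^2,V^3$ with block sets $\mathcal{B}^1,\mathcal{B}^2,\mathcal{B}^3$; for each $i$ choose a block $B^i\in\mathcal{B}^i$ and a point $x^i\in B^i$, and set $B^i_*=(B^i\setminus\{x^i\})\cup\{x^{i+1}\}$ (superscripts mod 3). The resulting configuration has point set $V^1\cup V^2\cup V^3$ and blocks $\bigcup_{i}(\mathcal{B}^i\setminus\{B^i\})\cup\{B^i_*\}$. (Since the Fano plane is flag-transitive, all choices give isomorphic results.) *)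

(* Defs.v *)
From mathcomp Require Import all_boot.
Set Implicit Arguments. Unset Strict Implicit. Unset Printing Implicit Defensive.

Section Config.
Variable T : finType.

Definition sym_config3 (B : {set {set T}}) : Prop :=
  [/\ #|B| = #|T|,
      (forall b, b \in B -> #|b| = 3),
      (forall x : T, #|[set b in B | x \in b]| = 3) &
      (forall x y : T, x != y -> #|[set b in B | (x \in b) && (y \in b)]| <= 1)].

Definition conf_connected (B : {set {set T}}) : Prop :=
  forall X : {set T},
    (forall b, b \in B -> (b \subset X) || (b \subset ~: X)) ->
    X = set0 \/ X = setT.

Definition blocking_set (B : {set {set T}}) (Q : {set T}) : Prop :=
  forall b, b \in B -> (b :&: Q != set0) /\ (b :\: Q != set0).

Definition has_blocking_set (B : {set {set T}}) : Prop :=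
  exists Q : {set T}, blocking_set B Q.

End Config.

Definition conf_iso (T T' : finType) (B : {set {set T}}) (B' : {set {set T'}}) : Prop :=
  exists f : T -> T', bijective f /\ B' = [set f @: b | b : {set T} in B].

Definition fano_pt (n : nat) : 'I_7 := inord (n %% 7).
Definition fano_blocks : {set {set 'I_7}} :=
  [set [set fano_pt i; fano_pt (i + 1); fano_pt (i + 3)] | i : 'I_7].

(* The cyclic three-configuration construction, applied to three copies
   (indexed by 'I_3) of the configuration F on T, with the same chosen block
   b0 and point x0 in each copy. Points of copy i are (i, p). *)
Definition three_construction (T : finType) (F : {set {set T}}) (b0 : {set T}) (x0 : T)
  : {set {set ('I_3 * T)}} :=
  [set (fun p => (i, p)) @: c | i : 'I_3, c : {set T} in F :\ b0]
  :|: [set ((fun p => (i, p)) @: (b0 :\ x0)) :|: [set (ordS i, x0)] | i : 'I_3].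

Definition fano_b0 : {set 'I_7} := [set fano_pt 0; fano_pt 1; fano_pt 3].
Definition fano_x0 : 'I_7 := fano_pt 0.

Definition three_fano : {set {set ('I_3 * 'I_7)}} :=
  three_construction fano_blocks fano_b0 fano_x0.

(* Main.v *)
Require Import Defs.
From mathcomp Require Import all_boot zify.
Set Implicit Arguments. Unset Strict Implicit. Unset Printing Implicit Defensive.

(* Points and blocks form a cubic bipartite graph, and a blocking set is a two-colouring of the points that
   makes every block bichromatic. A partial colouring extends whenever the blocks it leaves unsettled can be
   matched injectively to uncoloured points of their own (extend_colouring); hence an uncolourable connected
   graph has no 4-cycle, and its dual is uncolourable too. If the points of an 8-cycle are coloured
   alternately, Hall's condition must fail; for at most 21 points a minimal violator, of the graph or of its
   dual, has at most nine blocks, and a search lists the local patterns this leaves around the cycle. A Fano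
   plane minus a block, attached to three distinct blocks, contracts to a point and gives an uncolourable
   graph with six points fewer, so 9 and 15 points are treated on the way to 21. What remains is a finite case
   analysis: larger and larger partial configurations are excluded, from the rarest to a single incidence, by
   branching over the blocks at a point, the points on a block or the patterns at an 8-cycle. The only closed
   configuration that survives is the cyclic combination of three Fano planes. *)

(** * Matchings *)

(** An alternating colouring needs a cycle with an even number of points, and 4-cycles do not occur,
    so 8 is the least usable length. Each of the four cycle points has one edge left for the blocks
    off the cycle. These four edges allow a deficiency of one in Hall's condition, never of two, so
    all blocks off the cycle can still be matched if a single one takes its mate on the cycle. The
    points next to a minimal violator, the points forming a minimal violator of the dual and the
    cycle points are pairwise disjoint; this is the origin of the bound nine for 21 points.

    The obstacle is that the exceptional configuration cannot be refuted. Every refutation is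
    therefore relative to a proposition [Goal]: [False] for 9 and 15 points, the occurrence of [TF]
    for 21. One computation serves the three orders.

    [TF] consists of three Fano planes minus an incidence ([X14]). These survive longest, so the
    analysis assumes two disjoint copies of [X14], then one, then none, each time excluding whatever
    could lie beside them. The descent by contraction ends at three points, where a 4-cycle is
    unavoidable. *)

Definition nbh (Q P : finType) (r : Q -> P -> bool) (B : {set Q}) : {set P} :=
  [set p | [exists q, (q \in B) && r q p]].

Lemma nbhP (Q P : finType) (r : Q -> P -> bool) (B : {set Q}) p :
  reflect (exists2 q, q \in B & r q p) (p \in nbh r B).
Proof.
rewrite inE; apply: (iffP existsP) => [[q /andP[]]|[q qB rq]]; first by exists q.
by exists q; rewrite qB.
Qed.

(** The Halmos-Vaughan induction on [#|A|]. The point [p0] supplies a value for the matching when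
    [A] is empty. *)
Lemma hall (Q P : finType) (r : Q -> P -> bool) (A : {set Q}) (p0 : P) :
  (forall B : {set Q}, B \subset A -> #|B| <= #|nbh r B|) ->
  exists M : Q -> P, {in A &, injective M} /\ {in A, forall q, r q (M q)}.
Proof.
have [k] := ubnP #|A|; elim: k r A => // k IH r A leA hA.
have [->|[q0 q0A]] := set_0Vmem A.
  by exists (fun=> p0); split=> x; rewrite inE.
(* If a proper nonempty [B] is tight, match it inside its neighbourhood and the rest outside, where
   Hall's condition survives. If no set is tight, there is slack one everywhere, and any single pair
   may be matched first. *)
have [/existsP[B /and4P[BA B0 BnA /eqP tB]]|/existsPn loose] :=
  boolP [exists B : {set Q}, [&& B \subset A, B != set0, B != A & #|nbh r B| == #|B|]].
  have cA : #|A| = #|B| + #|A :\: B|.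
    by rewrite -(cardsID B A) (setIidPr BA).
  have ltB : #|B| < #|A| by apply: proper_card; rewrite properEneq BnA BA.
  have posB : 0 < #|B| by rewrite card_gt0.
  have [|C CB|M1 [inj1 r1]] := IH r B; first lia.
    by apply: hA; apply: subset_trans BA.
  pose r' q p := r q p && (p \notin nbh r B).
  have [|C CAB|M2 [inj2 r2]] := IH r' (A :\: B); first lia.
    have := hA (B :|: C); rewrite subUset BA (subset_trans CAB (subsetDl _ _)) => /(_ isT).
    have dBC : B :&: C = set0.
      apply/setP=> q; rewrite !inE; apply/andP=> -[qB /(subsetP CAB)].
      by rewrite inE qB.
    have -> : nbh r (B :|: C) = nbh r B :|: nbh r' C.
      apply/setP=> p; rewrite [in RHS]inE; apply/nbhP/orP.
        case=> q; rewrite inE => /orP[qB|qC] rq; first by left; apply/nbhP; exists q.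
        by case: (boolP (p \in nbh r B)) => pB; [left|right; apply/nbhP; exists q; rewrite // /r' rq].
      by case=> /nbhP[q qB]; [|case/andP]; exists q => //; rewrite inE qB ?orbT.
    rewrite !cardsU dBC cards0.
    by have := tB; lia.
  exists (fun q => if q \in B then M1 q else M2 q); split=> [x y xA yA|x xA] /=.
    case: ifP => xB; case: ifP => yB.
    - exact: inj1.
    - move=> e; have /r2/andP[_ /nbhP[]] : y \in A :\: B by rewrite inE yB.
      by exists x => //; rewrite -e r1.
    - move=> e; have /r2/andP[_ /nbhP[]] : x \in A :\: B by rewrite inE xB.
      by exists y => //; rewrite e r1.
    - by apply: inj2; rewrite inE ?xB ?yB.
  case: ifP => xB; first exact: r1.
  by have /r2/andP[] : x \in A :\: B by rewrite inE xB.
have /card_gt0P[p1 /nbhP[q]] : 0 < #|nbh r [set q0]|.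
  by have := hA [set q0]; rewrite sub1set q0A cards1 => /(_ isT).
rewrite inE => /eqP-> rp1.
pose r' q p := r q p && (p != p1).
have cA := cardsD1 q0 A; rewrite q0A in cA.
have [|C CA|M2 [inj2 r2]] := IH r' (A :\ q0); first lia.
  have [->|C0] := eqVneq C set0; first by rewrite cards0.
  have CAA : C \subset A := subset_trans CA (subsetDl _ _).
  have CnA : C != A by apply: contraTneq CA => ->; apply/subsetPn; exists q0; rewrite // !inE eqxx.
  have := hA C CAA; have := loose C; rewrite CAA C0 CnA /= => neq le.
  have -> : nbh r' C = nbh r C :\ p1.
    apply/setP=> p; rewrite [in RHS]inE in_set1; apply/nbhP/andP.
      by case=> q1 q1C /andP[rq ->]; split=> //; apply/nbhP; exists q1.
    by case=> np /nbhP[q1 q1C rq]; exists q1 => //; rewrite /r' rq.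
  by have := cardsD1 p1 (nbh r C); move: neq le; lia.
exists (fun q => if q == q0 then p1 else M2 q); split=> [x y xA yA|x xA] /=.
  case: eqP => [->|/eqP xq]; case: eqP => [->|/eqP yq] //.
  - by move=> e; have /r2/andP[_] : y \in A :\ q0; rewrite ?inE ?yq // -e eqxx.
  - by move=> e; have /r2/andP[_] : x \in A :\ q0; rewrite ?inE ?xq // e eqxx.
  - by apply: inj2; rewrite inE in_set1 ?xq ?yq.
case: eqP => [->|/eqP xq] //.
by have /r2/andP[] : x \in A :\ q0; rewrite ?inE ?xq.
Qed.

(** * Extension of colourings *)

Section Incidence.
Variables (P Q : finType) (inc : P -> Q -> bool).

Definition flipi (q : Q) (p : P) := inc p q.
Definition pts q := [set p | inc p q].
Definition bls p := [set q | inc p q].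
Definition cubic := (forall q, #|pts q| = 3) /\ (forall p, #|bls p| = 3).
Definition conn := forall (X : {set P}) (Y : {set Q}),
  (forall p q, inc p q -> (p \in X) = (q \in Y)) ->
  (X != set0) || (Y != set0) -> X = setT /\ Y = setT.
Definition bichrom (S : {set P}) (f : P -> bool) q :=
  [exists p, [exists p', [&& p \in S, p' \in S, inc p q, inc p' q & f p != f p']]].
Definition colourable := exists f, forall q, bichrom setT f q.

Lemma bichromP (S : {set P}) (f : P -> bool) q :
  reflect (exists p p', [/\ p \in S, p' \in S, inc p q, inc p' q & f p != f p']) (bichrom S f q).
Proof.
apply: (iffP existsP) => [[p /existsP[p' /and5P[]]]|[p [p' []]]]; first by exists p, p'.
by move=> *; exists p; apply/existsP; exists p'; apply/and5P.
Qed.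

Lemma edge_count (B : {set Q}) (U : {set P}) :
  \sum_(q in B) #|pts q :&: U| = \sum_(p in U) #|bls p :&: B|.
Proof.
under eq_bigr do rewrite -sum1_card.
under [RHS]eq_bigr do rewrite -sum1_card.
rewrite (exchange_big_dep (mem U)) /=; last by move=> q p _; rewrite inE => /andP[].
apply: eq_bigr => p pU; apply: eq_bigl => q; rewrite !inE pU andbT.
by rewrite andbC.
Qed.

Hypothesis cub : cubic.

Lemma card_sides : #|P| = #|Q|.
Proof.
have := edge_count setT setT.
rewrite (eq_bigr (fun=> 3)) => [|q _]; last by rewrite setIT cub.1.
rewrite [in RHS](eq_bigr (fun=> 3)) => [|p _]; last by rewrite setIT cub.2.
by rewrite !sum_nat_const !cardsT; lia.
Qed.

(** The edges of [B] that avoid [S] end in the neighbourhood, whose points absorb at most three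
    each. Thus every unit of deficiency in Hall's condition costs three edges into [S]. *)
Lemma nbh_count (B : {set Q}) (S : {set P}) :
  3 * #|B| <= \sum_(q in B) #|pts q :&: S| + 3 * #|nbh (fun q p => inc p q && (p \notin S)) B|.
Proof.
set N := nbh _ _.
have -> : 3 * #|B| = \sum_(q in B) (#|pts q :&: S| + #|pts q :\: S|).
  rewrite mulnC -sum_nat_const; apply: eq_bigr => q _.
  by rewrite cardsID cub.1.
rewrite big_split leq_add2l /=.
have -> : \sum_(q in B) #|pts q :\: S| = \sum_(q in B) #|pts q :&: N|.
  apply: eq_bigr => q qB; congr #|pred_of_set _|; apply/setP=> p.
  rewrite inE andbC [in RHS]inE; case: (boolP (p \in pts q)) => //=; rewrite inE => pq.
  case: (boolP (p \in S)) => pS; last by symmetry; apply/nbhP; exists q; rewrite ?pq.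
  by symmetry; apply/negP=> /nbhP[q' _ /andP[_]]; rewrite pS.
rewrite edge_count mulnC -sum_nat_const leq_sum // => p _.
by rewrite -(cub.2 p) subset_leq_card // subsetIl.
Qed.

Hypothesis con : conn.

(* A block that is not yet bichromatic but meets S is settled by colouring its mate; when no such block
   is left, the uncoloured points and the unsettled blocks form a union of components. *)
Lemma extend_colouring (S : {set P}) f (M : Q -> P) :
  S != set0 ->
  (forall q, ~~ bichrom S f q -> inc (M q) q /\ M q \notin S) ->
  {in [pred q | ~~ bichrom S f q] &, injective M} -> colourable.
Proof.
have [k] := ubnP #|~: S|; elim: k S f => // k IH S f leS S0 hM injM.
have ne p u : p \notin S -> u \in S -> (u == p) = false.
  by move=> pS uS; apply: contraNF pS => /eqP<-.
(* Colouring one more point keeps the matching usable, provided that this point is not the mate of a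
   block that stays unsettled. *)
have step p c : p \notin S -> (forall q, ~~ bichrom (p |: S) [eta f with p |-> c] q -> M q != p) -> colourable.
  move=> pS hp; pose S' := p |: S; pose f' := [eta f with p |-> c].
  have sat q : bichrom S f q -> bichrom S' f' q.
    case/bichromP=> u [v [uS vS uq vq fuv]]; apply/bichromP; exists u, v.
    rewrite /S' !inE uS vS !orbT /=; split=> //.
    by rewrite !ne.
  have unsat q : ~~ bichrom S' f' q -> ~~ bichrom S f q by apply/contra/sat.
  apply: (IH S' f').
  - have : #|~: S'| < #|~: S|.
      apply: proper_card; apply/properP; split; first by rewrite setCS subsetUr.
      by exists p; rewrite !inE ?eqxx.
    lia.
  - by apply/set0Pn; exists p; rewrite !inE eqxx.
  - move=> q uq; have [iq nq] := hM q (unsat q uq); split=> //.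
    by rewrite !inE negb_or nq andbT hp.
  - by move=> q q' /unsat uq /unsat uq'; apply: injM.
have [/existsP[q /andP[uq /existsP[p0 /andP[p0S p0q]]]]|/existsPn noA] :=
  boolP [exists q, ~~ bichrom S f q && [exists p, (p \in S) && inc p q]].
  have [Mq MS] := hM q uq.
  apply: (step (M q) (~~ f p0)) => // q' uq'; apply/eqP=> eM.
  have bq : bichrom (M q |: S) [eta f with M q |-> ~~ f p0] q.
    apply/bichromP; exists (M q), p0; rewrite !inE eqxx p0S orbT /= eqxx; split=> //.
    by rewrite ne //; case: (f p0).
  have uq'' : ~~ bichrom S f q'.
    apply: contra uq' => /bichromP[u [v [uS vS ui vi fuv]]]; apply/bichromP; exists u, v.
    rewrite !inE uS vS !orbT /=; split=> //.
    by rewrite !ne.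
  by move: uq'; rewrite (injM _ _ uq'' uq eM) bq.
(* An uncoloured point that is nobody's mate may take any colour. If there is none, [M] is a
   bijection from the unsettled blocks onto the uncoloured points. *)
have [/existsP[p /andP[pS /existsPn hp]]|/existsPn noB] :=
  boolP [exists p, (p \notin S) && ~~ [exists q, ~~ bichrom S f q && (M q == p)]].
  apply: (step p true pS) => q uq; have := hp q; rewrite negb_and negbK => /orP[bq|//].
  case/negP: uq; case/bichromP: bq => u [v [uS vS ui vi fuv]]; apply/bichromP; exists u, v.
  rewrite !inE uS vS !orbT /=; split=> //.
  by rewrite !ne.
pose U := [set q | ~~ bichrom S f q].
have UE q : q \in U = ~~ bichrom S f q by rewrite inE.
have MU : M @: U = ~: S.
  apply/setP=> p; rewrite [in RHS]inE; apply/imsetP/idP.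
    by case=> q; rewrite UE => /hM[_ ? ->].
  move=> pS; have := noB p; rewrite pS negbK => /existsP[q /andP[uq /eqP<-]].
  by exists q; rewrite ?UE.
have cU : #|~: S| = #|U|.
  by rewrite -MU card_in_imset // => q q'; rewrite !UE => ? ?; apply: injM.
have noSU p q : inc p q -> q \in U -> p \notin S.
  rewrite UE => pq uq; have := noA q; rewrite uq => /existsPn/(_ p).
  by rewrite pq andbT.
(* The unsettled blocks send all their [3 * #|U|] edges to uncoloured points. As [#|~: S| = #|U|],
   these are all the edges there, so none is left for a settled block. *)
have noS'U p q : inc p q -> p \notin S -> q \in U.
  move=> pq pS; apply/negPn/negP=> qU.
  have := edge_count setT (~: S).
  rewrite [in RHS](eq_bigr (fun=> 3)) => [|x _]; last by rewrite setIT cub.2.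
  rewrite (bigID (mem U)) /= (eq_bigl (mem U)); last by move=> x; rewrite in_setT.
  rewrite (eq_bigr (fun=> 3)) => [|x xU]; last first.
    rewrite -(cub.1 x); congr #|pred_of_set _|; apply/setP=> y; rewrite !inE.
    by case: (boolP (inc y x)) => //= yx; rewrite (noSU y x).
  rewrite !sum_nat_const cU (bigD1 q) /=; last by rewrite in_setT.
  have : 0 < #|pts q :&: ~: S| by apply/card_gt0P; exists p; rewrite !inE pq.
  by move=> h1 h2; move: h1 h2; set a := #|pts q :&: ~: S|; set b := \sum_(_ | _) _; clearbody a b; lia.
have [ST UT] : S = setT /\ ~: U = setT.
  apply: con; last by rewrite S0.
  move=> p q pq; rewrite in_setC; case: (boolP (q \in U)) => qU /=.
    by apply/negbTE/(noSU _ _ pq).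
  by apply/negPn/negP => /(noS'U _ _ pq); apply/negP.
exists f => q; have : q \in ~: U by rewrite UT inE.
by rewrite !inE negbK ST.
Qed.

(** Giving [x] and [y] different colours settles [q1] and [q2]. Each of the two points has only one
    edge left, and two edges are fewer than the three that a Hall violator costs. *)
Lemma four_cycle_colourable x y q1 q2 :
  x != y -> q1 != q2 -> inc x q1 -> inc x q2 -> inc y q1 -> inc y q2 -> colourable.
Proof.
move=> xy q12 x1 x2 y1 y2.
pose S := [set x; y]; pose f p := p == x.
have b1 : bichrom S f q1 by apply/bichromP; exists x, y; rewrite /S !inE !eqxx orbT /f (eq_sym y) eqxx (negbTE xy).
have b2 : bichrom S f q2 by apply/bichromP; exists x, y; rewrite /S !inE !eqxx orbT /f (eq_sym y) eqxx (negbTE xy).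
pose U := [set q | ~~ bichrom S f q].
have [|M [injM hM]] := hall (r := fun q p => inc p q && (p \notin S)) (A := U) x.
  move=> B BU; have := nbh_count B S; rewrite edge_count big_setU1 ?inE // big_set1.
  have hc z : inc z q1 -> inc z q2 -> #|bls z :&: B| <= 1.
    move=> z1 z2; have : #|[set q1; q2]| = 2 by rewrite cards2 q12.
    have := cardsID B (bls z); rewrite cub.2.
    have : #|[set q1; q2]| <= #|bls z :\: B|.
      apply: subset_leq_card; apply/subsetP=> q; rewrite !inE => /orP[]/eqP->; rewrite ?z1 ?z2 andbT.
        by apply/negP=> /(subsetP BU); rewrite inE b1.
      by apply/negP=> /(subsetP BU); rewrite inE b2.
    lia.
  have := hc x x1 x2; have := hc y y1 y2.
  rewrite /=; lia.
apply: (@extend_colouring S f M).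
- by apply/set0Pn; exists x; rewrite !inE eqxx.
- by move=> q uq; have /andP[] : inc (M q) q && (M q \notin S) by apply: hM; rewrite inE.
- by move=> q q' uq uq'; apply: injM; rewrite inE.
Qed.

Lemma perfect_matching (p0 : P) : exists M : Q -> P, injective M /\ forall q, inc (M q) q.
Proof.
have [|M [injM hM]] := hall (r := fun q p => inc p q && (p \notin set0)) (A := setT) p0.
  move=> B _; have := nbh_count B set0; rewrite big1 ?add0n ?leq_pmul2l // => q _.
  by rewrite setI0 cards0.
exists M; split=> [q q'|q]; first by apply: injM; rewrite inE.
by have /andP[] : inc (M q) q && (M q \notin set0) by apply: hM; rewrite inE.
Qed.
End Incidence.

(** * Duality and Hall violators *)

Record good (P Q : finType) (inc : P -> Q -> bool) (n : nat) : Prop := Good {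
  good_cubic : cubic inc;
  good_conn : conn inc;
  good_ncol : ~ colourable inc;
  good_card : #|P| = n }.

Section Dual.
Variables (P Q : finType) (inc : P -> Q -> bool) (n : nat).
Hypothesis G : good inc n.

Lemma good_linear x y q1 q2 : x != y -> q1 != q2 ->
  inc x q1 -> inc x q2 -> inc y q1 -> inc y q2 -> False.
Proof. by move=> *; apply: (good_ncol G); apply: (four_cycle_colourable (good_cubic G) (good_conn G) (x:=x) (y:=y) (q1:=q1) (q2:=q2)). Qed.

(* A colouring of the dual leads from each block to a differently coloured block through its mate;
   the recurrent blocks of this map give a coloured set of points to start from. *)
Lemma dual_ncol : ~ colourable (flipi inc).
Proof.
case: G => cub con ncol _ [g hg].
have [p0 _|noP] := pickP (@predT P); last first.
  apply: ncol; exists (fun=> true) => q; have : 0 < #|pts inc q| by rewrite cub.1.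
  by case/card_gt0P=> p; have := noP p.
have [M [injM hM]] := perfect_matching cub p0.
have nxtE q : exists q', inc (M q) q' && (g q' != g q).
  have /bichromP[u [v [_ _]]] := hg (M q); rewrite /flipi => qu qv uv.
  case: (eqVneq (g u) (g q)) => e; last by exists u; rewrite qu.
  by exists v; rewrite qv -e eq_sym.
pose nxt q := xchoose (nxtE q).
have nxtP q : inc (M q) (nxt q) /\ g (nxt q) != g q by have /andP := xchooseP (nxtE q).
have [q0 _] : exists q0 : Q, true.
  by have : 0 < #|bls inc p0|; [rewrite cub.2 | case/card_gt0P => q _; exists q].
pose closed (K : {set Q}) := (K != set0) && (nxt @: K \subset K).
have cT : closed setT by rewrite /closed subsetT andbT; apply/set0Pn; exists q0.
(* Minimality gives [nxt @: K = K]. So each block of [K] is the successor of another one in [K], and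
   contains both that block's mate and its own mate, which have opposite colours. *)
have [K /minsetP[/andP[K0 KK] Kmin] _] := minset_exists cT.
have KE : nxt @: K = K.
  apply: Kmin => //; rewrite /closed imsetS // andbT.
  by case/set0Pn: K0 => q qK; apply/set0Pn; exists (nxt q); apply: imset_f.
pose f p := [exists q, (M q == p) && g q].
have fM q : f (M q) = g q.
  apply/existsP/idP => [[q' /andP[/eqP/injM->]] //|gq].
  by exists q; rewrite eqxx.
have bK q : q \in K -> bichrom inc (M @: K) f q.
  rewrite -{1}KE => /imsetP[q' q'K ->]; have [i ne] := nxtP q'.
  apply/bichromP; exists (M q'), (M (nxt q')).
  have nK : nxt q' \in K by apply: (subsetP KK); apply: imset_f.
  by split; [apply: imset_f|apply: imset_f| |exact: hM|rewrite !fM eq_sym].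
apply: ncol; apply: (@extend_colouring _ _ _ cub con (M @: K) f M).
- by case/set0Pn: K0 => q qK; apply/set0Pn; exists (M q); apply: imset_f.
- move=> q uq; split=> //; apply: contra uq => /imsetP[q' q'K /injM->]; exact: bK.
- by move=> q q' _ _; apply: injM.
Qed.

Lemma good_dual : good (flipi inc) n.
Proof.
case: (G) => cub con _ cn; split; last by rewrite -(card_sides cub).
- by split=> [p|q]; rewrite -?(cub.2 p) -?(cub.1 q); apply: eq_card => z; rewrite !inE.
- move=> X Y h; rewrite orbC => h'; have [|//|] := con Y X; last by [].
  by move=> p q /h.
- exact: dual_ncol.
Qed.
End Dual.

Section Violator.
Variables (P Q : finType) (inc : P -> Q -> bool) (S : {set P}) (F : {set Q}).
Definition outer := nbh (fun q p => inc p q && (p \notin S)).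
Definition minviol (A : {set Q}) :=
  [/\ A \subset ~: F, #|outer A| < #|A| &
      forall B : {set Q}, B \subset A -> B != A -> #|B| <= #|outer B|].

Lemma outerS (A B : {set Q}) : A \subset B -> outer A \subset outer B.
Proof. by move=> AB; apply/subsetP=> p /nbhP[q qA h]; apply/nbhP; exists q => //; apply: (subsetP AB). Qed.

(** Removing one block restores Hall's condition, so the deficiency is exactly one. *)
Lemma minviol_card A : minviol A -> #|A| = #|outer A|.+1.
Proof.
move=> [_ lt mA]; have /card_gt0P[a aA] : 0 < #|A| by lia.
have cA := cardsD1 a A; rewrite aA in cA.
have := mA (A :\ a) (subsetDl _ _); have := subset_leq_card (outerS (subsetDl A [set a])).
have : A :\ a != A by apply/eqP=> e; move: aA; rewrite -e !inE eqxx.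
by move=> -> h1 /(_ isT) h2; lia.
Qed.
End Violator.

(* An 8-cycle, remembered only through its sets of points and blocks. *)
Definition octagon (P Q : finType) (inc : P -> Q -> bool) (S : {set P}) (F : {set Q}) :=
  [/\ #|S| = 4, #|F| = 4, forall p, p \in S -> #|bls inc p :&: F| = 2 &
      forall q, q \in F -> #|pts inc q :&: S| = 2].

Section Octagon.
Variables (P Q : finType) (inc : P -> Q -> bool) (n : nat) (S : {set P}) (F : {set Q}).
Hypotheses (G : good inc n) (oct : octagon inc S F).

Lemma minviol_exists f : (forall q, q \in F -> bichrom inc S f q) -> exists A, minviol inc S F A.
Proof.
move=> bF; case: (G) => cub con ncol _.
pose viol (A : {set Q}) := (A \subset ~: F) && (#|outer inc S A| < #|A|).
have [/existsP[A vA]|/existsPn noV] := boolP [exists A, viol A].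
  have [B /minsetP[/andP[BF ltB] mB] _] := minset_exists vA.
  exists B; split=> // C CB CnB; rewrite leqNgt; apply/negP => lt.
  by case/eqP: CnB; apply: mB => //; rewrite /viol lt (subset_trans CB).
case: ncol; case: oct => cS cF _ _.
have /card_gt0P[p0 p0S] : 0 < #|S| by rewrite cS.
have [|M [injM hM]] := hall (r := fun q p => inc p q && (p \notin S)) (A := ~: F) p0.
  by move=> B BF; have := noV B; rewrite /viol BF /= -leqNgt.
have uF q : ~~ bichrom inc S f q -> q \in ~: F by rewrite inE; apply/contra/bF.
apply: (@extend_colouring _ _ _ cub con S f M).
- by apply/set0Pn; exists p0.
- by move=> q /uF/hM/andP.
- by move=> q q' /uF ? /uF ?; apply: injM.
Qed.

(** Two of the three edges at a cycle point stay on the cycle, so only four edges reach the blocks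
    off it. *)
Lemma third_edges (C : {set Q}) : C \subset ~: F -> \sum_(q in C) #|pts inc q :&: S| <= 4.
Proof.
move=> CF; rewrite edge_count; case: oct => cS _ hS _; rewrite -[4]cS -sum1_card leq_sum // => p pS.
have := cardsID F (bls inc p); rewrite (hS p pS) (good_cubic G).2.
have : #|bls inc p :&: C| <= #|bls inc p :\: F|.
  by rewrite subset_leq_card // setDE setIS.
lia.
Qed.

(** A matching of all the blocks off the cycle in which only [a0] has its mate, [x0], on the cycle.
    Hence the alternating colouring extends as soon as [a0] can be settled, and everything hinges on
    paths that start at [a0]. By [frame_closed] the search never leaves the violator: a point on one
    of its blocks is a cycle point or the mate of a block of [A]. *)
Record frame (A : {set Q}) (a0 : Q) (x0 : P) (M : Q -> P) : Prop := Frame {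
  frame_a0 : a0 \in A;
  frame_x0 : x0 \in S;
  frame_sub : A \subset ~: F;
  frame_inj : {in ~: F &, injective M};
  frame_inc : forall q, q \notin F -> inc (M q) q;
  frame_M0 : M a0 = x0;
  frame_out : forall q, q \notin F -> q != a0 -> M q \notin S;
  frame_closed : forall q p, q \in A -> inc p q -> p \in S \/ exists2 a, a \in A & p = M a }.

Lemma frame_exists A : minviol inc S F A -> exists a0 x0 M, frame A a0 x0 M.
Proof.
move=> mvA; have cA := minviol_card mvA; case: mvA => AF _ mA.
have cub := good_cubic G.
have cnt := nbh_count cub A S.
(* A violator without edges into [S] would contradict [nbh_count]; any block of it that meets the
   cycle can serve as [a0]. *)
have [/existsP[a0 /andP[a0A /set0Pn[x0]]]|/existsPn none] :=
  boolP [exists q, (q \in A) && (pts inc q :&: S != set0)]; last first.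
  move: cnt; rewrite big1 => [|q qA]; last first.
    by have := none q; rewrite qA negbK => /eqP->; rewrite cards0.
  by rewrite -/(outer inc S A); lia.
rewrite !inE => /andP[x0a0 x0S].
have [|M1 [inj1 h1]] := hall (r := fun q p => inc p q && (p \notin S)) (A := A :\ a0) x0.
  move=> B BA; apply: mA; first exact: subset_trans BA (subsetDl _ _).
  by apply/eqP=> e; move: (subsetP BA a0); rewrite e a0A !inE eqxx => /(_ isT).
have M1out q : q \in A :\ a0 -> M1 q \in outer inc S A.
  move=> qA; apply/nbhP; exists q; last exact: h1.
  by case/setD1P: qA.
have im1 : M1 @: (A :\ a0) = outer inc S A.
  apply/eqP; rewrite eqEcard card_in_imset //; apply/andP; split.
    by apply/subsetP=> p /imsetP[q qA ->]; apply: M1out.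
  by have := cardsD1 a0 A; rewrite a0A; lia.
(* Outside [A] and its neighbourhood Hall's condition holds: a second deficient set, joined to [A],
   would have total deficiency two and need six edges into [S], where only four exist. *)
have [|M2 [inj2 h2]] := hall (r := fun q p => inc p q && (p \notin S) && (p \notin outer inc S A))
    (A := ~: F :\: A) x0.
  move=> B BFA; set N := nbh _ B; rewrite leqNgt; apply/negP=> lt.
  have BF : B \subset ~: F by apply: subset_trans BFA (subsetDl _ _).
  have dAB : A :&: B = set0.
    by apply/setP=> q; rewrite !inE; apply/andP=> -[qA /(subsetP BFA)]; rewrite inE qA.
  have := nbh_count cub (A :|: B) S; have := @third_edges (A :|: B).
  rewrite subUset AF BF => /(_ isT).
  have -> : nbh (fun q p => inc p q && (p \notin S)) (A :|: B) = outer inc S A :|: N.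
    apply/setP=> p; rewrite [in RHS]inE; apply/nbhP/orP.
      case=> q; rewrite inE => /orP[qA|qB] rq; first by left; apply/nbhP; exists q.
      by case: (boolP (p \in outer inc S A)) => pA; [left|right; apply/nbhP; exists q; rewrite ?rq].
    by case=> /nbhP[q qB]; [|case/andP]; exists q => //; rewrite inE qB ?orbT.
  rewrite !cardsU dAB cards0.
  set s := \sum_(_ in _) _; move: lt cA; set a := #|outer _ _ _|; set c := #|N|.
  by clearbody s a c; lia.
pose M q := if q == a0 then x0 else if q \in A then M1 q else M2 q.
have inA q : q \in A -> q != a0 -> q \in A :\ a0 by rewrite !inE => -> ->.
have inF q : q \in ~: F -> q \notin A -> q \in ~: F :\: A by rewrite !inE => -> ->.
have M1S q : q \in A -> q != a0 -> M1 q \notin S by move=> qA qa; have /andP[] := h1 q (inA q qA qa).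
have M2S q : q \in ~: F -> q \notin A -> M2 q \notin S by move=> qF qA; have /andP[/andP[]] := h2 q (inF q qF qA).
have M2o q : q \in ~: F -> q \notin A -> M2 q \notin outer inc S A by move=> qF qA; have /andP[] := h2 q (inF q qF qA).
have out q : q \in ~: F -> q != a0 -> M q \notin S.
  by rewrite /M => qF qa; rewrite (negbTE qa); case: ifPn => qA; [apply: M1S|apply: M2S].
exists a0, x0, M; split=> //.
- move=> q q' qF q'F; rewrite /M.
  have [->|qa] := eqVneq q a0; have [->|q'a] := eqVneq q' a0 => //.
  + by move=> e; have := out q' q'F q'a; rewrite /M (negbTE q'a) -e x0S.
  + by move=> e; have := out q qF qa; rewrite /M (negbTE qa) e x0S.
  case: ifPn => qA; case: ifPn => q'A.
  + by apply: inj1; apply: inA.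
  + by move=> e; have := M2o q' q'F q'A; rewrite -e M1out ?inA.
  + by move=> e; have := M2o q qF qA; rewrite e M1out ?inA.
  + by apply: inj2; apply: inF.
- move=> q qF; have qF' : q \in ~: F by rewrite inE.
  rewrite /M; case: eqP => [-> //|/eqP qa]; case: ifPn => qA.
    by have /andP[] := h1 q (inA q qA qa).
  by have /andP[/andP[]] := h2 q (inF q qF' qA).
- by rewrite /M eqxx.
- by move=> q qF; apply: out; rewrite inE.
- move=> q p qA pq; case: (boolP (p \in S)) => pS; [by left|right].
  have : p \in outer inc S A by apply/nbhP; exists q; rewrite ?pq.
  rewrite -im1 => /imsetP[a aA ->]; case/setD1P: (aA) => na aA'.
  by exists a; rewrite // /M (negbTE na) aA'.
Qed.
End Octagon.

Section DualViolators.
Variables (P Q : finType) (inc : P -> Q -> bool) (n : nat) (S : {set P}) (F : {set Q}).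
Hypotheses (G : good inc n) (cS : #|S| = 4).

(** An uncrossing argument. If the neighbourhood [N] of [A] met [A'], then [N'] would meet [A].
    Minimality applied to [A :\: N'] and [A' :\: N], whose neighbourhoods avoid [A'] and [A], would
    give [#|A| + #|A'| <= #|N| + #|N'|], although each violator exceeds its neighbourhood by one. So
    [S], [N] and [A'] are disjoint sets of points, of sizes 4, [#|A| - 1] and [#|A'|]. *)
Lemma minviol_disjoint A A' : minviol inc S F A -> minviol (flipi inc) F S A' ->
  #|A| + #|A'| + 3 <= n.
Proof.
move=> mvA mvA'; have cA := minviol_card mvA; have cA' := minviol_card mvA'.
case: mvA mvA' => AF _ mA [A'S _ mA'].
pose N := outer inc S A; pose N' := outer (flipi inc) F A'.
have adj p q : inc p q -> p \in A' -> q \in A -> q \in N'.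
  by move=> pq pA' qA; apply/nbhP; exists p; rewrite // /flipi pq -in_setC (subsetP AF).
have adj' p q : inc p q -> q \in A -> p \in A' -> p \in N.
  by move=> pq qA pA'; apply/nbhP; exists q; rewrite // pq -in_setC (subsetP A'S).
have dis : N :&: A' = set0.
  apply/eqP/negPn/negP => /set0Pn[p]; rewrite inE => /andP[/nbhP[q qA /andP[pq pS]] pA'].
  have qN' := adj p q pq pA' qA.
  have pN : p \in N by apply: (adj' p q).
  have le1 : #|A :\: N'| <= #|N :\: A'|.
    apply: leq_trans (mA (A :\: N') (subsetDl _ _) _) _.
      by apply/eqP=> e; move: qA; rewrite -e inE qN'.
    apply: subset_leq_card; apply/subsetP=> u /nbhP[v]; rewrite inE => /andP[vN' vA] /andP[uv uS].
    rewrite inE; apply/andP; split; last by apply/nbhP; exists v; rewrite ?uv.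
    by apply: contra vN' => uA'; apply: (adj u).
  have le2 : #|A' :\: N| <= #|N' :\: A|.
    apply: leq_trans (mA' (A' :\: N) (subsetDl _ _) _) _.
      by apply/eqP=> e; move: pA'; rewrite -e inE pN.
    apply: subset_leq_card; apply/subsetP=> u /nbhP[v]; rewrite inE => /andP[vN vA] /andP[uv uS].
    rewrite inE; apply/andP; split; last by apply/nbhP; exists v; rewrite ?uv.
    by apply: contra vN => uA'; apply: (adj' v u).
  have := cardsID N' A; have := cardsID A' N; have := cardsID N A'; have := cardsID A N'.
  rewrite (setIC N' A) (setIC N A').
  move: le1 le2 cA cA'; rewrite -/N -/N'; lia.
have : #|S :|: (N :|: A')| <= n by rewrite -(good_card G) max_card.
have dS : S :&: (N :|: A') = set0.
  apply/setP=> p; rewrite in_set0 in_setI in_setU; apply/andP=> -[pS /orP[/nbhP[q _ /andP[_]]|/(subsetP A'S)]].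
    by rewrite pS.
  by rewrite inE pS.
rewrite cardsU dS cardsU dis !cards0 cS; move: cA; rewrite -/N; lia.
Qed.
End DualViolators.

(** * Partial configurations and refutations *)

(* The virtual machine evaluates [&&], [||] and [has] strictly, hence the lazy variants. *)
Notation "a &&& b" := (if a then b else false) (at level 40, left associativity).
Notation "a ||| b" := (if a then true else b) (at level 50, left associativity).
Fixpoint lhas (T : Type) (a : T -> bool) (s : seq T) : bool :=
  if s is x :: s' then a x ||| lhas a s' else false.
Definition nmem (x : nat) (s : seq nat) : bool := lhas (eqn x) s.
(* A partial configuration: the number of its points [0, 1, ...] and the known points of each block. *)
Definition state := (nat * seq (seq nat))%type.
Definition amap := seq (nat * nat).
Fixpoint lookup (m : amap) (k : nat) : option nat :=
  if m is (a, v) :: m' then if eqn k a then Some v else lookup m' k else None.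
Definition taken (m : amap) (v : nat) : bool := lhas (fun x => eqn v x.2) m.

Definition deg (bs : seq (seq nat)) p := count (nmem p) bs.
(** A block through [p] that already meets [b] would share two points with [b] once [p] is added,
    which is a 4-cycle. *)
Definition clash (bs : seq (seq nat)) p (b : seq nat) : bool :=
  lhas (fun b' => nmem p b' &&& lhas (fun x => nmem x b) b') bs.
Definition add_edge (t : state) p j : option state :=
  let b := nth [::] t.2 j in
  if nmem p b then Some t
  else if (2 < size b) ||| (2 < deg t.2 p) ||| clash t.2 p b then None
  else Some (t.1, set_nth [::] t.2 j (rcons b p)).

(* All ways to lay the incidences [es] over [t] consistently with the partial maps [mp] and [mb] of their
   points and blocks; every incidence should share an end with the maps or with an earlier one. *)
Section Glue.
Variable n : nat.
Fixpoint glue (es : seq (nat * nat)) (t : state) (mp mb : amap) : seq state :=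
  if es is (p, b) :: es' then
    match lookup mp p, lookup mb b with
    | Some i, Some j => if add_edge t i j is Some t' then glue es' t' mp mb else [::]
    | Some i, None =>
        flatten [seq (if taken mb j then [::] else
                 if add_edge t i j is Some t' then glue es' t' mp ((b, j) :: mb) else [::])
               | j <- iota 0 (size t.2)]
        ++ (if (deg t.2 i < 3) &&& (size t.2 < n) then
              glue es' (t.1, rcons t.2 [:: i]) mp ((b, size t.2) :: mb) else [::])
    | None, Some j =>
        flatten [seq (if taken mp i then [::] else
                 if add_edge t i j is Some t' then glue es' t' ((p, i) :: mp) mb else [::])
               | i <- iota 0 t.1]
        ++ (if (size (nth [::] t.2 j) < 3) &&& (t.1 < n) then
              glue es' (t.1.+1, set_nth [::] t.2 j (rcons (nth [::] t.2 j) t.1)) ((p, t.1) :: mp) mb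
            else [::])
    | None, None => [:: t]
    end
  else [:: t].
End Glue.

Definition pblocks (t : state) i : seq nat :=
  [seq j <- iota 0 (size t.2) | nmem i (nth [::] t.2 j)].

(** The transposed incidence lists, computed once per state so that [embt] reads off the blocks at a
    point instead of scanning. *)
Fixpoint tabulate (bs : seq (seq nat)) j (tab : seq (seq nat)) : seq (seq nat) :=
  if bs is b :: bs' then
    tabulate bs' j.+1 (foldl (fun tab p => set_nth [::] tab p (j :: nth [::] tab p)) tab b)
  else tab.
Definition ptable (t : state) : seq (seq nat) := tabulate t.2 0 [::].
Section Emb.
Variables (t : state) (pb : seq (seq nat)).
Fixpoint embt (es : seq (nat * nat)) (mp mb : amap) : bool :=
  if es is (p, b) :: es' then
    match lookup mp p, lookup mb b with
    | Some i, Some j => nmem i (nth [::] t.2 j) &&& embt es' mp mb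
    | Some i, None => lhas (fun j => if taken mb j then false else embt es' mp ((b, j) :: mb)) (nth [::] pb i)
    | None, Some j => lhas (fun i => if taken mp i then false else embt es' ((p, i) :: mp) mb) (nth [::] t.2 j)
    | None, None => lhas (fun i => if taken mp i then false else
         lhas (fun j => if taken mb j then false else embt es' ((p, i) :: mp) ((b, j) :: mb)) (nth [::] pb i)) (iota 0 t.1)
    end
  else true.
End Emb.
Definition emb es t mp mb := embt t (ptable t) es mp mb.

Definition edges_of (s : state) : seq (nat * nat) :=
  flatten [seq [seq (p, j) | p <- nth [::] s.2 j] | j <- iota 0 (size s.2)].
(* Heuristic; whatever list comes out is checked with [cover] below. *)
Fixpoint order_edges fuel (es0 es : seq (nat * nat)) (vp vb : seq nat) : seq (nat * nat) :=
  if fuel is f.+1 then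
    if es is nil then [::] else
    let both := [seq e <- es | nmem e.1 vp &&& nmem e.2 vb] in
    let one := [seq e <- es | nmem e.1 vp ||| nmem e.2 vb] in
    let free e := if nmem e.1 vp then count (fun x => eqn x.1 e.1 &&& ~~ nmem x.2 vb) es0
                  else count (fun x => eqn x.2 e.2 &&& ~~ nmem x.1 vp) es0 in
    let gain e := if nmem e.1 vp then count (fun x => eqn x.2 e.2 &&& nmem x.1 vp) es0
                  else count (fun x => eqn x.1 e.1 &&& nmem x.2 vb) es0 in
    let sc e := (3 - gain e) * 10 + free e in
    let e := if both is e :: _ then e else if one is e :: es' then
       foldl (fun a c => if sc c < sc a then c else a) e es' else head (0,0) es in
    e :: order_edges f es0 [seq x <- es | ~~ (eqn x.1 e.1 &&& eqn x.2 e.2)] (e.1 :: vp) (e.2 :: vb)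
  else [::].
Definition anchored (k : nat) (s : state) := let es := edges_of s in
  (order_edges (size es) es es (iota 0 k) (iota 0 k), k).
Definition dunion (s t : state) : state := (s.1 + t.1, s.2 ++ map (map (addn s.1)) t.2).
Definition ordered (s : state) := let es := edges_of s in order_edges (size es) es es [::] [::].

(** Within a component every incidence but the first shares an end with an earlier one, which keeps
    the embedding search narrow. Nothing is proved about the order: each list is validated by
    [cover]. *)
Fixpoint bfs fuel (t : state) (pb : seq (seq nat)) (queue : seq (bool * nat)) (sp sb dp db : seq nat) : seq (nat * nat) :=
  if fuel is f.+1 then
    match queue with
    | (true, p) :: q => let js := [seq j <- nth [::] pb p | ~~ nmem j db] in
        let nw := [seq j <- js | ~~ nmem j sb] in
        [seq (p, j) | j <- js] ++ bfs f t pb (q ++ [seq (false, j) | j <- nw]) sp (nw ++ sb) (p :: dp) db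
    | (false, j) :: q => let ps := [seq p <- nth [::] t.2 j | ~~ nmem p dp] in
        let nw := [seq p <- ps | ~~ nmem p sp] in
        [seq (p, j) | p <- ps] ++ bfs f t pb (q ++ [seq (true, p) | p <- nw]) (nw ++ sp) sb dp (j :: db)
    | [::] => if [seq i <- iota 0 t.1 | ~~ nmem i sp] is i :: _ then bfs f t pb [:: (true, i)] (i :: sp) sb dp db else [::]
    end
  else [::].
Definition bfs_edges (t : state) pb := bfs 100 t pb [::] [::] [::] [::] [::].
Definition dual (t : state) : state := (size t.2, [seq pblocks t i | i <- iota 0 t.1]).

Definition C8 := [:: [:: 0;1]; [:: 1;2]; [:: 2;3]; [:: 3;0]].
(* The ways to continue the 8-cycle C8, found by the search for Hall violators. In [RC] an [X14] hangs
   between point 1 and the block through 0 and 2. Only [PATH], [RC] and their duals can really occur. *)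
Definition PATH : state := (5, C8 ++ [:: [:: 0;2;4]; [:: 4;1;3]]).
Definition RC : state := (11, C8 ++ [:: [::0;4;2];[::4;8;5];[::5;7;6];[::6;10;4];[::7;10;8];[::8;9;6];[::9;1;7];[::10;9;5]]).
Definition T2 : state := (11, C8 ++ [:: [::0;4;2];[::4;5;1];[::5;7;6];[::6;8;4];[::7;9;8];[::8;10;5];[::9;10;6];[::10;3;7]]).
Definition X11b : state := (9, C8 ++ [:: [::0;5;4];[::4;6;1];[::5;7;6];[::6;8;2];[::7;8;4];[::8;3;5]]).
Definition UX : state := (11, C8 ++ [:: [::0;4;2];[::4;8;5];[::5;7;6];[::6;10;4];[::7;10;8];[::8;9;6];[::9;3;1];[::10;9;5]]).
(* The Fano plane minus a block; [DX13] adds distinct blocks at the three deficient points. *)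
Definition X13 : state := (7, [:: [::0;1;4];[::2;3;4];[::0;2;5];[::1;3;5];[::0;3;6];[::1;2;6]]).
Definition DX13 : state := (7, X13.2 ++ [:: [::4];[::5];[::6]]).
Definition DX13d := dual DX13.
(* The Fano plane minus an incidence. *)
Definition X14 : state := (7, X13.2 ++ [:: [::4;5]]).
(* The shift of the first four blocks keeps the 8-cycle in standard position in the dual. *)
Definition cdual (s : state) : state :=
  (size s.2, [seq pblocks s (if i < 4 then (i + 1) %% 4 else i) | i <- iota 0 s.1]).

(** Pairs of permutations of the points and the blocks of the 8-cycle. Block [i] joins the points
    [i] and [i + 1] modulo 4, so the reflection [i -> -i] of the points carries it to block
    [3 - i]. *)
Definition dihedral : seq (seq nat * seq nat) :=
  [seq (rot r [:: 0;1;2;3], rot r [:: 0;1;2;3]) | r <- iota 0 4] ++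
  [seq (rot r [:: 0;3;2;1], rot r [:: 3;2;1;0]) | r <- iota 0 4].
Definition pat_edges (s : state) : seq (nat * nat) :=
  let es := flatten [seq [seq (p, j) | p <- nth [::] s.2 j & ~~ ((p < 4) &&& (j < 4))] | j <- iota 0 (size s.2)] in
  order_edges (size es) (edges_of s) (rev es) (iota 0 4) (iota 0 4).
Definition pattern := (state * seq (nat * nat) * seq (seq nat * seq nat))%type.
Definition pat_state (pt : pattern) := pt.1.1.
Definition pat_es (pt : pattern) := pt.1.2.
Definition pat_al (pt : pattern) := pt.2.
Definition mkpat al s : pattern := (s, pat_edges s, al).
(** The alignments are representatives modulo the symmetries of each pattern: one for [PATH], four
    for [RC]. That nothing is lost is checked by [reduction_check]. *)
Definition pats2 : seq pattern :=
  [seq mkpat (take 1 dihedral) s | s <- [:: PATH; cdual PATH]] ++ [seq mkpat (take 4 dihedral) s | s <- [:: RC; cdual RC]].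
Definition pats4 := pats2 ++ [seq mkpat dihedral s | s <- [:: T2; cdual T2; X11b; cdual X11b; UX; cdual UX]].
Definition aligned (xs bs : seq nat) (r : seq nat * seq nat) : amap * amap :=
  (zip (iota 0 4) [seq nth 0 xs i | i <- r.1], zip (iota 0 4) [seq nth 0 bs i | i <- r.2]).

Definition cyc_children n (pats : seq pattern) (t : state) xs bs : seq state :=
  flatten [seq flatten [seq (let m := aligned xs bs r in glue n (pat_es pt) t m.1 m.2) | r <- pat_al pt] | pt <- pats].
Definition idm a : amap := zip (iota 0 a) (iota 0 a).
(** The known blocks at [i] enter the map without any incidence to be laid. Being taken, they force
    the incidence [(0, size L)] onto a block that is not yet known to contain [i]. *)
Definition pstar n (t : state) i := let L := pblocks t i in
  glue n [:: (0, size L)] t [:: (0, i)] (zip (iota 0 (size L)) L).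
Definition bstar n (t : state) j := let L := nth [::] t.2 j in
  glue n [:: (size L, 0)] t (zip (iota 0 (size L)) L) [:: (0, j)].
Definition isopen (t : state) d i : bool :=
  if d then (i < t.1) &&& (deg t.2 i < 3) else (i < size t.2) &&& (size (nth [::] t.2 i) < 3).
Definition is_cycle8 (t : state) xs bs : bool :=
  (size xs == 4) && (size bs == 4) && uniq xs && uniq bs &&
  all (fun k => (nth 0 xs k \in nth [::] t.2 (nth 0 bs k)) && (nth 0 xs ((k + 1) %% 4) \in nth [::] t.2 (nth 0 bs k)))
    (iota 0 4).
Definition edge_in (e : nat * nat) es := lhas (pred1 e) es.
(** A certificate for reordered lists: maps that are injective on the ends of [es] and respect [es]
    then embed [t]. The heuristics that produce the orders can remain unverified. *)
Definition cover (es : seq (nat * nat)) (t : state) : bool :=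
  all uniq t.2 && all (all (fun p => p < t.1)) t.2 &&
  all (fun e => edge_in e es) (edges_of t) &&
  all (fun p => lhas (fun e => eqn e.1 p) es) (iota 0 t.1) &&
  all (fun b => lhas (fun e => eqn e.2 b) es) (iota 0 (size t.2)).

Definition closed_state (t : state) : bool :=
  (0 < t.1) && all (fun i => deg t.2 i == 3) (iota 0 t.1) && all (fun b => size b == 3) t.2.
Definition two_coloured (c : seq bool) (b : seq nat) := has (nth false c) b && has (fun i => ~~ nth false c i) b.
Fixpoint find_colouring (bs : seq (seq nat)) k (c : seq bool) : option (seq bool) :=
  if lhas (fun b => all (fun i => i < size c) b &&& ~~ two_coloured c b) bs then None else
  if k is k'.+1 then
    if find_colouring bs k' (rcons c true) is Some c' then Some c' else find_colouring bs k' (rcons c false)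
  else Some c.
Definition orders := [:: 9; 15; 21].
(** Three ways to die: more than 21 points; closed, hence the whole connected graph, with a number
    of points that is not under consideration; closed and coloured by [find_colouring]. *)
Definition leafcheck (t : state) : bool :=
  (21 < t.1) ||| (closed_state t &&& (if nmem t.1 orders then
    (if find_colouring t.2 t.1 [::] is Some c then all (two_coloured c) t.2 else false) else true)).

Definition anchored_edges := (seq (nat * nat) * nat)%type.
Definition hit (t : state) (k : anchored_edges) : bool := embt t (ptable t) k.1 (idm k.2) (idm k.2).
(* The patterns are tried with their first incidence at [e]. *)
Definition hit_edge (ks : seq anchored_edges) (t : state) (e : nat * nat) : bool :=
  let pb := ptable t in
  lhas (fun k => if (e.1 < k.2) ||| (e.2 < k.2) then false else
    if k.1 is (p, j) :: _ then embt t pb k.1 ((p, e.1) :: idm k.2) ((j, e.2) :: idm k.2) else false) ks.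
Definition new_at (old new : seq nat) : nat := head 0 [seq x <- new | ~~ nmem x old].
(** Only occurrences of forbidden patterns through the incidence just created are looked for; this
    is a pruning of the branches, done without any step of the script. *)
Definition point_children ks (t : state) i : seq state :=
  let L := pblocks t i in
  [seq t' <- pstar 21 t i | ~~ hit_edge ks t' (i, new_at L (pblocks t' i))].
Definition block_children ks (t : state) j : seq state :=
  let L := nth [::] t.2 j in
  [seq t' <- bstar 21 t j | ~~ hit_edge ks t' (new_at L (nth [::] t'.2 j), j)].

Definition join (t : state) x y : nat := find (fun b => nmem x b &&& nmem y b) t.2.

(* A step of a refutation: branch over the further block of a point, over the further point of a block or
   over the continuations of an 8-cycle, or quote a refuted pattern, by its position among the given ones
   or among the saved ones, latest first. *)
Inductive step := Point of nat | Block of nat | Cycle of nat & nat & nat & nat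
  | Known of nat | Memo of nat | Save | Leaf.
Definition memo := seq (seq (nat * nat)).
Definition outcome := option (memo * seq step).
Fixpoint replays (f : memo -> seq step -> state -> outcome) m sc cs : outcome :=
  if cs is c :: cs' then if f m sc c is Some (m', sc') then replays f m' sc' cs' else None else Some (m, sc).

Section Replay.
Variables (auto known : seq anchored_edges) (pats : seq pattern).
Fixpoint replay fuel (m : memo) (sc : seq step) (t : state) : outcome :=
  if fuel is f.+1 then
    if sc is s :: sc' then
      match s with
      | Point i => if isopen t true i then replays (replay f) m sc' (point_children auto t i) else None
      | Block j => if isopen t false j then replays (replay f) m sc' (block_children auto t j) else None
      | Cycle x0 x1 x2 x3 =>
          let xs := [:: x0; x1; x2; x3] in let bs := [:: join t x0 x1; join t x1 x2; join t x2 x3; join t x3 x0] in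
          if is_cycle8 t xs bs then replays (replay f) m sc' (cyc_children 21 pats t xs bs) else None
      | Known i => if drop i known is k :: _ then if hit t k then Some (m, sc') else None else None
      | Memo i => if drop i m is es :: _ then if emb es t [::] [::] then Some (m, sc') else None else None
      | Save => if replay f m sc' t is Some (m', sc'') then
          let es := bfs_edges t (ptable t) in if cover es t then Some (es :: m', sc'') else None else None
      | Leaf => if leafcheck t then Some (m, sc') else None
      end
    else None
  else None.
End Replay.

Definition edge_first a (s : state) (e : nat * nat) : anchored_edges :=
  (e :: [seq x <- edges_of s | x.1 < a] ++
   [seq x <- bfs 100 s (ptable s) [:: (true, e.1); (false, e.2)] [:: e.1] [:: e.2] [::] [::] | a <= x.1], a).
(** One version of the pattern per orbit of its free incidences. If an earlier version embeds into
    [s] itself with its head at [e], this embedding is an automorphism fixing the anchored part, and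
    starting at [e] finds nothing more. *)
Definition edge_reps a (s : state) : seq anchored_edges :=
  foldl (fun acc e => if hit_edge acc s e then acc else rcons acc (edge_first a s e)) [::]
    [seq e <- edges_of s | (a <= e.1) &&& (a <= e.2)].

(* What to refute, patterns tried at each new incidence, patterns quoted by [Known], refutation. The
   number next to a pattern counts the leading points and blocks that must stay in place. *)
Definition stage := (state * (seq (nat * state) * seq (nat * state)) * seq step)%type.
Definition run_stage fuel pats (s : stage) (auto known : seq anchored_edges) : bool :=
  if replay auto known pats fuel [::] s.2 s.1.1 is Some _ then true else false.
Fixpoint pipeline pats (done : seq state) (ss : seq stage) : bool :=
  if ss is s :: ss' then
    let auto := [seq edge_reps k.1 k.2 | k <- s.1.2.1] in
    let known := [seq anchored k.1 k.2 | k <- s.1.2.2] in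
    all (fun k => k.2 \in done) (s.1.2.1 ++ s.1.2.2) &&&
    all (fun x => all (fun y => cover y.1 x.1.2) x.2) (zip s.1.2.1 auto) &&&
    all (fun x => cover x.2.1 x.1.2) (zip s.1.2.2 known) &&&
    run_stage 100 pats s (flatten auto) known &&& pipeline pats (s.1.1 :: done) ss'
  else true.

(** * Embeddings of partial configurations *)

Lemma lhasE (T : Type) (a : T -> bool) s : lhas a s = has a s.
Proof. by elim: s => //= x s ->; case: (a x). Qed.

Lemma nmemE x s : nmem x s = (x \in s).
Proof. by rewrite /nmem lhasE -has_pred1; apply: eq_has => y; rewrite /= eq_sym. Qed.

Lemma degE bs p : deg bs p = count (fun b : seq nat => p \in b) bs.
Proof. by apply: eq_count => b; rewrite nmemE. Qed.

Lemma exhaust (T : finType) (Z : {set T}) (s : seq nat) (f : nat -> T) : uniq s -> {in s &, injective f} ->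
  (forall k, k \in s -> f k \in Z) -> size s = #|Z| -> forall z, z \in Z -> exists2 k, k \in s & z = f k.
Proof.
move=> us inj sub sz' z zZ.
have us' : uniq (map f s) by rewrite map_inj_in_uniq.
have : [set x in map f s] = Z.
  apply/eqP; rewrite eqEcard; apply/andP; split.
    by apply/subsetP=> x; rewrite inE => /mapP[k /sub h ->].
  by rewrite cardsE (card_uniqP us') size_map sz'.
by move/setP/(_ z); rewrite zZ inE => /mapP[k ks ->]; exists k.
Qed.

Section Embedding.
Variables (P Q : finType) (inc : P -> Q -> bool).

(** The image may carry further incidences: a state records what is known, not what is false. *)
Record embedding (t : state) (phi : nat -> P) (psi : nat -> Q) : Prop := Embedding {
  emb_inj_pt : forall i j, i < t.1 -> j < t.1 -> phi i = phi j -> i = j;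
  emb_inj_bl : forall i j, i < size t.2 -> j < size t.2 -> psi i = psi j -> i = j;
  emb_uniq : forall j, uniq (nth [::] t.2 j);
  emb_inc : forall i j, i \in nth [::] t.2 j -> i < t.1 /\ inc (phi i) (psi j) }.

Lemma nth_in_size (t : state) i j : i \in nth [::] t.2 j -> j < size t.2.
Proof. by case: (ltnP j (size t.2)) => // h; rewrite nth_default. Qed.

Variable n : nat.
Hypothesis G : good inc n.

Lemma embedding_card_pt t phi psi : embedding t phi psi -> t.1 <= n.
Proof.
move=> e; rewrite -(good_card G) -(size_iota 0 t.1) -(size_map phi).
rewrite -(card_uniqP _) ?max_card // map_inj_in_uniq ?iota_uniq // => i j.
by rewrite !mem_iota /= !add0n; apply: (emb_inj_pt e).
Qed.

Lemma embedding_card_bl t phi psi : embedding t phi psi -> size t.2 <= n.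
Proof.
move=> e; rewrite -(good_card G) (card_sides (good_cubic G)) -(size_iota 0 (size t.2)) -(size_map psi).
rewrite -(card_uniqP _) ?max_card // map_inj_in_uniq ?iota_uniq // => i j.
by rewrite !mem_iota /= !add0n; apply: (emb_inj_bl e).
Qed.

Lemma embedding_star t phi psi i (J : seq nat) : embedding t phi psi -> uniq J ->
  (forall j, j \in J -> j < size t.2 /\ inc (phi i) (psi j)) -> size J <= 3.
Proof.
move=> e uJ hJ; rewrite -((good_cubic G).2 (phi i)) -(size_map psi).
rewrite -(card_uniqP _); last first.
  by rewrite map_inj_in_uniq // => j k /hJ[? _] /hJ[? _]; apply: (emb_inj_bl e).
by apply/subset_leq_card/subsetP => q /mapP[j /hJ[_ h] ->]; rewrite inE.
Qed.

Lemma embedding_line t phi psi j (I : seq nat) : embedding t phi psi -> uniq I ->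
  (forall i, i \in I -> i < t.1 /\ inc (phi i) (psi j)) -> size I <= 3.
Proof.
move=> e uI hI; rewrite -((good_cubic G).1 (psi j)) -(size_map phi).
rewrite -(card_uniqP _); last first.
  by rewrite map_inj_in_uniq // => i k /hI[? _] /hI[? _]; apply: (emb_inj_pt e).
by apply/subset_leq_card/subsetP => q /mapP[i /hI[_ h] ->]; rewrite inE.
Qed.

Lemma deg_pblocks t i : deg t.2 i = size (pblocks t i).
Proof.
rewrite /pblocks size_filter degE -{1}(mkseq_nth [::] t.2) /mkseq count_map.
by apply: eq_in_count => j _ /=; rewrite nmemE.
Qed.

Lemma uniq_pblocks t i : uniq (pblocks t i).
Proof. by rewrite filter_uniq ?iota_uniq. Qed.

Lemma mem_pblocks t i j : (j \in pblocks t i) = (i \in nth [::] t.2 j).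
Proof.
rewrite mem_filter nmemE mem_iota /= add0n; case: (boolP (i \in _)) => //= h.
by rewrite (nth_in_size h).
Qed.

Lemma full_block t phi psi j p : embedding t phi psi -> size (nth [::] t.2 j) = 3 -> inc p (psi j) ->
  exists2 i, i \in nth [::] t.2 j & p = phi i.
Proof.
move=> e s3 pj; apply: (exhaust (Z := pts inc (psi j)) (emb_uniq e j)); rewrite ?inE ?(good_cubic G).1 //.
  by move=> i k /(emb_inc e)[? _] /(emb_inc e)[? _]; apply: (emb_inj_pt e).
by move=> k /(emb_inc e)[_]; rewrite inE.
Qed.

Lemma full_point t phi psi i q : embedding t phi psi -> size (pblocks t i) = 3 -> inc (phi i) q ->
  exists2 j, j \in pblocks t i & q = psi j.
Proof.
move=> e s3 iq; apply: (exhaust (Z := bls inc (phi i)) (uniq_pblocks t i)); rewrite ?inE ?(good_cubic G).2 //.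
  by move=> j k; rewrite !mem_pblocks => /nth_in_size ? /nth_in_size ?; apply: (emb_inj_bl e).
by move=> k; rewrite mem_pblocks => /(emb_inc e)[_]; rewrite inE.
Qed.

Lemma embedding_rcons t phi psi i j : embedding t phi psi ->
  i < t.1 -> j < size t.2 -> i \notin nth [::] t.2 j -> inc (phi i) (psi j) ->
  embedding (t.1, set_nth [::] t.2 j (rcons (nth [::] t.2 j) i)) phi psi.
Proof.
move=> e li lj ni ij.
have sz : size (set_nth [::] t.2 j (rcons (nth [::] t.2 j) i)) = size t.2.
  by rewrite size_set_nth; apply/maxn_idPr.
split=> /=; rewrite ?sz; try by case: e.
  move=> k; rewrite nth_set_nth /=; case: eqP => _; last exact: (emb_uniq e).
  by rewrite rcons_uniq ni (emb_uniq e).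
move=> k l; rewrite nth_set_nth /=; case: eqP => [->|_]; last exact: (emb_inc e).
by rewrite mem_rcons inE => /orP[/eqP->|/(emb_inc e)].
Qed.

(** The tests of [add_edge] reject only a fourth point on a block, a fourth block at a point or a
    4-cycle, and none of these can come from an incidence of the actual graph. *)
Lemma add_edge_sound t phi psi i j : embedding t phi psi ->
  i < t.1 -> j < size t.2 -> inc (phi i) (psi j) ->
  exists t', [/\ add_edge t i j = Some t', t'.1 = t.1, size t'.2 = size t.2 & embedding t' phi psi].
Proof.
move=> e li lj ij; rewrite /add_edge nmemE; case: ifPn => [_|ni]; first by exists t.
have -> : (2 < size (nth [::] t.2 j)) = false.
  apply/negbTE; rewrite -leqNgt; have := @embedding_line t phi psi j (i :: nth [::] t.2 j) e.
  rewrite /= ni (emb_uniq e) => /(_ isT) h; apply: h => k.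
  by rewrite inE => /orP[/eqP->|/(emb_inc e)].
have -> : (2 < deg t.2 i) = false.
  apply/negbTE; rewrite -leqNgt deg_pblocks; have := @embedding_star t phi psi i (j :: pblocks t i) e.
  rewrite /= mem_pblocks ni uniq_pblocks => /(_ isT) h; apply: h => k.
  rewrite inE mem_pblocks => /orP[/eqP->//|h]; split; first exact: nth_in_size h.
  by have [] := emb_inc e h.
have -> : clash t.2 i (nth [::] t.2 j) = false.
  apply/negbTE/negP; rewrite /clash lhasE => /(has_nthP [::])[k lk].
  rewrite nmemE; case: ifP => // ik; rewrite lhasE => /hasP[x xk]; rewrite nmemE => xj.
  have kj : k != j by apply: contra ni => /eqP<-.
  have ix : i != x by apply: contra ni => /eqP->.
  have [lx ixk] := emb_inc e xk; have [_ iik] := emb_inc e ik; have [_ ixj] := emb_inc e xj.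
  apply: (good_linear G (x := phi i) (y := phi x) (q1 := psi k) (q2 := psi j)) => //.
    by apply: contra ix => /eqP/(emb_inj_pt e li lx)->.
  by apply: contra kj => /eqP/(emb_inj_bl e lk lj)->.
eexists; split; first reflexivity.
- by [].
- by rewrite /= size_set_nth; apply/maxn_idPr.
- exact: embedding_rcons.
Qed.
End Embedding.

Lemma lookup_mem m k v : lookup m k = Some v -> (k, v) \in m.
Proof.
elim: m => //= -[a w] m IH; case: ifP => [/eqnP->[->]|_ /IH h]; first by rewrite inE eqxx.
by rewrite inE h orbT.
Qed.

Lemma lookup_None m k v : lookup m k = None -> (k, v) \notin m.
Proof.
elim: m => //= -[a w] m IH; case: ifP => // /eqnP ka /IH; rewrite inE negb_or => ->.
by rewrite andbT xpair_eqE; apply/negP=> /andP[/eqP/ka].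
Qed.

Lemma takenP m v : reflect (exists k, (k, v) \in m) (taken m v).
Proof.
rewrite /taken lhasE; apply: (iffP hasP) => [[[k w] h /= /eqnP->]|[k h]]; first by exists k.
by exists (k, v) => //=; apply/eqnP.
Qed.

Section GlueSound.
Variables (P Q : finType) (inc : P -> Q -> bool) (n N : nat).
Hypotheses (G : good inc n) (nN : n <= N).
Variables (alpha : nat -> P) (beta : nat -> Q) (Dp Db : pred nat).
Hypotheses (inja : {in Dp &, injective alpha}) (injb : {in Db &, injective beta}).

Definition agrees_pt (t : state) phi (mp : amap) :=
  forall k v, (k, v) \in mp -> [/\ Dp k, v < t.1 & phi v = alpha k].
Definition agrees_bl (t : state) psi (mb : amap) :=
  forall k v, (k, v) \in mb -> [/\ Db k, v < size t.2 & psi v = beta k].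

(** Completeness of the branching: if the pattern really occurs, along [alpha] and [beta], then
    following its actual images through [t] singles out one branch that is again embedded. The
    predicates [Dp] and [Db] delimit the names on which [alpha] and [beta] are injective. *)
Lemma glue_sound es t phi psi mp mb : embedding inc t phi psi ->
  agrees_pt t phi mp -> agrees_bl t psi mb ->
  (forall p b, (p, b) \in es -> [/\ Dp p, Db b & inc (alpha p) (beta b)]) ->
  exists t' phi' psi', t' \in glue N es t mp mb /\ embedding inc t' phi' psi'.
Proof.
elim: es t phi psi mp mb => [|[p b] es IH] t phi psi mp mb e ap ab hes.
  by exists t, phi, psi; rewrite inE eqxx.
have [Dpp Dbb ipb] := hes p b (mem_head _ _).
have {}hes : forall p b, (p, b) \in es -> [/\ Dp p, Db b & inc (alpha p) (beta b)].
  by move=> p' b' h; apply: hes; rewrite inE h orbT.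
rewrite /=; destruct (lookup mp p) as [i|] eqn:lp; destruct (lookup mb b) as [j|] eqn:lb.
- have [_ li ei] := ap _ _ (lookup_mem lp); have [_ lj ej] := ab _ _ (lookup_mem lb).
  have [|t' [-> s1 s2 e']] := add_edge_sound G e li lj; first by rewrite ei ej.
  apply: (IH t' phi psi mp mb e') => //.
    by move=> k v /ap; rewrite s1.
  by move=> k v /ab; rewrite s2.
- have [_ li ei] := ap _ _ (lookup_mem lp).
  (* Either the image of [b] is the image of a known block, which cannot be taken since [beta] is
     injective, or it is new and is appended to the state. *)
  have [/hasP[j]|none] := boolP (has (fun j => psi j == beta b) (iota 0 (size t.2))).
    rewrite mem_iota /= add0n => lj /eqP ej.
    have nt : taken mb j = false.
      apply/negP=> /takenP[k hk]; have [Dk _ ek] := ab _ _ hk.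
      by have := lookup_None j lb; rewrite -(injb Dk Dbb) ?hk // -ek ej.
    have [|t' [ea s1 s2 e']] := add_edge_sound G e li lj; first by rewrite ei ej.
    have [|||t'' [phi' [psi' [h'' e'']]]] := IH t' phi psi mp ((b, j) :: mb) e'.
    + by move=> k v /ap; rewrite s1.
    + by move=> k v; rewrite inE s2 => /orP[/eqP[-> ->]|/ab].
    + by [].
    exists t'', phi', psi'; split=> //; rewrite mem_cat; apply/orP; left.
    apply/flattenP; exists (glue N es t' mp ((b, j) :: mb)) => //.
    by apply/mapP; exists j; rewrite ?mem_iota ?nt ?ea.
  pose psi' j := if j == size t.2 then beta b else psi j.
  have psi'E j : j < size t.2 -> psi' j = psi j by rewrite /psi'; case: eqP => // ->; rewrite ltnn.
  have psi'n j : j < size t.2 -> psi j <> beta b.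
    by move=> lj ej; move/hasPn: none => /(_ j); rewrite mem_iota add0n lj ej eqxx => /(_ isT).
  have e' : embedding inc (t.1, rcons t.2 [:: i]) phi psi'.
    split=> /=; first by case: e.
    - move=> j k; rewrite size_rcons !ltnS leq_eqVlt => /orP[/eqP->|lj]; rewrite leq_eqVlt => /orP[/eqP->|lk] //.
      + by rewrite (psi'E k lk) /psi' eqxx => h; case: (psi'n k).
      + by rewrite (psi'E j lj) /psi' eqxx => h; case: (psi'n j).
      + by rewrite !psi'E //; apply: (emb_inj_bl e).
    - move=> j; rewrite nth_rcons; case: ifP => _; first exact: (emb_uniq e).
      by case: ifP.
    - move=> k j; rewrite nth_rcons; case: ifP => lj; first by rewrite psi'E //; apply: (emb_inc e).
      case: eqP => // ->; rewrite inE => /eqP->; split=> //.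
      by rewrite /psi' eqxx ei.
  have ldeg : deg t.2 i < 3.
    have := @embedding_star _ _ _ _ G _ phi psi' i (rcons (pblocks t i) (size t.2)) e'.
    rewrite size_rcons -deg_pblocks; apply.
      rewrite rcons_uniq uniq_pblocks andbT mem_pblocks nth_default //.
    move=> j; rewrite mem_rcons inE mem_pblocks /= size_rcons => /orP[/eqP->|h].
      by rewrite ltnSn /psi' eqxx ei.
    have lj := nth_in_size h; rewrite psi'E //; split; first by rewrite ltnS ltnW.
    by have [] := emb_inc e h.
  have lsz : size t.2 < N by apply: leq_trans nN; have := embedding_card_bl G e'; rewrite /= size_rcons.
  have [|||t'' [phi' [psi'' [h'' e'']]]] := IH _ phi psi' mp ((b, size t.2) :: mb) e'.
  + by move=> k v /ap.
  + move=> k v; rewrite inE /= size_rcons => /orP[/eqP[-> ->]|/ab[h1 h2 h3]]; first by rewrite ltnSn /psi' eqxx.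
    by rewrite psi'E // ltnS ltnW.
  + by [].
  by exists t'', phi', psi''; split=> //; rewrite mem_cat ldeg lsz h'' orbT.
- have [_ lj ej] := ab _ _ (lookup_mem lb).
  have [/hasP[i]|none] := boolP (has (fun i => phi i == alpha p) (iota 0 t.1)).
    rewrite mem_iota /= add0n => li /eqP ei.
    have nt : taken mp i = false.
      apply/negP=> /takenP[k hk]; have [Dk _ ek] := ap _ _ hk.
      by have := lookup_None i lp; rewrite -(inja Dk Dpp) ?hk // -ek ei.
    have [|t' [ea s1 s2 e']] := add_edge_sound G e li lj; first by rewrite ei ej.
    have [|||t'' [phi' [psi' [h'' e'']]]] := IH t' phi psi ((p, i) :: mp) mb e'.
    + by move=> k v; rewrite inE s1 => /orP[/eqP[-> ->]|/ap].
    + by move=> k v /ab; rewrite s2.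
    + by [].
    exists t'', phi', psi'; split=> //; rewrite mem_cat; apply/orP; left.
    apply/flattenP; exists (glue N es t' ((p, i) :: mp) mb) => //.
    by apply/mapP; exists i; rewrite ?mem_iota ?nt ?ea.
  pose phi' i := if i == t.1 then alpha p else phi i.
  have phi'E i : i < t.1 -> phi' i = phi i by rewrite /phi'; case: eqP => // ->; rewrite ltnn.
  have phi'n i : i < t.1 -> phi i <> alpha p.
    by move=> li ei; move/hasPn: none => /(_ i); rewrite mem_iota add0n li ei eqxx => /(_ isT).
  have e0 : embedding inc (t.1.+1, t.2) phi' psi.
    split=> /=; try by case: e.
    - move=> i k; rewrite !ltnS leq_eqVlt => /orP[/eqP->|li]; rewrite leq_eqVlt => /orP[/eqP->|lk] //.
      + by rewrite (phi'E k lk) /phi' eqxx => h; case: (phi'n k).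
      + by rewrite (phi'E i li) /phi' eqxx => h; case: (phi'n i).
      + by rewrite !phi'E //; apply: (emb_inj_pt e).
    - by move=> i k /(emb_inc e)[li]; rewrite phi'E // => ?; split=> //; apply: ltnW.
  have nin : t.1 \notin nth [::] t.2 j by apply/negP=> /(emb_inc e)[]; rewrite ltnn.
  have ip : inc (phi' t.1) (psi j) by rewrite /phi' eqxx ej.
  have e' := embedding_rcons e0 (ltnSn t.1 : t.1 < (t.1.+1, t.2).1) lj nin ip.
  have lsz : size (nth [::] t.2 j) < 3.
    have := @embedding_line _ _ _ _ G _ phi' psi j (t.1 :: nth [::] t.2 j) e0.
    rewrite /= nin (emb_uniq e) => /(_ isT); apply=> k; rewrite inE => /orP[/eqP->//|/(emb_inc e0)//].
  have lt : t.1 < N by apply: leq_trans nN; have := embedding_card_pt G e'.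
  have [|||t'' [phi'' [psi'' [h'' e'']]]] := IH _ phi' psi ((p, t.1) :: mp) mb e'.
  + move=> k v; rewrite inE /= => /orP[/eqP[-> ->]|/ap[h1 h2 h3]]; first by rewrite ltnSn /phi' eqxx.
    by rewrite phi'E // ltnS ltnW.
  + move=> k v /ab /=; rewrite size_set_nth; suff -> : maxn j.+1 (size t.2) = size t.2 by [].
    exact/maxn_idPr.
  + by [].
  by exists t'', phi'', psi''; split=> //; rewrite mem_cat lsz lt h'' orbT.
- by exists t, phi, psi; rewrite inE eqxx.
Qed.
End GlueSound.

(** * Finding a pattern inside a partial configuration *)

Definition injmap (m : amap) := forall k k' v, lookup m k = Some v -> lookup m k' = Some v -> k = k'.
Definition extmap (m m' : amap) := forall k v, lookup m k = Some v -> lookup m' k = Some v.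

Lemma injmap_cons m k v : injmap m -> ~~ taken m v -> injmap ((k, v) :: m).
Proof.
move=> im nt a a' w /=.
have h x : lookup m x <> Some v by move/lookup_mem => hx; case/takenP: nt; exists x.
case: eqnP => [->|_]; case: eqnP => [->|_] //.
- by move=> [<-] /h.
- by move=> + [e]; rewrite -e => /h.
- exact: im.
Qed.

Lemma extmap_cons m k v : lookup m k = None -> extmap m ((k, v) :: m).
Proof. by move=> h a w /=; case: eqnP => // ->; rewrite h. Qed.

Lemma mem_tabulate bs j0 tab i j : j \in nth [::] (tabulate bs j0 tab) i ->
  j \in nth [::] tab i \/ j0 <= j /\ i \in nth [::] bs (j - j0).
Proof.
elim: bs j0 tab => [|b bs IH] j0 tab /=; first by left.
case/IH => [|[lj ij]]; last by right; split; [exact: ltnW|rewrite (_ : j - j0 = (j - j0.+1).+1) //; lia].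
suff h b' : j \in nth [::] (foldl (fun tab p => set_nth [::] tab p (j0 :: nth [::] tab p)) tab b') i ->
    j \in nth [::] tab i \/ j = j0 /\ i \in b'.
  by case/h => [|[-> ib]]; [left|right; rewrite subnn].
elim: b' tab => [|p b' IHb] tab /=; first by left.
case/IHb => [|[-> ib]]; last by right; rewrite inE ib orbT.
rewrite nth_set_nth /=; case: eqP => [->|_]; last by left.
by rewrite inE => /orP[/eqP->|]; [right; rewrite mem_head|left].
Qed.

Lemma mem_ptable t i j : j \in nth [::] (ptable t) i -> i \in nth [::] t.2 j.
Proof. by case/mem_tabulate => [|[_]]; rewrite ?nth_nil ?subn0. Qed.

Lemma emb_sound es t mp mb : injmap mp -> injmap mb -> emb es t mp mb ->
  exists mp' mb', [/\ injmap mp', injmap mb', extmap mp mp', extmap mb mb' &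
    forall p b, (p, b) \in es -> exists i j,
      [/\ lookup mp' p = Some i, lookup mb' b = Some j & i \in nth [::] t.2 j]].
Proof.
rewrite /emb; elim: es mp mb => [|[p b] es IH] mp mb ip ib; first by exists mp, mb; split.
have step mp1 mb1 i j : injmap mp1 -> injmap mb1 -> extmap mp mp1 -> extmap mb mb1 ->
    lookup mp1 p = Some i -> lookup mb1 b = Some j -> i \in nth [::] t.2 j -> embt t (ptable t) es mp1 mb1 ->
    exists mp' mb', [/\ injmap mp', injmap mb', extmap mp mp', extmap mb mb' &
    forall p' b', (p', b') \in (p, b) :: es -> exists i j,
      [/\ lookup mp' p' = Some i, lookup mb' b' = Some j & i \in nth [::] t.2 j]].
  move=> ip1 ib1 xp1 xb1 lp lb ij /(IH _ _ ip1 ib1)[mp' [mb' [h1 h2 h3 h4 h5]]].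
  exists mp', mb'; split=> //; try by move=> k v /xp1/h3; try by move=> k v /xb1/h4.
    by move=> k v /xb1/h4.
  move=> p' b'; rewrite inE => /orP[/eqP[-> ->]|/h5 //].
  by exists i, j; rewrite (h3 _ _ lp) (h4 _ _ lb).
rewrite /=; destruct (lookup mp p) as [i|] eqn:lp; destruct (lookup mb b) as [j|] eqn:lb.
- by case: ifP => //; rewrite nmemE => ij; apply: (step mp mb i j).
- rewrite lhasE => /hasP[j /mem_ptable ij]; case: ifPn => // nt.
  apply: (step mp ((b, j) :: mb) i j) => //; first exact: injmap_cons.
    exact: extmap_cons.
  by rewrite /= (introT eqnP).
- rewrite lhasE => /hasP[i ij]; case: ifPn => // nt.
  apply: (step ((p, i) :: mp) mb i j) => //; first exact: injmap_cons.
    exact: extmap_cons.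
  by rewrite /= (introT eqnP).
- rewrite lhasE => /hasP[i _]; case: ifPn => // nt.
  rewrite lhasE => /hasP[j /mem_ptable ij]; case: ifPn => // nt'.
  apply: (step ((p, i) :: mp) ((b, j) :: mb) i j) => //; try exact: injmap_cons; try exact: extmap_cons.
    by rewrite /= (introT eqnP).
  by rewrite /= (introT eqnP).
Qed.

Lemma edges_ofP (t : state) p j : ((p, j) \in edges_of t) = (p \in nth [::] t.2 j).
Proof.
apply/flatten_mapP/idP => [[k]|h].
  by rewrite mem_iota add0n => lk /mapP[x xk [-> ->]].
by exists j; [rewrite mem_iota add0n (nth_in_size h)|apply/mapP; exists p].
Qed.

Lemma cover_embedding (P Q : finType) (inc : P -> Q -> bool) es t (alpha : nat -> P) (beta : nat -> Q) :
  cover es t -> {in [seq e.1 | e <- es] &, injective alpha} -> {in [seq e.2 | e <- es] &, injective beta} ->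
  (forall p b, (p, b) \in es -> inc (alpha p) (beta b)) -> embedding inc t alpha beta.
Proof.
case/andP=> /andP[/andP[/andP[/allP un /allP rng] /allP ed] /allP pc] /allP bc ia ib he; split.
- move=> i j li lj; apply: ia.
    have := pc i; rewrite mem_iota add0n => /(_ li); rewrite lhasE => /hasP[e ee /eqnP<-].
    by apply: map_f.
  have := pc j; rewrite mem_iota add0n => /(_ lj); rewrite lhasE => /hasP[e ee /eqnP<-].
  by apply: map_f.
- move=> i j li lj; apply: ib.
    have := bc i; rewrite mem_iota add0n => /(_ li); rewrite lhasE => /hasP[e ee /eqnP<-].
    by apply: map_f.
  have := bc j; rewrite mem_iota add0n => /(_ lj); rewrite lhasE => /hasP[e ee /eqnP<-].
  by apply: map_f.
- move=> j; case: (ltnP j (size t.2)) => lj; last by rewrite nth_default.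
  by apply: un; apply: mem_nth.
- move=> i j ij; have lj := nth_in_size ij; split.
    by have /rng/allP/(_ i ij) : nth [::] t.2 j \in t.2 by apply: mem_nth.
  apply: he; have := ed (i, j); rewrite edges_ofP => /(_ ij).
  by rewrite /edge_in lhasE has_pred1.
Qed.

Lemma emb_maps (P Q : finType) (inc : P -> Q -> bool) es t mp mb phi psi :
  injmap mp -> injmap mb -> emb es t mp mb -> embedding inc t phi psi ->
  exists alpha beta, [/\ {in [seq e.1 | e <- es] &, injective alpha}, {in [seq e.2 | e <- es] &, injective beta},
    forall p b, (p, b) \in es -> inc (alpha p) (beta b),
    forall k v, lookup mp k = Some v -> alpha k = phi v &
    forall k v, lookup mb k = Some v -> beta k = psi v].
Proof.
move=> ip ib /(emb_sound ip ib)[mp' [mb' [ip' ib' xp xb h]]] e.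
exists (fun k => phi (odflt 0 (lookup mp' k))), (fun k => psi (odflt 0 (lookup mb' k))); split.
- move=> x y /mapP[[a b] ha ->] /mapP[[c d] hc ->] /=.
  have [i [j [l1 l2 ij]]] := h _ _ ha; have [k [l [l3 l4 kl]]] := h _ _ hc.
  rewrite l1 l3 /= => /(emb_inj_pt e) ik; apply: (ip' _ _ i) => //; rewrite l3 ik //.
    by have [] := emb_inc e ij.
  by have [] := emb_inc e kl.
- move=> x y /mapP[[a b] ha ->] /mapP[[c d] hc ->] /=.
  have [i [j [l1 l2 ij]]] := h _ _ ha; have [k [l [l3 l4 kl]]] := h _ _ hc.
  rewrite l2 l4 /= => /(emb_inj_bl e) ik; apply: (ib' _ _ j) => //; rewrite l4 ik //.
    exact: nth_in_size ij.
  exact: nth_in_size kl.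
- move=> p b hpb; have [i [j [-> -> ij]]] := h _ _ hpb.
  by have [] := emb_inc e ij.
- by move=> k v /xp->.
- by move=> k v /xb->.
Qed.

(** * Soundness of the steps of a refutation *)

Section Refute.
Variables (P Q : finType) (inc : P -> Q -> bool) (n : nat).
Hypothesis G : good inc n.
Variable Goal : Prop.

(** Nonoccurrence up to [Goal]: an occurrence of [t] is allowed if it already yields the desired
    conclusion. *)
Definition refuted t := forall phi psi, embedding inc t phi psi -> Goal.
Definition refuted_es (es : seq (nat * nat)) := forall (alpha : nat -> P) (beta : nat -> Q),
  {in [seq e.1 | e <- es] &, injective alpha} -> {in [seq e.2 | e <- es] &, injective beta} ->
  (forall p b, (p, b) \in es -> inc (alpha p) (beta b)) -> Goal.

Lemma cover_refuted es t : cover es t -> refuted t -> refuted_es es.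
Proof. by move=> ct rt alpha beta ia ib he; exact: rt _ _ (cover_embedding ct ia ib he). Qed.

Lemma emb_refuted es t mp mb : injmap mp -> injmap mb ->
  emb es t mp mb -> refuted_es es -> refuted t.
Proof.
by move=> ip ib em r phi psi /(emb_maps ip ib em)[alpha [beta [ia ib' he _ _]]]; apply: r he.
Qed.

Lemma lookup_idm a k v : lookup (idm a) k = Some v -> k = v.
Proof.
move/lookup_mem; rewrite /idm; elim: (iota 0 a) => //= x s IH.
by rewrite inE => /orP[/eqP[-> ->]|/IH].
Qed.

Lemma injmap_idm a : injmap (idm a).
Proof. by move=> k k' v /lookup_idm-> /lookup_idm->. Qed.

(** No edge leaves the image of a cubic state, so by connectedness the image is everything. *)
Lemma closed_onto t phi psi : closed_state t -> embedding inc t phi psi ->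
  (forall p, exists2 i, i < t.1 & phi i = p) /\ (forall q, exists2 j, j < size t.2 & psi j = q).
Proof.
case/andP=> /andP[np /allP dg] /allP sz e.
pose X := [set p | has (fun i => phi i == p) (iota 0 t.1)].
pose Y := [set q | has (fun j => psi j == q) (iota 0 (size t.2))].
have XP p : reflect (exists2 i, i < t.1 & phi i = p) (p \in X).
  rewrite inE; apply: (iffP hasP) => [[i]|[i li <-]]; first by rewrite mem_iota add0n => li /eqP<-; exists i.
  by exists i; rewrite ?mem_iota ?add0n.
have YP q : reflect (exists2 j, j < size t.2 & psi j = q) (q \in Y).
  rewrite inE; apply: (iffP hasP) => [[i]|[i li <-]]; first by rewrite mem_iota add0n => li /eqP<-; exists i.
  by exists i; rewrite ?mem_iota ?add0n.
have [XT YT] : X = setT /\ Y = setT.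
  apply: (good_conn G); last first.
    by apply/orP; left; apply/set0Pn; exists (phi 0); apply/XP; exists 0.
  move=> p q pq; apply/XP/YP => [[i li ei]|[j lj ej]].
    have [||j ji ->] := @full_point _ _ _ _ G t phi psi i q e.
    - by rewrite -deg_pblocks; apply/eqP/dg; rewrite mem_iota add0n.
    - by rewrite ei.
    by exists j => //; move: ji; rewrite mem_pblocks => /nth_in_size.
  have [||i ij ->] := @full_block _ _ _ _ G t phi psi j p e.
  - by apply/eqP/sz; apply: mem_nth.
  - by rewrite ej.
  by exists i => //; have [] := emb_inc e ij.
by split=> [p|q]; [apply/XP; rewrite XT|apply/YP; rewrite YT].
Qed.

Hypothesis n_orders : n \in orders.

Let n21 : n <= 21. Proof. by move: n_orders; rewrite !inE => /or3P[]/eqP->. Qed.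

Lemma leafcheck_sound t : leafcheck t -> refuted t.
Proof.
rewrite /leafcheck; case: ltnP => [lt _ phi psi e|_].
  by have := leq_trans (leq_trans lt (embedding_card_pt G e)) n21; rewrite ltnn.
case: ifP => // ct; rewrite nmemE; case: ifPn => [tn h|tn _ phi psi e]; last first.
  case/negP: tn; have [onto _] := closed_onto ct e.
  suff -> : t.1 = n by [].
  apply/eqP; rewrite eqn_leq (embedding_card_pt G e) /= -(good_card G).
  have -> : #|P| = #|[set x in map phi (iota 0 t.1)]|.
    rewrite -cardsT; congr #|pred_of_set _|; apply/setP=> p; rewrite !inE; apply/esym/mapP.
    by have [i li <-] := onto p; exists i; rewrite ?mem_iota ?add0n.
  by rewrite cardsE (leq_trans (card_size _)) // size_map size_iota.
move: h; case: find_colouring => // c /allP hc phi psi e; case: (good_ncol G).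
have [onto ontob] := closed_onto ct e.
pose f p := has (fun i => (phi i == p) && nth false c i) (iota 0 t.1).
have fE i : i < t.1 -> f (phi i) = nth false c i.
  move=> li; apply/hasP/idP => [[k]|ci]; last by exists i; rewrite ?mem_iota ?add0n ?eqxx.
  by rewrite mem_iota add0n => lk /andP[/eqP/(emb_inj_pt e lk li)->].
exists f => q; have [j lj <-] := ontob q.
have /hc/andP[/hasP[a aj ca] /hasP[b bj cb]] : nth [::] t.2 j \in t.2 by apply: mem_nth.
have [la ia] := emb_inc e aj; have [lb ib] := emb_inc e bj.
apply/bichromP; exists (phi a), (phi b); split; rewrite ?inE // !fE // ca.
by move: cb; case: nth.
Qed.

Lemma pstar_sound t i phi psi : embedding inc t phi psi -> isopen t true i ->
  exists t' phi' psi', t' \in pstar 21 t i /\ embedding inc t' phi' psi'.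
Proof.
move=> e; rewrite /isopen; case: ifP => // li dg; rewrite /pstar.
set L := pblocks t i.
have [q qi qn] : exists2 q, inc (phi i) q & forall j, j \in L -> psi j != q.
  have : exists2 q, q \in bls inc (phi i) & q \notin [set x in map psi L].
    apply/subsetPn/negP => /subset_leq_card; rewrite (good_cubic G).2 cardsE.
    move=> h; have := leq_trans h (card_size _); rewrite size_map.
    by move: dg; rewrite deg_pblocks -/L; lia.
  case=> q; rewrite !inE => qi /mapP qn; exists q => // j jL; apply/eqP=> ej.
  by apply: qn; exists j.
pose beta k := if k < size L then psi (nth 0 L k) else q.
have Lin k : k < size L -> nth 0 L k \in L by apply: mem_nth.
apply: (@glue_sound _ _ _ _ 21 G n21 (fun=> phi i) beta (pred1 0) (fun k => k <= size L) _ _ _ _ phi psi _ _ e).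
- by move=> x y; rewrite !inE => /eqP-> /eqP->.
- move=> x y lx ly; rewrite /beta; case: ltnP => hx; case: ltnP => hy.
  + move/(emb_inj_bl e) => h; apply/eqP; rewrite -(nth_uniq 0 hx hy (uniq_pblocks _ _)); apply/eqP/h.
      by have := Lin x hx; rewrite mem_pblocks => /nth_in_size.
    by have := Lin y hy; rewrite mem_pblocks => /nth_in_size.
  + by move=> h; have := qn _ (Lin x hx); rewrite h eqxx.
  + by move=> h; have := qn _ (Lin y hy); rewrite h eqxx.
  + by move: lx ly hx hy; rewrite /in_mem /=; lia.
- by move=> k v; rewrite inE => /eqP[-> ->].
- move=> k v /(nthP (0,0))[x]; rewrite size_zip size_iota minnn => lx.
  rewrite nth_zip ?size_iota // nth_iota // add0n => -[<- <-].
  rewrite /beta lx; split=> //; first exact: ltnW.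
  by have := Lin x lx; rewrite mem_pblocks => /nth_in_size.
- by move=> p b; rewrite inE => /eqP[-> ->]; rewrite /beta ltnn; split; rewrite /= ?eqxx ?leqnn.
Qed.

Lemma bstar_sound t j phi psi : embedding inc t phi psi -> isopen t false j ->
  exists t' phi' psi', t' \in bstar 21 t j /\ embedding inc t' phi' psi'.
Proof.
move=> e; rewrite /isopen; case: ifP => // lj dg; rewrite /bstar.
set L := nth [::] t.2 j.
have [q qi qn] : exists2 q, inc q (psi j) & forall i, i \in L -> phi i != q.
  have : exists2 q, q \in pts inc (psi j) & q \notin [set x in map phi L].
    apply/subsetPn/negP => /subset_leq_card; rewrite (good_cubic G).1 cardsE.
    move=> h; have := leq_trans h (card_size _); rewrite size_map.
    by move: dg; rewrite -/L; lia.
  case=> q; rewrite !inE => qi /mapP qn; exists q => // i iL; apply/eqP=> ei.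
  by apply: qn; exists i.
pose alpha k := if k < size L then phi (nth 0 L k) else q.
have Lin k : k < size L -> nth 0 L k \in L by apply: mem_nth.
apply: (@glue_sound _ _ _ _ 21 G n21 alpha (fun=> psi j) (fun k => k <= size L) (pred1 0) _ _ _ _ phi psi _ _ e).
- move=> x y lx ly; rewrite /alpha; case: ltnP => hx; case: ltnP => hy.
  + move/(emb_inj_pt e) => h; apply/eqP; rewrite -(nth_uniq 0 hx hy (emb_uniq e j)); apply/eqP/h.
      by have [] := emb_inc e (Lin x hx).
    by have [] := emb_inc e (Lin y hy).
  + by move=> h; have := qn _ (Lin x hx); rewrite h eqxx.
  + by move=> h; have := qn _ (Lin y hy); rewrite h eqxx.
  + by move: lx ly hx hy; rewrite /in_mem /=; lia.
- by move=> x y; rewrite !inE => /eqP-> /eqP->.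
- move=> k v /(nthP (0,0))[x]; rewrite size_zip size_iota minnn => lx.
  rewrite nth_zip ?size_iota // nth_iota // add0n => -[<- <-].
  rewrite /alpha lx; split=> //; first exact: ltnW.
  by have [] := emb_inc e (Lin x lx).
- by move=> k v; rewrite inE => /eqP[-> ->].
- by move=> p b; rewrite inE => /eqP[-> ->]; rewrite /alpha ltnn; split; rewrite /= ?eqxx ?leqnn.
Qed.

Variable pats : seq pattern.
Definition pat_ok (pt : pattern) : bool :=
  (4 <= (pat_state pt).1) && (4 <= size (pat_state pt).2) &&
  all (fun e => e.1 \in nth [::] (pat_state pt).2 e.2) (pat_es pt) &&
  all (fun r => [&& size r.1 == 4, size r.2 == 4, all (gtn 4) r.1 & all (gtn 4) r.2]) (pat_al pt).

(** The licence for [Cycle] steps: every actual 8-cycle carries one of the patterns in a listed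
    position. It is obtained for [pats4] from the violator search, and for [pats2] once the six
    surplus patterns have been refuted. *)
Definition outcome_complete := forall x b, embedding inc (4, C8) x b ->
  (exists2 pt, pt \in pats & exists r alpha beta,
    [/\ r \in pat_al pt, embedding inc (pat_state pt) alpha beta,
        forall i, i < 4 -> alpha i = x (nth 0 r.1 i) & forall i, i < 4 -> beta i = b (nth 0 r.2 i)]) \/ Goal.

Lemma cyc_sound t phi psi xs bs : all pat_ok pats -> outcome_complete ->
  embedding inc t phi psi -> is_cycle8 t xs bs ->
  (exists t' phi' psi', t' \in cyc_children 21 pats t xs bs /\ embedding inc t' phi' psi') \/ Goal.
Proof.
move=> /allP pok oc e /andP[/andP[/andP[/andP[/eqP sx /eqP sb] ux] ub] /allP cy].
pose x i := phi (nth 0 xs i); pose b i := psi (nth 0 bs i).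
have cyi i : i < 4 -> nth 0 xs i \in nth [::] t.2 (nth 0 bs i) /\ nth 0 xs ((i + 1) %% 4) \in nth [::] t.2 (nth 0 bs i).
  by move=> li; apply/andP/cy; rewrite mem_iota.
have lx i : i < 4 -> nth 0 xs i < t.1 by move=> /cyi[/(emb_inc e)[]].
have lb i : i < 4 -> nth 0 bs i < size t.2 by move=> /cyi[/nth_in_size].
have ec : embedding inc (4, C8) x b.
  split=> /=.
  - move=> i j li lj /(emb_inj_pt e (lx i li) (lx j lj))/eqP.
    by rewrite nth_uniq ?sx // => /eqP.
  - move=> i j li lj /(emb_inj_bl e (lb i li) (lb j lj))/eqP.
    by rewrite nth_uniq ?sb // => /eqP.
  - by do 4!case=> //; move=> j; rewrite nth_default.
  have ci k : k < 4 -> inc (x k) (b k) /\ inc (x ((k + 1) %% 4)) (b k).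
    by move=> /cyi[/(emb_inc e)[_ ?] /(emb_inc e)[_ ?]].
  move=> i; have [h0 h0'] := ci 0 isT; have [h1 h1'] := ci 1 isT.
  have [h2 h2'] := ci 2 isT; have [h3 h3'] := ci 3 isT.
  do 4![case; first by rewrite !inE => /orP[]/eqP->; split].
  by move=> j; rewrite nth_default.
case: (oc x b ec) => [[pt ptp [r [alpha [beta [ral ep ha hb]]]]]|]; [left|by right].
have /andP[/andP[/andP[n4 b4] /allP es] /allP al] := pok _ ptp.
have /and4P[/eqP r1 /eqP r2 /allP a1 /allP a2] := al _ ral.
have [||k v|k v|p' b'|t' [phi' [psi' [h' e']]]] := @glue_sound _ _ _ _ 21 G n21 alpha beta (fun k => k < (pat_state pt).1) (fun k => k < size (pat_state pt).2) _ _
   (pat_es pt) t phi psi (aligned xs bs r).1 (aligned xs bs r).2 e.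
- by move=> i j li lj; apply: (emb_inj_pt ep).
- by move=> i j li lj; apply: (emb_inj_bl ep).
- move=> /(nthP (0,0))[y]; rewrite size_zip size_iota size_map r1 => ly.
  rewrite nth_zip ?size_iota ?size_map // nth_iota // (nth_map 0) ?r1 // add0n => -[<- <-].
  have l4 : nth 0 r.1 y < 4 by apply: a1; rewrite mem_nth ?r1.
  by split; rewrite ?ha ?lx //=; apply: leq_trans n4.
- move=> /(nthP (0,0))[y]; rewrite size_zip size_iota size_map r2 => ly.
  rewrite nth_zip ?size_iota ?size_map // nth_iota // (nth_map 0) ?r2 // add0n => -[<- <-].
  have l4 : nth 0 r.2 y < 4 by apply: a2; rewrite mem_nth ?r2.
  by split; rewrite ?hb ?lb //=; apply: leq_trans b4.
- move=> /es /= h; have [h1 h2] := emb_inc ep h; split=> //.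
  exact: nth_in_size h.
exists t', phi', psi'; split=> //; apply/flatten_mapP; exists pt => //.
by apply/flatten_mapP; exists r.
Qed.

Variables auto known : seq anchored_edges.
Hypotheses (autoP : forall k, k \in auto -> refuted_es k.1) (knownP : forall k, k \in known -> refuted_es k.1).
Hypotheses (pats_ok : all pat_ok pats) (oc : outcome_complete).

Lemma taken_idm a v : taken (idm a) v -> v < a.
Proof.
case/takenP=> k; rewrite /idm => /(nthP (0, 0))[i].
rewrite size_zip size_iota minnn => li; rewrite nth_zip ?size_iota // nth_iota //.
by case=> _ <-.
Qed.

Lemma hit_edge_sound t e : hit_edge auto t e -> refuted t.
Proof.
rewrite /hit_edge lhasE => /hasP[k ka]; case: ltnP => // le1; case: ltnP => // le2.
case: k ka le1 le2 => [[|[p j] es] a] // ka le1 le2 em.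
have im v q : a <= v -> injmap ((q, v) :: idm a).
  move=> av; apply: injmap_cons; first exact: injmap_idm.
  by apply/negP=> /taken_idm; rewrite ltnNge av.
exact: (emb_refuted (im _ p le1) (im _ j le2) em (autoP ka)).
Qed.

Definition memo_ok (m : memo) := forall es, es \in m -> refuted_es es.

Lemma replays_sound f : (forall m sc t m' sc', f m sc t = Some (m', sc') -> memo_ok m -> memo_ok m' /\ refuted t) ->
  forall cs m sc m' sc', replays f m sc cs = Some (m', sc') -> memo_ok m ->
  memo_ok m' /\ forall t, t \in cs -> refuted t.
Proof.
move=> hf; elim=> [|c cs IH] m sc m' sc' /=; first by move=> [<- _].
case E: (f m sc c) => [[m1 sc1]|] // /IH h mo; have [mo1 rc] := hf _ _ _ _ _ E mo.
have [mo' rcs] := h mo1; split=> // t; rewrite inE => /orP[/eqP->|/rcs] //.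
Qed.

Lemma drop_mem (T : eqType) i (s : seq T) x s' : drop i s = x :: s' -> x \in s.
Proof. by move=> e; apply: (mem_drop (n0 := i)); rewrite e mem_head. Qed.

Lemma replay_sound fuel m sc t m' sc' : replay auto known pats fuel m sc t = Some (m', sc') ->
  memo_ok m -> memo_ok m' /\ refuted t.
Proof.
elim: fuel m sc t m' sc' => [|fuel IH] m [|s sc] t m' sc' //=.
case: s => [i|j|x0 x1 x2 x3|i|i||].
- case: ifP => // op /(replays_sound IH) h /h[mo rc]; split=> // phi psi e.
  have [t' [phi' [psi' [ht' e']]]] := pstar_sound e op.
  case: (boolP (hit_edge auto t' (i, new_at (pblocks t i) (pblocks t' i)))) => [/hit_edge_sound r|nh]; first exact: r e'.
  by apply: rc e'; rewrite mem_filter nh.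
- case: ifP => // op /(replays_sound IH) h /h[mo rc]; split=> // phi psi e.
  have [t' [phi' [psi' [ht' e']]]] := bstar_sound e op.
  case: (boolP (hit_edge auto t' (new_at (nth [::] t.2 j) (nth [::] t'.2 j), j))) => [/hit_edge_sound r|nh]; first exact: r e'.
  by apply: rc e'; rewrite mem_filter nh.
- case: ifP => // cy /(replays_sound IH) h /h[mo rc]; split=> // phi psi e.
  by have [[t' [phi' [psi' [/rc r /r]]]]|] := cyc_sound pats_ok oc e cy.
- case E: (drop i known) => [|k ks] //; case: ifP => // em [<- _] mo; split=> //.
  by apply: emb_refuted em (knownP (drop_mem E)); apply: injmap_idm.
- case E: (drop i m) => [|es ms] //; case: ifP => // em [<- _] mo; split=> //.
  exact: (@emb_refuted es t [::] [::]) em (mo _ (drop_mem E)).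
- case E: (replay _ _ _ _ _ _ _) => [[m1 sc1]|] //; case: ifP => // cv [<- _] /(IH _ _ _ _ _ E)[mo rt].
  by split=> // es; rewrite inE => /orP[/eqP->|/mo] //; apply: cover_refuted cv rt.
- by case: ifP => // /leafcheck_sound lt [<- _]; split.
Qed.
End Refute.

(** * Search for Hall violators *)

(* Growing a minimal Hall violator of the 8-cycle: entry [i] of a [vstate] is a block, whose mate is point
   [own i] (the mate of block 0 is the cycle point 0), with its two other points once these are known. *)
Definition own i := if i is 0 then 0 else i + 3.
Definition vstate := seq (option (nat * nat)).
Definition levi (st : vstate) : state :=
  (size st + 3, C8 ++ [seq (if nth None st i is Some (c1, c2) then [:: own i; c1; c2] else [:: own i]) | i <- iota 0 (size st)]).

Fixpoint colour_of (path : seq (nat * bool)) w : option bool :=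
  if path is (a, c) :: path' then if eqn w a then Some c else colour_of path' w else None.
(* A path from block 0 along mates that closes up with the wrong parity makes the configuration colourable. *)
Fixpoint lasso fuel (st : vstate) v c (path : seq (nat * bool)) : bool :=
  if fuel is f.+1 then
    let step k := if k < 4 then odd k (+) c else
      if colour_of path (k - 3) is Some c' then c' (+) c else lasso f st (k - 3) (~~ c) ((k - 3, ~~ c) :: path) in
    if nth None st v is Some (c1, c2) then step c1 ||| step c2 else false
  else false.

Definition addable t c j : option state := if nmem c (nth [::] t.2 j) then None else add_edge t c j.
Definition mk (st : vstate) v k c1 c2 : vstate := set_nth None (st ++ nseq k None) v (Some (c1, c2)).
(** The pair [(c, c)] stands for a block of which only one further point is known. The path starts
    with colour [false] because the mate of block 0 is cycle point 0, coloured by its parity; the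
    fuel exceeds the at most nine blocks that a path can visit. *)
Definition single st t v c := if addable t c (v + 4) is Some _ then
   ~~ lasso 10 (set_nth None st v (Some (c, c))) 0 false [:: (0, false)] else false.
Definition pairok t v c1 c2 := if addable t c1 (v + 4) is Some t1 then
   if addable t1 c2 (v + 4) is Some _ then true else false else false.
(** The three parts correspond to zero, one or two of the further points of block [v] being mates of
    blocks not yet seen. Each such point brings its block along, and the bounds 9 and 8 keep the
    violator within nine blocks. *)
Definition vs_children (st : vstate) v : seq vstate :=
  let t := levi st in let N := size st + 3 in
  let L := [seq c <- iota 0 N | single st t v c] in
  flatten [seq [seq mk st v 0 c1 c2 | c2 <- L & (c1 < c2) &&& pairok t v c1 c2] | c1 <- L]
  ++ (if size st < 9 then [seq mk st v 1 c N | c <- L] else [::])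
  ++ (if size st < 8 then [:: mk st v 2 N N.+1] else [::]).

Definition full_edges (s : state) : seq (nat * nat) :=
  let es := edges_of s in order_edges (size es) es es (iota 0 4) (iota 0 4).
Definition leaf_pats : seq pattern :=
  [seq (s, full_edges s, dihedral) | s <- [:: PATH; RC; T2; X11b; UX]].
Definition leaf_known := [seq ordered s | s <- [:: DX13; DX13d]].
Definition vs_leaf lp lk (st : vstate) : bool :=
  let t := levi st in
  lhas (fun pt => lhas (fun r => let m := aligned (iota 0 4) (iota 0 4) r in emb (pat_es pt) t m.1 m.2) (pat_al pt)) lp
  ||| lhas (fun es => emb es t [::] [::]) lk.

Fixpoint alll (T : Type) (a : T -> bool) s := if s is x :: s' then a x &&& alll a s' else true.
(** Always develops the open block with the fewest continuations. Once no block is open, the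
    violator is complete and must show a listed pattern at the cycle, or [DX13] or its dual
    anywhere. *)
Fixpoint violator_search lp lk fuel (st : vstate) : bool :=
  if fuel is f.+1 then
    let os := [seq v <- iota 0 (size st) | if nth None st v is None then true else false] in
    if [seq vs_children st v | v <- os] is l :: ls then
      alll (violator_search lp lk f) (foldl (fun a b => if size b < size a then b else a) l ls)
    else vs_leaf lp lk st
  else false.

Lemma colour_of_mem path w c : colour_of path w = Some c -> (w, c) \in path.
Proof.
elim: path => //= -[a d] path IH; case: ifP => [/eqnP->[->]|_ /IH h]; first by rewrite inE eqxx.
by rewrite inE h orbT.
Qed.

Lemma colour_of_None path w c : colour_of path w = None -> (w, c) \notin path.
Proof.
elim: path => //= -[a d] path IH; case: ifP => // /eqnP wa /IH; rewrite inE negb_or => ->.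
by rewrite andbT xpair_eqE; apply/negP=> /andP[/eqP/wa].
Qed.

Section SearchSound.
Variables (P Q : finType) (inc : P -> Q -> bool) (n : nat).
Hypothesis G : good inc n.
Variables (x : nat -> P) (b : nat -> Q).
Hypothesis C : embedding inc (4, C8) x b.
Definition xset := [set p | has (fun k => x k == p) (iota 0 4)].
Definition bset := [set q | has (fun k => b k == q) (iota 0 4)].
Variables (A : {set Q}) (a0 : Q) (M : Q -> P).
Hypothesis fr : frame inc xset bset A a0 (x 0) M.

Lemma xsetP p : reflect (exists2 k, k < 4 & x k = p) (p \in xset).
Proof.
rewrite inE; apply: (iffP hasP) => [[k]|[k lk <-]]; first by rewrite mem_iota add0n => lk /eqP; exists k.
by exists k; rewrite ?mem_iota ?add0n.
Qed.

Lemma bsetP q : reflect (exists2 k, k < 4 & b k = q) (q \in bset).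
Proof.
rewrite inE; apply: (iffP hasP) => [[k]|[k lk <-]]; first by rewrite mem_iota add0n => lk /eqP; exists k.
by exists k; rewrite ?mem_iota ?add0n.
Qed.

(** Only the blocks are mapped freely. A point [c >= 4] goes to the mate of block [c - 3], so
    injectivity on points is inherited from the matching. *)
Definition ph (psi : nat -> Q) c := if c < 4 then x c else M (psi (c - 3)).
Definition bb (psi : nat -> Q) j := if j < 4 then b j else psi (j - 4).

Record vs_embedded (st : vstate) (psi : nat -> Q) : Prop := VsEmbedded {
  vs_pos : 0 < size st;
  vs_psi0 : psi 0 = a0;
  vs_A : forall i, i < size st -> psi i \in A;
  vs_inj : forall i j, i < size st -> j < size st -> psi i = psi j -> i = j;
  vs_inc : forall i c1 c2, nth None st i = Some (c1, c2) ->
     [/\ c1 < size st + 3, c2 < size st + 3, inc (ph psi c1) (psi i) & inc (ph psi c2) (psi i)] }.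

Lemma psi_notF st psi i : vs_embedded st psi -> i < size st -> psi i \notin bset.
Proof. by move=> e li; have := subsetP (frame_sub fr) _ (vs_A e li); rewrite inE. Qed.

Lemma ph_own st psi i : vs_embedded st psi -> ph psi (own i) = M (psi i).
Proof.
move=> e; case: i => [|i]; first by rewrite /ph /= (vs_psi0 e) (frame_M0 fr).
by rewrite /ph ifN /own ?addnK // -leqNgt; lia.
Qed.

Lemma own_inc st psi i : vs_embedded st psi -> i < size st -> inc (ph psi (own i)) (psi i).
Proof. by move=> e li; rewrite (ph_own _ e); apply: (frame_inc fr); apply: psi_notF li. Qed.

Lemma ph_inj st psi c d : vs_embedded st psi -> c < size st + 3 -> d < size st + 3 ->
  ph psi c = ph psi d -> c = d.
Proof.
move=> e; have out c' : 4 <= c' -> c' < size st + 3 -> M (psi (c' - 3)) \notin xset.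
  move=> h1 h2; apply: (frame_out fr); first by apply: psi_notF e _; lia.
  by rewrite -(vs_psi0 e); apply/eqP=> /(vs_inj e); lia.
rewrite /ph => lc ld; case: ltnP => hc; case: ltnP => hd.
- exact: (emb_inj_pt C).
- by move=> h; have := out d hd ld; rewrite -h; case/xsetP; exists c.
- by move=> h; have := out c hc lc; rewrite h; case/xsetP; exists d.
- move/(frame_inj fr) => h.
  have /(vs_inj e) : psi (c - 3) = psi (d - 3).
    by apply: h; rewrite inE; apply: psi_notF e _; lia.
  by move=> h'; have := h' ltac:(lia) ltac:(lia); lia.
Qed.

Lemma C_inc k : k < 4 -> inc (x k) (b k) /\ inc (x ((k + 1) %% 4)) (b k).
Proof.
have ci i j : i \in nth [::] C8 j -> inc (x i) (b j) by move=> h; have [] := emb_inc C (h : i \in nth [::] (4, C8).2 j).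
by move: k; do 4![case; first by split; apply: ci].
Qed.

Lemma vs_embedding st psi : vs_embedded st psi ->
  (forall i, uniq (nth [::] (levi st).2 i)) -> embedding inc (levi st) (ph psi) (bb psi).
Proof.
move=> e un; have sz : size (levi st).2 = size st + 4 by rewrite /= size_map size_iota; lia.
split=> //.
- by move=> i j; apply: (ph_inj e).
- move=> i j; rewrite sz /bb => li lj; case: ltnP => hi; case: ltnP => hj.
  + exact: (emb_inj_bl C).
  + move=> h; have /negP[] : psi (j - 4) \notin bset by apply: psi_notF e _; lia.
    by rewrite -h; apply/bsetP; exists i.
  + move=> h; have /negP[] : psi (i - 4) \notin bset by apply: psi_notF e _; lia.
    by rewrite h; apply/bsetP; exists j.
  + by move=> /(vs_inj e) h; have := h ltac:(lia) ltac:(lia); lia.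
- move=> i j ij; have := nth_in_size ij; rewrite sz => lj.
  have -> : (levi st).1 = size st + 3 by [].
  have p0 := vs_pos e.
  move: ij; rewrite /levi /= -/C8 -[[:: _, _, _, _ & _]]/(C8 ++ _) nth_cat.
  case: ltnP => /= hj.
    rewrite /bb hj => h; have [h1 h2] := emb_inc C (h : i \in nth [::] (4, C8).2 j).
    have h1' : i < 4 by [].
    by rewrite /ph h1'; split=> //; lia.
  rewrite (nth_map 0) ?size_iota; last by lia.
  rewrite nth_iota; last by lia.
  have ej : bb psi j = psi (j - 4) by rewrite /bb ltnNge hj.
  rewrite add0n ej; set k := j - 4; have lk : k < size st by rewrite /k; lia.
  have ownl : own k < size st + 3 by rewrite /own; case: (k) lk => [|k']; lia.
  have ho : own k < size st + 3 /\ inc (ph psi (own k)) (psi k) by split=> //; apply: own_inc e lk.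
  case E: (nth None st k) => [[c1 c2]|]; last by rewrite inE => /eqP->.
  have [h1 h2 h3 h4] := vs_inc e E.
  by rewrite !inE => /or3P[]/eqP->.
Qed.

(* Colour the points of the cycle alternately, and the mates alternately along the path: when the path
   ends in a block that sees both colours, [extend_colouring] applies. *)
Definition pset psi (path : seq (nat * bool)) :=
  [set p | (p \in xset) || has (fun e => ph psi (own e.1) == p) path].
Definition pcol psi (path : seq (nat * bool)) p :=
  has (fun k => (x k == p) && odd k) (iota 0 4) || has (fun e => (ph psi (own e.1) == p) && e.2) path.
Definition path_ok (st : vstate) (path : seq (nat * bool)) :=
  [/\ (forall w c, (w, c) \in path -> w < size st), (0, false) \in path &
      forall w c c', (w, c) \in path -> (w, c') \in path -> c = c'].

Lemma own_lt (st : vstate) i : i < size st -> own i < size st + 3.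
Proof. by rewrite /own; case: i => [|i]; lia. Qed.

Lemma own_inj i j : own i = own j -> i = j.
Proof. by case: i => [|i]; case: j => [|j] //=; lia. Qed.

Lemma pcolE st psi path w c : vs_embedded st psi -> path_ok st path -> (w, c) \in path ->
  pcol psi path (ph psi (own w)) = c.
Proof.
move=> e [lp p0 up] wc; have lw := lp _ _ wc; rewrite /pcol.
have -> : has (fun e0 => (ph psi (own e0.1) == ph psi (own w)) && e0.2) path = c.
  apply/hasP/idP => [[[w' c'] wc' /= /andP[/eqP h c'T]]|cT]; last by exists (w, c); rewrite //= eqxx cT.
  have := ph_inj e (own_lt (lp _ _ wc')) (own_lt lw) h => /own_inj ew.
  by rewrite ew in wc'; rewrite (up _ _ _ wc wc').
case: c wc => wc; [by rewrite orbT|rewrite orbF].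
apply/negbTE/negP => /hasP[k]; rewrite mem_iota /= add0n => lk /andP[/eqP h ok].
have p := vs_pos e; have : k = own w.
  apply: (ph_inj e); [lia|exact: own_lt|by rewrite -h /ph lk].
by case: w lw wc h => [|w] lw wc h /= ek; [rewrite ek in ok|lia].
Qed.

Lemma pcolx st psi path k : vs_embedded st psi -> path_ok st path -> k < 4 -> pcol psi path (x k) = odd k.
Proof.
move=> e [lp p0 up] lk; have p := vs_pos e; rewrite /pcol.
have -> : has (fun j => (x j == x k) && odd j) (iota 0 4) = odd k.
  apply/hasP/idP => [[j]|ok]; last by exists k; rewrite ?mem_iota ?add0n // eqxx.
  by rewrite mem_iota /= add0n => lj /andP[/eqP/(emb_inj_pt C lj lk)->].
case ok: (odd k) => //; apply/negbTE/negP => /hasP[[w c] wc /= /andP[/eqP h cT]].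
have ek : own w = k.
  by apply: (ph_inj e); [exact: own_lt (lp _ _ wc)|lia|rewrite h /ph lk].
case: w wc h ek => [|w] wc h /= ek; last by lia.
by rewrite -(up _ _ _ p0 wc) in cT.
Qed.

Definition sat psi path w := bichrom inc (pset psi path) (pcol psi path) (psi w).

(** The coloured points are the cycle and the mates of the path blocks. Once all path blocks are
    settled, a block still unsettled has its mate outside the coloured set, even [a0] with its mate
    on the cycle being settled, and [extend_colouring] gives a contradiction. *)
Lemma path_finish st psi path : vs_embedded st psi -> path_ok st path ->
  (forall w c, (w, c) \in path -> sat psi path w) -> False.
Proof.
move=> e ok hs; apply: (good_ncol G); have [lp p0 up] := ok.
have nF q : ~~ bichrom inc (pset psi path) (pcol psi path) q -> q \notin bset.
  apply: contra => /bsetP[k lk <-]; have [h1 h2] := C_inc lk.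
  have lk' : (k + 1) %% 4 < 4 by rewrite ltn_mod.
  apply/bichromP; exists (x k), (x ((k + 1) %% 4)).
  rewrite !inE !(pcolx e ok) //; split=> //.
  + by apply/orP; left; apply/hasP; exists k; rewrite ?mem_iota ?add0n.
  + by apply/orP; left; apply/hasP; exists ((k + 1) %% 4); rewrite ?mem_iota ?add0n.
  + by move: k lk {h1 h2 lk'}; do 4!case=> //.
apply: (@extend_colouring _ _ _ (good_cubic G) (good_conn G) (pset psi path) (pcol psi path) M).
- by apply/set0Pn; exists (x 0); rewrite inE; apply/orP; left; apply/xsetP; exists 0.
- move=> q uq; split; first exact: (frame_inc fr) (nF _ uq).
  apply: contra (uq) => /[1!inE] /orP[mx|/hasP[[w c] wc /= /eqP h]].
    have [eq|nq] := eqVneq q a0; last by have := frame_out fr (nF _ uq) nq; rewrite mx.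
    by rewrite eq -(vs_psi0 e); apply: hs p0.
  have -> : q = psi w; last exact: hs wc.
  apply: (frame_inj fr); [by rewrite in_setC nF|by rewrite in_setC (psi_notF e (lp _ _ wc))|].
  by rewrite -(ph_own _ e) h.
- by move=> q q' /nF uq /nF uq'; apply: (frame_inj fr); rewrite in_setC.
Qed.

Lemma sat_cons st psi path w c v : vs_embedded st psi -> path_ok st path -> path_ok st ((w, c) :: path) ->
  sat psi path v -> sat psi ((w, c) :: path) v.
Proof.
move=> e ok ok' /bichromP[p [p' [pS p'S ip ip' ne]]]; apply/bichromP; exists p, p'.
have sub z : z \in pset psi path -> z \in pset psi ((w, c) :: path).
  by rewrite !inE => /orP[->//|h]; rewrite /= h !orbT.
have eqc z : z \in pset psi path -> pcol psi ((w, c) :: path) z = pcol psi path z.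
  rewrite inE => /orP[/xsetP[k lk <-]|/hasP[[u d] ud /= /eqP<-]].
    by rewrite !(pcolx e).
  by rewrite (pcolE e ok ud) (pcolE e ok' (c := d)) // inE ud orbT.
by rewrite !eqc //; split=> //; apply: sub.
Qed.

(** Invariant: every block of the path except the last one, [v], already sees two colours. A
    coloured point of [v] that differs from its mate settles [v] and ends the argument. An
    uncoloured one is the mate of a new block: it receives the opposite colour, which settles [v],
    and the path moves on to that block. *)
Lemma lasso_sound fuel st psi v c path : vs_embedded st psi -> path_ok st path -> (v, c) \in path ->
  (forall w d, (w, d) \in path -> w != v -> sat psi path w) -> lasso fuel st v c path -> False.
Proof.
elim: fuel v c path => //= fuel IH v c path e ok vc hs.
have [lp p0 up] := ok; have levi := lp _ _ vc.
case E: (nth None st v) => [[c1 c2]|] //; have [l1 l2 i1 i2] := vs_inc e E.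
have io := own_inc e levi.
have vS : ph psi (own v) \in pset psi path by rewrite inE; apply/orP; right; apply/hasP; exists (v, c).
suff step k : k < size st + 3 -> inc (ph psi k) (psi v) ->
    (if k < 4 then odd k (+) c else
      if colour_of path (k - 3) is Some c' then c' (+) c else lasso fuel st (k - 3) (~~ c) ((k - 3, ~~ c) :: path)) -> False.
  by case: ifP => [h _|_]; [apply: (step c1)|apply: (step c2)].
move=> lk ik.
have fin k' d : ph psi k = k' -> k' \in pset psi path -> pcol psi path k' = d -> d (+) c -> False.
  move=> ek kS kd dc; apply: (path_finish e ok) => w c' wc'.
  have [->|wv] := eqVneq w v; last exact: hs wc' wv.
  apply/bichromP; exists k', (ph psi (own v)); rewrite kS vS -{1}ek ik io kd (pcolE e ok vc); split=> //.
  by move: dc; case: (d); case: (c).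
case: ifP => k4 h.
  apply: (fin (x k) (odd k)) => //; first by rewrite /ph k4.
    by rewrite inE; apply/orP; left; apply/xsetP; exists k.
  exact: pcolx e ok k4.
have ek : k = own (k - 3) by rewrite /own; case E': (k - 3) => [|m]; lia.
case Ec: (colour_of path (k - 3)) h => [c'|] h.
  have kp := colour_of_mem Ec.
  apply: (fin (ph psi (own (k - 3))) c') => //; first by rewrite -ek.
    by rewrite inE; apply/orP; right; apply/hasP; exists (k - 3, c').
  exact: pcolE e ok kp.
have ok' : path_ok st ((k - 3, ~~ c) :: path).
  split.
  - by move=> w d; rewrite inE => /orP[/eqP[-> _]|/lp //]; lia.
  - by rewrite inE p0 orbT.
  - move=> w d d'; rewrite !inE => /orP[/eqP[ew ->]|wd] /orP[/eqP[ew' ->]|wd'] //.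
    + by move: (colour_of_None d' Ec); rewrite -ew wd'.
    + by move: (colour_of_None d Ec); rewrite -ew' wd.
    + exact: up wd wd'.
apply: (IH _ _ _ e ok' _ _ h); first by rewrite inE eqxx.
move=> w d; rewrite inE => /orP[/eqP[-> _]|wd]; first by rewrite eqxx.
move=> wk; have [->|wv] := eqVneq w v; last exact: (sat_cons e ok ok' (hs _ _ wd wv)).
apply/bichromP; exists (ph psi k), (ph psi (own v)).
have := pcolE e ok' (mem_head _ _); rewrite -ek => ->.
rewrite (pcolE e ok' (c := c)); last by rewrite inE vc orbT.
split=> //; last by case: (c).
  by rewrite inE; apply/orP; right; rewrite /= -ek eqxx.
by rewrite inE; apply/orP; right; apply/hasP; exists (v, c); rewrite // inE vc orbT.
Qed.

Definition vs_uniq (st : vstate) := forall i c1 c2, nth None st i = Some (c1, c2) -> uniq [:: own i; c1; c2].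

Lemma lv_nth st i : i < size st -> nth [::] (levi st).2 (i + 4) =
  if nth None st i is Some (c1, c2) then [:: own i; c1; c2] else [:: own i].
Proof.
move=> li; rewrite /levi /= -[[:: _, _, _, _ & _]]/(C8 ++ _) nth_cat /= addnK.
have -> : (i + 4 < 4) = false by lia.
by rewrite (nth_map 0) ?size_iota // nth_iota.
Qed.

Lemma levi_uniq st : vs_uniq st -> forall j, uniq (nth [::] (levi st).2 j).
Proof.
move=> un j; case: (ltnP j 4) => j4; first by move: j j4; do 4!case=> //.
case: (ltnP (j - 4) (size st)) => lj; last first.
  by rewrite nth_default //= size_map size_iota; lia.
have -> : j = j - 4 + 4 by lia.
by rewrite lv_nth //; case E: nth => [[c1 c2]|] //; apply: un E.
Qed.

Lemma vs_fresh st psi a : vs_embedded st psi -> a \in A -> (forall i, i < size st -> psi i <> a) ->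
  exists psi', [/\ vs_embedded (rcons st None) psi', forall c, c < size st + 3 -> ph psi' c = ph psi c,
      forall i, i < size st -> psi' i = psi i, psi' (size st) = a & ph psi' (size st + 3) = M a].
Proof.
move=> e aA na; pose psi' i := if i == size st then a else psi i; exists psi'.
have E i : i < size st -> psi' i = psi i by rewrite /psi'; case: eqP => // ->; rewrite ltnn.
have EN : psi' (size st) = a by rewrite /psi' eqxx.
have p0 := vs_pos e.
have pE c : c < size st + 3 -> ph psi' c = ph psi c by move=> lc; rewrite /ph; case: ifP => // c4; rewrite E //; lia.
split=> //; last by rewrite /ph addnK EN; case: ifP => //; lia.
split; rewrite ?size_rcons //.
- by rewrite E // (vs_psi0 e).
- by move=> i; rewrite ltnS leq_eqVlt => /orP[/eqP->|li]; rewrite ?EN // E //; apply: (vs_A e).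
- move=> i j; rewrite !ltnS leq_eqVlt => /orP[/eqP->|li]; rewrite leq_eqVlt => /orP[/eqP->|lj] //.
  + by rewrite EN (E j lj) => h; case: (na j).
  + by rewrite EN (E i li) => h; case: (na i).
  + by rewrite !E //; apply: (vs_inj e).
- move=> i c1 c2; rewrite nth_rcons; case: ifP => li; last by case: ifP.
  by move=> /(vs_inc e)[h1 h2 h3 h4]; rewrite E // !pE //; split=> //; lia.
Qed.

Lemma vs_set st psi v c1 c2 : vs_embedded st psi -> v < size st ->
  c1 < size st + 3 -> c2 < size st + 3 -> inc (ph psi c1) (psi v) -> inc (ph psi c2) (psi v) ->
  vs_embedded (set_nth None st v (Some (c1, c2))) psi.
Proof.
move=> e levi l1 l2 i1 i2.
have sz : size (set_nth None st v (Some (c1, c2))) = size st by rewrite size_set_nth; apply/maxn_idPr.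
case: e => h1 h2 h3 h4 h5; split; rewrite ?sz // => i d1 d2.
by rewrite nth_set_nth /=; case: eqP => [-> [<- <-]|_ /h5 //].
Qed.

Lemma vs_uniq_set st v c1 c2 : vs_uniq st -> uniq [:: own v; c1; c2] -> vs_uniq (set_nth None st v (Some (c1, c2))).
Proof. by move=> un u i d1 d2; rewrite nth_set_nth /=; case: eqP => [-> [<- <-]|_ /un]. Qed.

Lemma single_true st psi v c : vs_embedded st psi -> vs_uniq st -> v < size st -> nth None st v = None ->
  c < size st + 3 -> c != own v -> inc (ph psi c) (psi v) -> single st (levi st) v c.
Proof.
move=> e un lv' vN lc cv ic; have emb := vs_embedding e (levi_uniq un).
have lj : v + 4 < size (levi st).2 by rewrite /= size_map size_iota; lia.
have bE : bb psi (v + 4) = psi v by rewrite /bb addnK; case: ifP => //; lia.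
have [|t' [ea _ _ _]] := add_edge_sound G emb (lc : c < (levi st).1) lj; first by rewrite bE.
rewrite /single /addable nmemE lv_nth // vN inE (negbTE cv) ea.
apply/negP => h; apply: (@lasso_sound 10 (set_nth None st v (Some (c, c))) psi 0 false [:: (0, false)]) h.
- exact: vs_set.
- split.
  + move=> w d; rewrite inE => /eqP[-> _]; rewrite size_set_nth.
    by have := vs_pos e; lia.
  + by rewrite inE.
  + by move=> w d d'; rewrite !inE => /eqP[_ ->] /eqP[_ ->].
- by rewrite inE.
- by move=> w d; rewrite inE => /eqP[-> _]; rewrite eqxx.
Qed.

Lemma pairok_true st psi v c1 c2 : vs_embedded st psi -> vs_uniq st -> v < size st -> nth None st v = None ->
  c1 < size st + 3 -> c2 < size st + 3 -> c1 != own v -> c2 != own v -> c1 != c2 ->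
  inc (ph psi c1) (psi v) -> inc (ph psi c2) (psi v) -> pairok (levi st) v c1 c2.
Proof.
move=> e un lv' vN l1 l2 cv1 cv2 c12 i1 i2; have emb := vs_embedding e (levi_uniq un).
have lj : v + 4 < size (levi st).2 by rewrite /= size_map size_iota; lia.
have bE : bb psi (v + 4) = psi v by rewrite /bb addnK; case: ifP => //; lia.
have [|t' [ea s1 s2 e']] := add_edge_sound G emb (l1 : c1 < (levi st).1) lj; first by rewrite bE.
have nE : nth [::] (levi st).2 (v + 4) = [:: own v] by rewrite lv_nth // vN.
have n1 : c1 \in [:: own v] = false by rewrite inE (negbTE cv1).
rewrite /pairok /addable nmemE nE n1 ea.
have nE' : nth [::] t'.2 (v + 4) = [:: own v; c1].
  move: ea; rewrite /add_edge nmemE nE n1; case: ifP => // _ [<-] /=.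
  by rewrite nth_set_nth /= eqxx.
rewrite nmemE nE' !inE (negbTE cv2) (eq_sym c2) (negbTE c12) /=.
have [|||t'' [-> _ _ _]] // := add_edge_sound G e' (i := c2) (j := v + 4).
- by rewrite s1.
- by rewrite s2.
- by rewrite bE.
Qed.

Hypothesis cA : #|A| <= 9.

Lemma vs_size st psi : vs_embedded st psi -> size st <= 9.
Proof.
move=> e; apply: leq_trans cA; rewrite -(size_iota 0 (size st)) -(size_map psi).
rewrite -(card_uniqP _); last first.
  rewrite map_inj_in_uniq ?iota_uniq // => i j; rewrite !mem_iota /= !add0n; exact: (vs_inj e).
apply/subset_leq_card/subsetP=> q /mapP[i]; rewrite mem_iota /= add0n => li ->.
exact: (vs_A e).
Qed.

Lemma vs_children_sound st psi v : vs_embedded st psi -> vs_uniq st -> v < size st -> nth None st v = None ->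
  exists st' psi', [/\ st' \in vs_children st v, vs_embedded st' psi' & vs_uniq st'].
Proof.
move=> e un lv' vN; have io := own_inc e lv'.
have c2 : #|pts inc (psi v) :\ ph psi (own v)| = 2.
  by have := cardsD1 (ph psi (own v)) (pts inc (psi v)); rewrite (good_cubic G).1 inE io; lia.
have [y1 [y2 [y12 yE]]] : exists y1 y2 : P, y1 != y2 /\ pts inc (psi v) :\ ph psi (own v) = [set y1; y2].
  by move/eqP/cards2P: c2 => [y1 [y2 [? ?]]]; exists y1, y2.
have yP y : y \in [set y1; y2] -> inc y (psi v) /\ y != ph psi (own v).
  by rewrite -yE !inE => /andP[].
have [i1 n1] := yP y1 (set21 _ _); have [i2 n2] := yP y2 (set22 _ _).
pose known y := exists2 c, c < size st + 3 & ph psi c = y.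
(* By [frame_closed] a point on a block of the violator is on the cycle or is a mate within [A]; the
   latter is fresh exactly when its block is not in the state. *)
pose fresh y := exists a, [/\ a \in A, forall i, i < size st -> psi i <> a & y = M a].
have cls y : inc y (psi v) -> known y \/ fresh y.
  move=> iy; case: (frame_closed fr (vs_A e lv') iy) => [/xsetP[k lk ek]|[a aA ea]].
    by left; exists k; [have := vs_pos e; lia|rewrite /ph lk].
  have [/hasP[i]|/hasPn none] := boolP (has (fun i => psi i == a) (iota 0 (size st))).
    rewrite mem_iota /= add0n => li /eqP ei; left; exists (own i); first exact: own_lt.
    by rewrite (ph_own _ e) ei.
  right; exists a; split=> // i li ei; have := none i.
  by rewrite mem_iota /= add0n li ei eqxx => /(_ isT).
have lst := vs_size e.
have kk c d : c < d -> d < size st + 3 -> inc (ph psi c) (psi v) -> inc (ph psi d) (psi v) ->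
    c != own v -> d != own v -> exists st' psi', [/\ st' \in vs_children st v, vs_embedded st' psi' & vs_uniq st'].
  move=> cd ld ic id nc nd; have lc : c < size st + 3 by lia.
  exists (mk st v 0 c d), psi; rewrite /mk cats0; split; last 1 first.
  - by apply: vs_uniq_set => //; rewrite /= !inE !(eq_sym (own v)) (negbTE nc) (negbTE nd) /= andbT (ltn_eqF cd).
  - rewrite /vs_children mem_cat; apply/orP; left; apply/flatten_mapP; exists c.
      by rewrite mem_filter mem_iota /= add0n lc (single_true e).
    apply/mapP; exists d; last by rewrite /mk cats0.
    rewrite !mem_filter mem_iota /= add0n ld (single_true e) // cd (pairok_true e) //.
    by apply/eqP; lia.
  - exact: vs_set.
have knownown c y : ph psi c = y -> y != ph psi (own v) -> c != own v.
  by move=> <-; apply: contra => /eqP->.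
have kf c y : c < size st + 3 -> ph psi c != y -> ph psi c != ph psi (own v) -> inc (ph psi c) (psi v) ->
    inc y (psi v) -> fresh y -> exists st' psi', [/\ st' \in vs_children st v, vs_embedded st' psi' & vs_uniq st'].
  move=> lc ny nc ic iy [a [aA af ey]].
  have [psi' [e' pE sE sN pN]] := vs_fresh e aA af.
  have l9 := vs_size e'; rewrite size_rcons in l9.
  have cv : c != own v by apply: knownown nc.
  have lov := own_lt lv'.
  have ls : v < size (rcons st None) by rewrite size_rcons ltnS ltnW.
  exists (mk st v 1 c (size st + 3)), psi'; rewrite /mk cats1; split.
  - rewrite /vs_children !mem_cat; apply/orP; right; apply/orP; left; rewrite l9.
    apply/mapP; exists c; last by rewrite /mk cats1.
    by rewrite mem_filter mem_iota /= add0n lc (single_true e).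
  - apply: (vs_set e' ls).
    + by rewrite size_rcons addSn ltnS ltnW.
    + by rewrite size_rcons addSn.
    + by rewrite pE // sE.
    + by rewrite pN sE // -ey.
  - apply: vs_uniq_set.
      by move=> i d1 d2; rewrite nth_rcons; case: ifP => [_ /un //|_]; case: ifP.
    by rewrite /= !inE !(eq_sym (own v)) (negbTE cv) /= andbT (gtn_eqF lov) /= (ltn_eqF lc).
have ff y y' : y != y' -> inc y (psi v) -> inc y' (psi v) -> fresh y -> fresh y' ->
    exists st' psi', [/\ st' \in vs_children st v, vs_embedded st' psi' & vs_uniq st'].
  move=> ny iy iy' [a [aA af ey]] [a' [aA' af' ey']].
  have [psi' [e' pE sE sN pN]] := vs_fresh e aA af.
  have af'' i : i < size (rcons st None) -> psi' i <> a'.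
    rewrite size_rcons ltnS leq_eqVlt => /orP[/eqP->|li]; last by rewrite sE //; apply: af'.
    by rewrite sN => h; case/eqP: ny; rewrite ey ey' h.
  have [psi2 [e2 pE2 sE2 _ pN2]] := vs_fresh e' aA' af''.
  rewrite !size_rcons in pE2 sE2 pN2.
  have l9 := vs_size e2; rewrite !size_rcons -[9]/(8.+1) ltnS in l9.
  have lov := own_lt lv'.
  have ls : v < size (rcons (rcons st None) None) by rewrite !size_rcons !ltnS ltnW // ltnW.
  have sv : psi2 v = psi v by rewrite sE2 ?sE // ltnS ltnW.
  exists (mk st v 2 (size st + 3) (size st + 3).+1), psi2.
  have -> : mk st v 2 (size st + 3) (size st + 3).+1 =
      set_nth None (rcons (rcons st None) None) v (Some (size st + 3, (size st + 3).+1)).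
    by rewrite /mk -!cats1 -catA.
  split.
  - rewrite /vs_children !mem_cat; apply/orP; right; apply/orP; right.
    rewrite l9.
    by rewrite inE /mk -!cats1 -catA.
  - apply: (vs_set e2 ls).
    + by rewrite !size_rcons !addSn ltnS ltnW.
    + by rewrite !size_rcons !addSn.
    + by rewrite pE2 ?pN ?sv -?ey // addSn.
    + by have -> : (size st + 3).+1 = (size st).+1 + 3 by []; rewrite pN2 sv -ey'.
  - apply: vs_uniq_set.
      move=> i d1 d2; rewrite nth_rcons; case: ifP => [_|_]; last by case: ifP.
      by rewrite nth_rcons; case: ifP => [_ /un //|_]; case: ifP.
    by rewrite /= !inE andbT (ltn_eqF lov) (ltn_eqF (ltn_trans lov (ltnSn _))) /= (ltn_eqF (ltnSn _)).
case: (cls y1 i1) => [[c lc ec]|f1]; case: (cls y2 i2) => [[d ld ed]|f2].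
- have cd : c != d by apply: contra y12 => /eqP h; rewrite -ec -ed h.
  have nc := knownown _ _ ec n1; have nd := knownown _ _ ed n2.
  case: (ltngtP c d) => h; last by rewrite h eqxx in cd.
    by apply: (kk c d) => //; rewrite ?ec ?ed.
  by apply: (kk d c) => //; rewrite ?ec ?ed.
- by apply: (kf c y2) => //; rewrite ec.
- by apply: (kf d y1) => //; rewrite ed // eq_sym.
- exact: (ff y1 y2).
Qed.
End SearchSound.

Lemma alllP (T : eqType) (a : T -> bool) s : alll a s -> forall x, x \in s -> a x.
Proof.
by elim: s => //= y s IH; case: ifP => // ay /IH h x; rewrite inE => /orP[/eqP->|/h].
Qed.

Lemma foldl_min_mem (T : eqType) (l : seq T) (ls : seq (seq T)) :
  foldl (fun a b => if size b < size a then b else a) l ls \in l :: ls.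
Proof.
elim: ls l => [|y ls IH] l /=; first by rewrite inE eqxx.
have := IH (if size y < size l then y else l); rewrite !inE; case: ifP => _ /orP[->|->]; rewrite ?orbT //.
Qed.

Lemma injmap_uniq m : uniq (unzip2 m) -> injmap m.
Proof.
move=> u k k' v /lookup_mem + /lookup_mem; elim: m u => //= -[a c] m IH /= /andP[nc u].
have hc z : (z, c) \in m -> False by move=> h; case/negP: nc; apply/mapP; exists (z, c).
rewrite !inE => /orP[/eqP[-> ev]|h] /orP[/eqP[-> ev']|h'] //.
- by rewrite ev in h'; case: (hc k').
- by rewrite ev' in h; case: (hc k).
- exact: IH.
Qed.

(** * Positions of a pattern at the 8-cycle, their symmetries and duality *)

Definition align_ok (r : seq nat * seq nat) : bool :=
  let m := aligned (iota 0 4) (iota 0 4) r in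
  [&& size r.1 == 4, size r.2 == 4, uniq (unzip2 m.1), uniq (unzip2 m.2) &
      all (fun i => [&& nth 0 r.1 i < 4, nth 0 r.2 i < 4, lookup m.1 i == Some (nth 0 r.1 i) &
                     lookup m.2 i == Some (nth 0 r.2 i)]) (iota 0 4)].

Section Aligned.
Variables (P Q : finType) (inc : P -> Q -> bool).

Definition occurs (x : nat -> P) (b : nat -> Q) (s : state) (g : seq nat * seq nat) :=
  exists alpha beta, embedding inc s alpha beta /\
    forall i, i < 4 -> alpha i = x (nth 0 g.1 i) /\ beta i = b (nth 0 g.2 i).

Lemma occurs_emb x b t phi psi s es r : embedding inc t phi psi ->
  (forall i, i < 4 -> phi i = x i /\ psi i = b i) -> cover es s -> align_ok r ->
  emb es t (aligned (iota 0 4) (iota 0 4) r).1 (aligned (iota 0 4) (iota 0 4) r).2 -> occurs x b s r.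
Proof.
move=> e he cs /and5P[_ _ /injmap_uniq i1 /injmap_uniq i2 /allP hl] em.
have [alpha [beta [ia ib hi ha hb]]] := emb_maps i1 i2 em e.
exists alpha, beta; split; first exact: cover_embedding hi.
move=> i li; have i4 : i \in iota 0 4 by rewrite mem_iota add0n.
have /and4P[l1 l2 /eqP e1 /eqP e2] := hl i i4.
by rewrite (ha _ _ e1) (hb _ _ e2) (he _ l1).1 (he _ l2).2.
Qed.

Definition gcomp (g h : seq nat * seq nat) : seq nat * seq nat :=
  ([seq nth 0 g.1 i | i <- h.1], [seq nth 0 g.2 i | i <- h.2]).

Lemma occurs_sym x b s es g h : align_ok h -> cover es s ->
  emb es s (aligned (iota 0 4) (iota 0 4) h).1 (aligned (iota 0 4) (iota 0 4) h).2 ->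
  occurs x b s g -> occurs x b s (gcomp g h).
Proof.
move=> okh cs em [alpha [beta [e hab]]].
have /and5P[/eqP s1 /eqP s2 _ _ /allP hl] := okh.
have [] := @occurs_emb alpha beta s alpha beta s es h e _ cs okh em; first by [].
move=> a [b' [e' h']]; exists a, b'; split=> // i li.
have i4 : i \in iota 0 4 by rewrite mem_iota add0n.
have /and4P[l1 l2 _ _] := hl i i4.
have [-> ->] := h' i li; have [-> _] := hab _ l1; have [_ ->] := hab _ l2.
by rewrite /gcomp /= !(nth_map 0) ?s1 ?s2.
Qed.
End Aligned.

Lemma embedding_cdual (P Q : finType) (inc : P -> Q -> bool) s alpha beta : 4 <= s.1 ->
  embedding (flipi inc) s alpha beta ->
  embedding inc (cdual s) beta (fun i => alpha (if i < 4 then (i + 1) %% 4 else i)).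
Proof.
move=> s4 e; pose sg i := if i < 4 then (i + 1) %% 4 else i.
have sgl i : i < s.1 -> sg i < s.1.
  by rewrite /sg; case: ifP => // i4 _; apply: leq_trans s4; rewrite ltn_mod.
have sgi i j : sg i = sg j -> i = j.
  rewrite /sg; case: ifP => i4; case: ifP => j4 //.
  - by case: i i4 => [|[|[|[|i]]]] // _; case: j j4 => [|[|[|[|j]]]].
  - by move=> h; have := ltn_pmod (i + 1) (isT : 0 < 4); rewrite h j4.
  - by move=> h; have := ltn_pmod (j + 1) (isT : 0 < 4); rewrite -h i4.
have nthE i : i < s.1 -> nth [::] (cdual s).2 i = pblocks s (sg i).
  by move=> li; rewrite (nth_map 0) ?size_iota // nth_iota.
have sz : size (cdual s).2 = s.1 by rewrite size_map size_iota.
split.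
- by move=> i j li lj; apply: (emb_inj_bl e).
- by move=> i j; rewrite sz => li lj /(emb_inj_pt e (sgl _ li) (sgl _ lj))/sgi.
- move=> j; case: (ltnP j s.1) => lj; last by rewrite nth_default ?sz.
  by rewrite nthE // uniq_pblocks.
- move=> i j ij; have lj := nth_in_size ij; rewrite sz in lj.
  move: ij; rewrite nthE // mem_pblocks => h; split; first exact: nth_in_size h.
  by have [] := emb_inc e h.
Qed.

Section FrameOutcome.
Variables (P Q : finType) (inc : P -> Q -> bool) (n : nat) (Goal : Prop).
Hypothesis G : good inc n.
Variables (lp : seq pattern) (lk : seq (seq (nat * nat))) (fuel : nat).
Hypothesis lpP : all (fun pt => cover (pat_es pt) (pat_state pt) && all align_ok (pat_al pt)) lp.
Hypothesis lkP : forall es, es \in lk -> refuted_es inc Goal es.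
Hypothesis runP : violator_search lp lk fuel [:: None].

Lemma frame_outcome x b A a0 M : embedding inc (4, C8) x b ->
  frame inc (xset x) (bset b) A a0 (x 0) M -> #|A| <= 9 ->
  (exists2 pt, pt \in lp & exists2 r, r \in pat_al pt & occurs inc x b (pat_state pt) r) \/ Goal.
Proof.
move=> C fr cA.
have sound f st psi : violator_search lp lk f st -> vs_embedded inc x A a0 M st psi -> vs_uniq st ->
  exists st' psi', [/\ vs_embedded inc x A a0 M st' psi', vs_uniq st' & vs_leaf lp lk st'].
  elim: f st psi => //= f IH st psi.
  case E: [seq vs_children st v | v <- _] => [|l ls]; first by move=> h e un; exists st, psi.
  move=> h e un; have := foldl_min_mem l ls; rewrite -E => /mapP[v].
  rewrite mem_filter mem_iota /= add0n => /andP[vN lv'] eq; rewrite eq in h.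
  have [|st' [psi' [hc e' un']]] := vs_children_sound G C fr cA e un lv'.
    by move: vN; case: nth.
  exact: IH (alllP h hc) e' un'.
(* The search starts from the block [a0] alone, whose mate is cycle point 0. *)
have e0 : vs_embedded inc x A a0 M [:: None] (fun=> a0).
  split=> //=; first by move=> i _; apply: (frame_a0 fr).
    by move=> [|i] [|j].
  by move=> [|i] c1 c2 //=; rewrite nth_default.
have [|st [psi [e un leaf]]] := sound _ _ _ runP e0.
  by move=> [|i] c1 c2 //=; rewrite nth_default.
have em := vs_embedding C fr e (levi_uniq un).
have h4 i : i < 4 -> ph x M psi i = x i /\ bb b psi i = b i by move=> i4; rewrite /ph /bb i4.
move: leaf; rewrite /vs_leaf; case: ifP => [|_].
  rewrite lhasE => /hasP[pt ptp]; rewrite lhasE => /hasP[r rp er] _; left.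
  have /andP[cv /allP al] := allP lpP _ ptp.
  by exists pt => //; exists r => //; apply: occurs_emb em h4 cv (al _ rp) er.
rewrite lhasE => /hasP[es esk ee]; right.
by apply: emb_refuted ee (lkP esk) _ _ em; move=> k k' v.
Qed.

(** An embedding prescribes incidences without forbidding others. Here an additional incidence
    within the 8-cycle would close a 4-cycle, so the counts are exactly two. *)
Lemma octagon_cycle x b : embedding inc (4, C8) x b -> octagon inc (xset x) (bset b).
Proof.
move=> C; have ci := C_inc C.
have xi i j : i < 4 -> j < 4 -> (x i == x j) = (i == j).
  by move=> li lj; apply/eqP/eqP => [/(emb_inj_pt C li lj)|->].
have bi i j : i < 4 -> j < 4 -> (b i == b j) = (i == j).
  by move=> li lj; apply/eqP/eqP => [/(emb_inj_bl C li lj)|->].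
have [h00 h10] := ci 0 isT; have [h11 h21] := ci 1 isT.
have [h22 h32] := ci 2 isT; have [h33 h03] := ci 3 isT.
rewrite /= in h10 h21 h32 h03.
have lin i j k l : i < 4 -> j < 4 -> k < 4 -> l < 4 -> i != j -> k != l ->
    inc (x i) (b k) -> inc (x i) (b l) -> inc (x j) (b k) -> inc (x j) (b l) -> False.
  by move=> li lj hk ll ij kl; apply: (good_linear G); rewrite ?xi ?bi.
have inE4 i j : i < 4 -> j < 4 -> inc (x i) (b j) = (i == j) || (i == (j + 1) %% 4).
  move=> li lj; have [/orP[]/eqP->|] := boolP ((i == j) || (i == (j + 1) %% 4)); try by have [] := ci j lj.
  move=> nij; apply/negP => h; move: i li j lj nij h.
  case=> [|[|[|[|i]]]] // _ [|[|[|[|j]]]] // _ _ h.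
  - exact: (lin 0 1 1 0).
  - exact: (lin 0 3 2 3).
  - exact: (lin 1 2 2 1).
  - exact: (lin 1 0 3 0).
  - exact: (lin 2 1 0 1).
  - exact: (lin 2 3 3 2).
  - exact: (lin 3 0 0 3).
  - exact: (lin 3 2 1 2).
have cS : #|xset x| = 4.
  have -> : xset x = [set p in map x (iota 0 4)] by apply/setP=> p; rewrite !inE /= orbF !(eq_sym p) !orbA.
  rewrite cardsE (card_uniqP _) ?size_map // map_inj_in_uniq // => i j.
  by rewrite !mem_iota !add0n => li lj; apply: (emb_inj_pt C).
have cF : #|bset b| = 4.
  have -> : bset b = [set p in map b (iota 0 4)] by apply/setP=> p; rewrite !inE /= orbF !(eq_sym p) !orbA.
  rewrite cardsE (card_uniqP _) ?size_map // map_inj_in_uniq // => i j.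
  by rewrite !mem_iota !add0n => li lj; apply: (emb_inj_bl C).
split=> //.
- move=> p /xsetP[i li <-].
  have -> : bls inc (x i) :&: bset b = [set b i; b ((i + 3) %% 4)].
    have l3 : (i + 3) %% 4 < 4 by rewrite ltn_mod.
    apply/setP=> q; rewrite in_setI in_set2 inE; apply/andP/orP => [[iq /bsetP[j lj ej]]|].
      move: iq; rewrite -ej inE4 // !bi // => h.
      by move: i li j lj {ej l3} h => [|[|[|[|i]]]] // _ [|[|[|[|j]]]] //= _; auto.
    case=> /eqP->; (split; [|by apply/bsetP; eexists; [|reflexivity]]); rewrite inE4 ?eqxx //.
    by move: i li {l3} => [|[|[|[|i]]]].
  by rewrite cards2 bi ?ltn_mod //; move: i li => [|[|[|[|i]]]].
- move=> q /bsetP[j lj <-].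
  have -> : pts inc (b j) :&: xset x = [set x j; x ((j + 1) %% 4)].
    have l3 : (j + 1) %% 4 < 4 by rewrite ltn_mod.
    apply/setP=> p; rewrite in_setI in_set2 inE; apply/andP/orP => [[ip /xsetP[i li ei]]|].
      move: ip; rewrite -ei inE4 // !xi // => h.
      by move: j lj i li {ei l3} h => [|[|[|[|j]]]] // _ [|[|[|[|i]]]] //= _; auto.
    case=> /eqP->; (split; [|by apply/xsetP; eexists; [|reflexivity]]); rewrite inE4 ?eqxx ?orbT //.
  by rewrite cards2 xi ?ltn_mod //; move: j lj => [|[|[|[|j]]]].
Qed.

Lemma cycle_bichrom x b : embedding inc (4, C8) x b -> exists f, forall q, q \in bset b -> bichrom inc (xset x) f q.
Proof.
move=> C; exists (fun p => has (fun k => (x k == p) && odd k) (iota 0 4)) => q /bsetP[j lj <-].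
have fE k : k < 4 -> has (fun i => (x i == x k) && odd i) (iota 0 4) = odd k.
  move=> hk; apply/hasP/idP => [[i]|ok]; last by exists k; rewrite ?mem_iota ?add0n // eqxx.
  by rewrite mem_iota /= add0n => li /andP[/eqP/(emb_inj_pt C li hk)->].
have [h1 h2] := C_inc C lj; have l1 : (j + 1) %% 4 < 4 by rewrite ltn_mod.
apply/bichromP; exists (x j), (x ((j + 1) %% 4)); rewrite !fE //; split=> //.
- by apply/xsetP; exists j.
- by apply/xsetP; exists ((j + 1) %% 4).
- by move: j lj {h1 h2 l1} => [|[|[|[|j]]]].
Qed.

Lemma cycle_rot x b k : k < 4 -> embedding inc (4, C8) x b ->
  let x' i := x ((i + k) %% 4) in let b' i := b ((i + k) %% 4) in
  [/\ embedding inc (4, C8) x' b', xset x' = xset x & bset b' = bset b].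
Proof.
move=> k4 C x' b'.
have mi i j : i < 4 -> j < 4 -> (i + k) %% 4 = (j + k) %% 4 -> i = j.
  by move=> li lj /eqP; rewrite eqn_modDr !modn_small // => /eqP.
have l4 i : (i + k) %% 4 < 4 by rewrite ltn_mod.
have back i : i < 4 -> exists2 j, j < 4 & (j + k) %% 4 = i.
  move=> li; exists ((i + (4 - k)) %% 4); first by rewrite ltn_mod.
  by rewrite modnDml -addnA (subnK (ltnW k4)) modnDr modn_small.
split.
- split=> /=.
  + by move=> i j li lj /(emb_inj_pt C (l4 _) (l4 _))/mi; apply.
  + by move=> i j li lj /(emb_inj_bl C (l4 _) (l4 _))/mi; apply.
  + by move=> [|[|[|[|j]]]] //=; rewrite nth_default.
  have ci j : inc (x' j) (b' j) /\ inc (x' (j + 1)) (b' j).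
    have [h1 h2] := C_inc C (l4 j); split=> //.
    by rewrite /x' addnAC; move: h2; rewrite modnDml.
  have x4 : x' 4 = x' 0 by rewrite /x' modnDl.
  have [h0 h0'] := ci 0; have [h1 h1'] := ci 1.
  have [h2 h2'] := ci 2; have [h3 h3'] := ci 3; rewrite x4 in h3'.
  move=> i; do 4![case; first by rewrite !inE => /orP[]/eqP->; split].
  by move=> j; rewrite nth_default.
- apply/setP=> p; apply/xsetP/xsetP => [[i li <-]|[i li <-]]; first by exists ((i + k) %% 4).
  by have [j lj <-] := back i li; exists j.
- apply/setP=> p; apply/bsetP/bsetP => [[i li <-]|[i li <-]]; first by exists ((i + k) %% 4).
  by have [j lj <-] := back i li; exists j.
Qed.

Definition grot k (r : seq nat * seq nat) : seq nat * seq nat :=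
  ([seq (i + k) %% 4 | i <- r.1], [seq (i + k) %% 4 | i <- r.2]).

(** The search assumes that the mate of [a0] is cycle point 0; rotating the cycle by [k] arranges
    this, and [grot k] undoes it in the reported position. *)
Lemma violator_outcome x b A : embedding inc (4, C8) x b -> minviol inc (xset x) (bset b) A -> #|A| <= 9 ->
  (exists2 pt, pt \in lp & exists2 r, r \in pat_al pt & exists2 k, k < 4 & occurs inc x b (pat_state pt) (grot k r)) \/ Goal.
Proof.
move=> C mv cA; have [a0 [x0 [M fr]]] := frame_exists G (octagon_cycle C) mv.
have /xsetP[k k4 ek] := frame_x0 fr.
have [C' xE bE] := cycle_rot k4 C.
have fr' : frame inc (xset (fun i => x ((i + k) %% 4))) (bset (fun i => b ((i + k) %% 4))) A a0 (x ((0 + k) %% 4)) M.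
  by rewrite xE bE add0n modn_small // ek.
case: (frame_outcome C' fr' cA) => [[pt ptp [r rp [alpha [beta [e h]]]]]|]; [left|by right].
exists pt => //; exists r => //; exists k => //; exists alpha, beta; split=> // i li.
have [-> ->] := h i li.
have /andP[_ /allP al] := allP lpP _ ptp.
have /and5P[/eqP s1 /eqP s2 _ _ _] := al _ rp.
by rewrite /grot /= !(nth_map 0) ?s1 ?s2.
Qed.
End FrameOutcome.

(** The position of a pattern of the dual, read in the original graph. Points of the dual cycle are
    the blocks [b i] and its blocks are the points [x (i + 1)]: hence the shift by one in the first
    component and, since [cdual] shifts its blocks, the rotation in the second. *)
Definition gdual (g : seq nat * seq nat) : seq nat * seq nat := ([seq (i + 1) %% 4 | i <- g.2], rot 1 g.1).

Definition symmetries (s : state) es : seq (seq nat * seq nat) :=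
  [seq h <- dihedral | align_ok h && emb es s (aligned (iota 0 4) (iota 0 4) h).1 (aligned (iota 0 4) (iota 0 4) h).2].
Definition reduces (pats : seq pattern) (s : state) sym g : bool :=
  has (fun pt => (pat_state pt == s) && has (fun h => gcomp g h \in pat_al pt) sym) pats.
(** A position [g] is found in the list after composition with an automorphism of the pattern, for
    the original graph and for the dual, and for all four rotations of every alignment. *)
Definition reduction_check (lp pats : seq pattern) : bool :=
  all (fun pt =>
    let s := pat_state pt in let es := full_edges s in let sym := symmetries s es in
    let s' := cdual s in let es' := full_edges s' in let sym' := symmetries s' es' in
    [&& 4 <= s.1, cover es s, cover es' s' &
     all (fun r => (size r.1 == 4) && (size r.2 == 4) && all (fun k => let g := grot k r in
       reduces pats s sym g && reduces pats s' sym' (gdual g)) (iota 0 4)) (pat_al pt)]) lp.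

Section Outcome.
Variables (P Q : finType) (inc : P -> Q -> bool) (n : nat) (Goal : Prop).
Hypotheses (G : good inc n) (n21 : n <= 21).
Variables (lp : seq pattern) (lk : seq (seq (nat * nat))) (fuel : nat) (pats : seq pattern).
Hypothesis lpP : all (fun pt => cover (pat_es pt) (pat_state pt) && all align_ok (pat_al pt)) lp.
Hypothesis lkP : forall es, es \in lk -> refuted_es inc Goal es.
Hypothesis lkP' : forall es, es \in lk -> refuted_es (flipi inc) Goal es.
Hypothesis runP : violator_search lp lk fuel [:: None].
Hypothesis redP : reduction_check lp pats.

Lemma reduces_sound x b s es g : cover es s -> reduces pats s (symmetries s es) g -> occurs inc x b s g ->
  exists2 pt, pt \in pats & exists r alpha beta,
    [/\ r \in pat_al pt, embedding inc (pat_state pt) alpha beta,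
        forall i, i < 4 -> alpha i = x (nth 0 r.1 i) & forall i, i < 4 -> beta i = b (nth 0 r.2 i)].
Proof.
move=> cv /hasP[pt ptp /andP[/eqP ps /hasP[h]]]; rewrite mem_filter => /andP[/andP[okh em] _] hal oc.
have [alpha [beta [e hab]]] := occurs_sym okh cv em oc.
exists pt => //; exists (gcomp g h), alpha, beta; rewrite ps; split=> // i /hab[] //.
Qed.

(** The graph and its dual both have a minimal violator at the cycle. With [n <= 21],
    [minviol_disjoint] bounds one of them by nine blocks; if it is the one of the dual, the pattern
    found is transposed by [cdual]. *)
Lemma cycle_outcome : outcome_complete inc Goal pats.
Proof.
move=> x b C; have G' := good_dual G.
have [S4 F4 hS hF] := octagon_cycle G C.
pose b' i := x ((i + 1) %% 4).
have l4 i : (i + 1) %% 4 < 4 by rewrite ltn_mod.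
have mi i j : i < 4 -> j < 4 -> (i + 1) %% 4 = (j + 1) %% 4 -> i = j.
  by move=> li lj /eqP; rewrite eqn_modDr !modn_small // => /eqP.
have C' : embedding (flipi inc) (4, C8) b b'.
  split=> /=.
  - by move=> i j li lj; apply: (emb_inj_bl C).
  - by move=> i j li lj /(emb_inj_pt C (l4 _) (l4 _))/mi; apply.
  - by move=> [|[|[|[|j]]]] //=; rewrite nth_default.
  have [h00 h10] := C_inc C (isT : 0 < 4); have [h11 h21] := C_inc C (isT : 1 < 4).
  have [h22 h32] := C_inc C (isT : 2 < 4); have [h33 h03] := C_inc C (isT : 3 < 4).
  move=> i; do 4![case; first by rewrite !inE => /orP[]/eqP->; split].
  by move=> j; rewrite nth_default.
have xE : bset b' = xset x.
  apply/setP=> p; apply/bsetP/xsetP => [[i li <-]|[i li <-]]; first by exists ((i + 1) %% 4).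
  by case: i li => [|[|[|[|i]]]] // _; [exists 3|exists 0|exists 1|exists 2].
have bE : xset b = bset b by [].
have [f hf] := cycle_bichrom C; have [f' hf'] := cycle_bichrom C'.
have [A mv] := minviol_exists G (octagon_cycle G C) hf.
have [A' mv'] := minviol_exists G' (octagon_cycle G' C') hf'.
have := minviol_disjoint G S4 mv; rewrite -xE -bE => /(_ _ mv') dj.
have [A9|A9] := leqP #|A| 9.
  case: (violator_outcome G lpP lkP runP C mv A9) => [[pt ptp [r rp [k k4 oc]]]|]; [left|by right].
  have /and4P[_ cv _ /allP h] := allP redP _ ptp; have /andP[_ /allP h'] := h _ rp.
  have /h'/andP[h1 _] : k \in iota 0 4 by rewrite mem_iota add0n.
  exact: reduces_sound cv h1 oc.
have A'9 : #|A'| <= 9 by lia.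
case: (violator_outcome G' lpP lkP' runP C' mv' A'9) => [[pt ptp [r rp [k k4 oc]]]|]; [left|by right].
have /and4P[s4 _ cv /allP h] := allP redP _ ptp; have /andP[/andP[/eqP r1 /eqP r2] /allP h'] := h _ rp.
have /h'/andP[_ h2] : k \in iota 0 4 by rewrite mem_iota add0n.
apply: reduces_sound cv h2 _; case: oc => alpha [beta [e hab]].
exists beta, (fun i => alpha (if i < 4 then (i + 1) %% 4 else i)); split; first exact: embedding_cdual.
move=> i i4; rewrite i4; have [_ ->] := hab i i4; have [-> _] := hab _ (l4 i).
rewrite /b'; case: r r1 r2 {rp h' hab} => [s1' s2'] /=.
case: s1' => [|c0 [|c1 [|c2 [|c3 [|]]]]] // _; case: s2' => [|d0 [|d1 [|d2 [|d3 [|]]]]] // _.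
by case: i i4 => [|[|[|[|]]]].
Qed.
End Outcome.

(** * Contraction *)

Section Contract.
Variables (P Q : finType) (inc : P -> Q -> bool) (n : nat).
Hypothesis G : good inc n.
Variables (phi : nat -> P) (psi : nat -> Q).
Hypothesis E : embedding inc DX13 phi psi.

Let full_block j p := full_block G E (j := j) (p := p).
Let full_point i q := full_point G E (i := i) (q := q).

Definition gone := [set p | has (fun i => phi i == p) [:: 0; 1; 2; 3; 5; 6]].
Definition bgone := [set q | has (fun j => psi j == q) (iota 0 6)].
Definition P' : finType := {p : P | p \notin gone}.
Definition Q' : finType := {q : Q | q \notin bgone}.
(** The merged point is [phi 4], which takes over the blocks of [phi 5] and [phi 6]. Six points and
    the six blocks of [X13] disappear, so the two sides stay equal. *)
Definition linked p q := inc p q || (p == phi 4) && (inc (phi 5) q || inc (phi 6) q).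
Definition inc' (p : P') (q : Q') := linked (val p) (val q).

Lemma phiE i j : i < 7 -> j < 7 -> (phi i == phi j) = (i == j).
Proof. by move=> li lj; apply/eqP/eqP => [/(emb_inj_pt E li lj)|->]. Qed.
Lemma psiE i j : i < 9 -> j < 9 -> (psi i == psi j) = (i == j).
Proof. by move=> li lj; apply/eqP/eqP => [/(emb_inj_bl E li lj)|->]. Qed.

Lemma p4_in : phi 4 \notin gone.
Proof. by rewrite inE /= !phiE. Qed.
Definition p4 : P' := Sub (phi 4) p4_in.

Lemma bgoneP q : reflect (exists2 j, j < 6 & q = psi j) (q \in bgone).
Proof.
rewrite inE; apply: (iffP hasP) => [[j]|[j lj ->]]; first by rewrite mem_iota add0n => lj /eqP<-; exists j.
by exists j; rewrite ?mem_iota ?add0n.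
Qed.

Lemma inner_block i q : i < 4 -> inc (phi i) q -> q \in bgone.
Proof.
move=> i4 iq; have [|j jb ->] := full_point _ iq; first by case: i i4 {iq} => [|[|[|[|i]]]].
apply/bgoneP; exists j => //.
by move: jb; case: i i4 {iq} => [|[|[|[|i]]]] // _; rewrite /= !inE => /or3P[]/eqP->.
Qed.

Lemma outer_block i q : i < 3 -> inc (phi (4 + i)) q -> q \in bgone \/ q = psi (6 + i).
Proof.
move=> i3 iq; have [|j jb ->] := full_point _ iq; first by case: i i3 {iq} => [|[|[|i]]].
have /orP[j6|/eqP->] : (j < 6) || (j == 6 + i); last by right.
  by move: jb; case: i i3 {iq} => [|[|[|i]]] // _; rewrite /= !inE => /or3P[]/eqP->.
by left; apply/bgoneP; exists j.
Qed.

Lemma gone_block j p : j < 6 -> inc p (psi j) -> exists2 i, i < 7 & p = phi i.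
Proof.
move=> j6 pj; have [|i ib ->] := full_block _ pj; first by case: j j6 {pj} => [|[|[|[|[|[|j]]]]]].
exists i => //.
by move: ib; case: j j6 {pj} => [|[|[|[|[|[|j]]]]]] // _; rewrite /= !inE => /or3P[]/eqP->.
Qed.

Definition rep p := if (p == phi 5) || (p == phi 6) then phi 4 else p.

Lemma goneP p : reflect (exists2 i, i \in [:: 0; 1; 2; 3; 5; 6] & p = phi i) (p \in gone).
Proof.
by rewrite inE; apply: (iffP hasP) => [[i hi /eqP<-]|[i hi ->]]; exists i.
Qed.

Lemma rep_linked p q : q \notin bgone -> inc p q -> rep p \notin gone /\ linked (rep p) q.
Proof.
move=> nq pq; rewrite /rep /linked; case: ifP => [/orP[]/eqP ep|/norP[n5 n6]].
- by rewrite p4_in eqxx -ep pq orbT.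
- by rewrite p4_in eqxx -ep pq !orbT.
split; last by rewrite pq.
apply/goneP=> -[i hi ei]; rewrite ei in pq n5 n6.
have [i4|] := ltnP i 4; first by case/negP: nq; apply: inner_block i4 pq.
by move: hi n5 n6; rewrite !inE => /or4P[/eqP->|/eqP->|/eqP->|/or3P[]/eqP->] //; rewrite !eqxx.
Qed.

(** This is where the three added blocks of [DX13] must be distinct: no remaining block then
    contains two of the points 4, 5, 6, and merging does not shrink a block. *)
Lemma rep_inj q : q \notin bgone -> {in pts inc q &, injective rep}.
Proof.
move=> nq.
have out i : i < 3 -> inc (phi (4 + i)) q -> q = psi (6 + i).
  by move=> i3 /(outer_block i3)[qb|//]; rewrite qb in nq.
have one i j : i < 3 -> j < 3 -> inc (phi (4 + i)) q -> inc (phi (4 + j)) q -> i = j.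
  move=> i3 j3 /(out i i3) e1 /(out j j3) e2; have := psiE (i := 6 + i) (j := 6 + j).
  by rewrite -e1 -e2 eqxx => h; apply/eqP; rewrite -(eqn_add2l 6) -h //; lia.
have cls p : rep p = phi 4 \/ rep p = p /\ p <> phi 5 /\ p <> phi 6.
  by rewrite /rep; case: ifP => [_|/norP[/eqP ? /eqP ?]]; [left|right].
have cls4 p : rep p = phi 4 -> exists2 i, i < 3 & p = phi (4 + i).
  rewrite /rep; case: ifP => [/orP[]/eqP->|_ ->]; first by exists 1.
    by exists 2.
  by exists 0.
move=> p p'; rewrite !inE => pq p'q epp.
have [h|[h _]] := cls p; have [h'|[h' _]] := cls p'.
- have [i i3 ei] := cls4 _ h; have [j j3 ej] := cls4 _ h'; rewrite ei ej in pq p'q *.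
  by rewrite (one i j).
- have [i i3 ei] := cls4 _ h; have [j j3 ej] := cls4 _ (etrans (esym epp) h); rewrite ei ej in pq p'q *.
  by rewrite (one i j).
- have [i i3 ei] := cls4 _ (etrans epp h'); have [j j3 ej] := cls4 _ h'; rewrite ei ej in pq p'q *.
  by rewrite (one i j).
- by rewrite -h epp.
Qed.

Lemma contract_cubic : cubic inc'.
Proof.
split=> [q|p].
  (* [rep] maps the three old points of a surviving block bijectively onto its new ones. *)
  have nq := valP q; rewrite -((good_cubic G).1 (val q)) -(card_in_imset (rep_inj nq)) -(card_imset _ val_inj).
  congr #|pred_of_set _|; apply/setP=> p; apply/imsetP/imsetP => [[p' h ->]|[p' h ->]].
    move: h; rewrite inE /inc' /linked => /orP[h|/andP[/eqP-> /orP[]h]].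
    + exists (val p'); first by rewrite inE.
      rewrite /rep; case: ifP => // /orP[]/eqP e; have /negP[] := valP p'; apply/goneP.
        by exists 5.
      by exists 6.
    + by exists (phi 5); rewrite ?inE // /rep eqxx.
    + by exists (phi 6); rewrite ?inE // /rep eqxx orbT.
  rewrite inE in h; have [h1 h2] := rep_linked nq h.
  by exists (Sub (rep p') h1); rewrite ?inE /inc' ?SubK.
have np := valP p.
have nin j : j < 9 -> 5 < j -> psi j \notin bgone.
  move=> l9 l5; apply/bgoneP=> -[k k6 /eqP]; rewrite psiE //; last by lia.
  by move/eqP; lia.
rewrite -(card_imset _ val_inj).
have [ep|np4] := eqVneq (val p) (phi 4).
  have -> : val @: bls inc' p = [set psi 6; psi 7; psi 8].
    have i6 : inc (phi 4) (psi 6) by have [] := emb_inc E (isT : 4 \in nth [::] DX13.2 6).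
    have i7 : inc (phi 5) (psi 7) by have [] := emb_inc E (isT : 5 \in nth [::] DX13.2 7).
    have i8 : inc (phi 6) (psi 8) by have [] := emb_inc E (isT : 6 \in nth [::] DX13.2 8).
    apply/setP=> q; apply/imsetP/idP => [[q' h ->]|].
      have nq' := valP q'; move: h; rewrite inE /inc' /linked ep eqxx => /or3P[]h.
      - by have [e|->] := @outer_block 0 _ isT h; [rewrite e in nq'|rewrite !inE eqxx].
      - by have [e|->] := @outer_block 1 _ isT h; [rewrite e in nq'|rewrite !inE eqxx orbT].
      - by have [e|->] := @outer_block 2 _ isT h; [rewrite e in nq'|rewrite !inE eqxx orbT].
    rewrite !inE -orbA => /or3P[]/eqP->.
    - by exists (Sub (psi 6) (nin 6 isT isT)); rewrite ?SubK // inE /inc' /linked SubK ep i6.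
    - by exists (Sub (psi 7) (nin 7 isT isT)); rewrite ?SubK // inE /inc' /linked SubK ep eqxx i7 orbT.
    - by exists (Sub (psi 8) (nin 8 isT isT)); rewrite ?SubK // inE /inc' /linked SubK ep eqxx i8 !orbT.
  by rewrite -setUA cardsU1 !inE cards2 !psiE.
rewrite -((good_cubic G).2 (val p)); congr #|pred_of_set _|; apply/setP=> q; apply/imsetP/idP => [[q' h ->]|].
  by move: h; rewrite !inE /inc' /linked (negbTE np4) orbF.
rewrite inE => pq; have nq : q \notin bgone.
  apply/bgoneP=> -[j j6 ej]; rewrite ej in pq; have [i i7 ei] := gone_block j6 pq.
  case/negP: np; rewrite ei; apply/goneP; exists i => //; rewrite ei phiE // in np4.
  by move: i i7 {ei} np4 => [|[|[|[|[|[|[|i]]]]]]].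
by exists (Sub q nq); rewrite ?SubK // inE /inc' /linked SubK pq.
Qed.

Lemma contract_conn : conn inc'.
Proof.
move=> X Y hXY ne.
pose in7 p := has (fun i => phi i == p) (iota 0 7).
(* A union of components is lifted by putting all of [X13], points and blocks, on the side of the
   merged point. *)
pose mX p := if in7 p then p4 \in X else if insub p is Some p' then p' \in X else false.
pose mY q := if insub q is Some q' then q' \in Y else p4 \in X.
have in7P p : reflect (exists2 i, i < 7 & p = phi i) (in7 p).
  apply: (iffP hasP) => [[i]|[i li ->]]; first by rewrite mem_iota add0n => li /eqP<-; exists i.
  by exists i; rewrite ?mem_iota ?add0n.
have goneI p : p \in gone -> in7 p.
  by case/goneP=> i hi ->; apply/in7P; exists i => //; move: hi; rewrite !inE => /or4P[/eqP->|/eqP->|/eqP->|/or3P[]/eqP->].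
have mXE (p : P') : mX (val p) = (p \in X).
  rewrite /mX valK; case: ifP => // /in7P[i i7 ei].
  have [ei4|ni4] := eqVneq i 4; first by congr (_ \in X); apply: val_inj; rewrite /= ei ei4.
  have /negP[] := valP p; rewrite ei; apply/goneP; exists i => //.
  by move: i i7 {ei} ni4 => [|[|[|[|[|[|[|i]]]]]]].
have closed : forall p q, inc p q -> (p \in [set p | mX p]) = (q \in [set q | mY q]).
  move=> p q pq; rewrite !inE; have [qb|nq] := boolP (q \in bgone).
    have -> : mY q = (p4 \in X) by rewrite /mY insubF //; apply/negbTE; rewrite negbK.
    have /bgoneP[j j6 ej] := qb; rewrite ej in pq; have [i i7 ei] := gone_block j6 pq.
    by rewrite /mX; have -> : in7 p by apply/in7P; exists i.
  have -> : mY q = (Sub q nq \in Y) by rewrite /mY insubT.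
  have [h1 h2] := rep_linked nq pq.
  rewrite -(hXY (Sub (rep p) h1) (Sub q nq)); last by rewrite /inc' !SubK.
  rewrite -mXE SubK /rep; case: ifP => // h5.
  have m i : i < 7 -> mX (phi i) = (p4 \in X) by move=> i7; rewrite /mX ifT //; apply/in7P; exists i.
  by case/orP: h5 => /eqP->; rewrite !m.
have [XT YT] : [set p | mX p] = setT /\ [set q | mY q] = setT.
  apply: (good_conn G) => //; case/orP: ne => /set0Pn[z zX].
    by apply/orP; left; apply/set0Pn; exists (val z); rewrite inE mXE.
  by apply/orP; right; apply/set0Pn; exists (val z); rewrite inE /mY valK.
split; apply/setP=> z; rewrite inE.
  by have /setP/(_ (val z)) := XT; rewrite !inE mXE.
by have /setP/(_ (val z)) := YT; rewrite !inE /mY valK.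
Qed.

(* the four inner points take the colour opposite to the merged point *)
Lemma contract_ncol : ~ colourable inc'.
Proof.
case=> f' hf'; apply: (good_ncol G).
pose inner p := has (fun i => phi i == p) (iota 0 4).
pose f p := if inner p then ~~ f' p4 else if insub (rep p) is Some p' then f' p' else false.
have innerP p : reflect (exists2 i, i < 4 & p = phi i) (inner p).
  apply: (iffP hasP) => [[i]|[i li ->]]; first by rewrite mem_iota add0n => li /eqP<-; exists i.
  by exists i; rewrite ?mem_iota ?add0n.
have f_in i : i < 4 -> f (phi i) = ~~ f' p4 by move=> i4; rewrite /f ifT //; apply/innerP; exists i.
have ninner p : rep p \notin gone -> inner p = false.
  move=> h; apply/negP => /innerP[i i4 ei]; case/negP: h; rewrite /rep ei !phiE; try lia.
  have -> : (i == 5) || (i == 6) = false by lia.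
  by apply/goneP; exists i => //; move: i i4 {ei} => [|[|[|[|i]]]].
have fE p (h : rep p \notin gone) : f p = f' (Sub (rep p) h).
  by rewrite /f (ninner p h) insubT.
have rep4 i : 3 < i -> i < 7 -> rep (phi i) = phi 4.
  by move=> h1 h2; rewrite /rep !phiE //; move: i h1 h2 => [|[|[|[|[|[|[|i]]]]]]].
have f_out i : 3 < i -> i < 7 -> f (phi i) = f' p4.
  move=> h1 h2; have h : rep (phi i) \notin gone by rewrite rep4 // p4_in.
  by rewrite (fE _ h); congr f'; apply: val_inj; rewrite /= rep4.
exists f => q; have [/bgoneP[j j6 ->]|nq] := boolP (q \in bgone).
  have [a [c [aj cj a4 c4]]] : exists a c, [/\ a \in nth [::] DX13.2 j, c \in nth [::] DX13.2 j, a < 4 & 3 < c].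
    by case: j j6 => [|[|[|[|[|[|j]]]]]] // _; [exists 0, 4|exists 2, 4|exists 0, 5|exists 1, 5|exists 0, 6|exists 1, 6].
  have [la ia] := emb_inc E aj; have [lc ic] := emb_inc E cj.
  apply/bichromP; exists (phi a), (phi c); rewrite !inE f_in // f_out //; split=> //.
  by case: (f' p4).
have /bichromP[u [v [_ _ uq vq uv]]] := hf' (Sub q nq).
have back (w : P') : inc' w (Sub q nq) -> exists2 p, inc p q & f p = f' w.
  rewrite /inc' /linked SubK => h.
  have [p pq ep] : exists2 p, inc p q & rep p = val w.
    case/orP: h => [h|/andP[/eqP-> /orP[]h]].
    - exists (val w) => //; rewrite /rep; case: ifP => // /orP[]/eqP e; have /negP[] := valP w; apply/goneP.
        by exists 5.
      by exists 6.
    - by exists (phi 5); rewrite // rep4.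
    - by exists (phi 6); rewrite // rep4.
  exists p => //; have h' : rep p \notin gone by rewrite ep; exact: (valP w).
  by rewrite (fE _ h'); congr f'; apply: val_inj; rewrite /= ep.
have [p pq fp] := back u uq; have [p' p'q fp'] := back v vq.
by apply/bichromP; exists p, p'; rewrite !inE fp fp'.
Qed.

Lemma contract_good : good inc' (n - 6).
Proof.
split; [exact: contract_cubic|exact: contract_conn|exact: contract_ncol|].
rewrite card_sub -(good_card G) -[in RHS](cardC (mem gone)).
have -> : #|mem gone| = 6.
  have -> : #|mem gone| = #|[set p in map phi [:: 0; 1; 2; 3; 5; 6]]|.
    by apply: eq_card => p; rewrite !inE /= !(eq_sym p) orbF.
  rewrite cardsE (card_uniqP _) ?size_map // map_inj_in_uniq // => i j hi hj.
  have l7 k : k \in [:: 0; 1; 2; 3; 5; 6] -> k < 7 by rewrite !inE => /or4P[/eqP->|/eqP->|/eqP->|/or3P[]/eqP->].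
  exact: (emb_inj_pt E (l7 _ hi) (l7 _ hj)).
by rewrite addKn; apply: eq_card => p; rewrite !inE.
Qed.
End Contract.

(** * The case analysis *)

(** As bipartite graphs: [theta] is three paths of length three from point 0 to the block of 1, 2,
    3; [tri] is two 6-cycles sharing the incidence of point 2 with the last block; [six] is a single
    6-cycle. *)
Definition theta : state := (4, [:: [::0;1]; [::0;2]; [::0;3]; [::1;2;3]]).
Definition tri : state := (5, [:: [::0;1]; [::1;2]; [::2;3]; [::3;4]; [::4;0;2]]).
Definition six : state := (3, [:: [::0;1]; [::1;2]; [::2;0]]).
Definition heawood : state := (7, rcons X13.2 [:: 4;5;6]).
(** Point [j] of copy [i] is numbered [7 * i + j]. The Fano lines are [{j, j + 1, j + 3}]; the one
    with [j = 0] is replaced by a block that leads to point 0 of the next copy. *)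
Definition TF : state := (21, flatten [seq [seq [:: 7 * i + j; 7 * i + (j + 1) %% 7; 7 * i + (j + 3) %% 7] | j <- iota 1 6]
    ++ [:: [:: 7 * i + 1; 7 * i + 3; 7 * ((i + 1) %% 3)]] | i <- iota 0 3]).
Definition XX : state := dunion X14 X14.
Definition heawood2 : state := dunion X14 heawood.
(** [RC], and next its dual, renumbered so that their copy of [X14] fills the first seven points and
    blocks and can be anchored. *)
Definition RCx : state := (11, X13.2 ++ [:: [::4;5;8]; [::7;8]; [::8;9]; [::9;10]; [:: 10;7]; [::6;7;9]]).
Definition RCdx : state := (12, X13.2 ++ [:: [::4;5;11]; [::7;8;6]; [::8;9;11]; [:: 9;10]; [::10;7;11]]).

Definition target := (state * (seq (nat * state) * seq (nat * state)))%type.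
Definition tg (s : state) auto known : target := (s, (auto, known)).
Definition DXs := [:: (0, DX13); (0, DX13d)].
Definition T2s := [:: (0, T2); (0, cdual T2)].

Definition targets_pats : seq target :=
  [:: tg T2 [::] DXs; tg (cdual T2) [::] DXs; tg X11b [::] (T2s ++ DXs); tg (cdual X11b) [::] (T2s ++ DXs);
      tg UX [:: (0, DX13)] [:: (0, DX13d)]; tg (cdual UX) [:: (0, DX13)] [:: (0, DX13d)]].

(* Extensions of [tri] that cut its refutation into short pieces. *)
Definition T6 : state := (10, [:: [::0;1];[::1;2;5];[::2;3;6];[::3;4];[::4;0;2];[::5;6];[::1;7];[::5;7];[::3;8];[::6;8];[::0;9];[::4;9]]).
Definition T5 : state := (9, take 10 T6.2).
Definition T4 : state := (8, take 8 T6.2).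
Definition T3 : state := (7, take 6 T6.2).

(* Refutations in the presence of a partial configuration [Y], disjoint from what is drawn. *)
Section Layer.
Variables (Y : state) (closing : seq (nat * state)).
Let D s := dunion Y s.
Let k s := (Y.1, D s).
Definition layer1 : seq target :=
  [:: tg (D X13) [:: k X14] DXs; tg (D (dual X13)) [:: k X14] DXs;
      tg (D PATH) [::] [:: k X13; k (dual X13); k X14]; tg (D (dual PATH)) [::] [:: k X13; k (dual X13); k X14]].
(** An [RC] contains an [X14]; [rc] lists the forms in which this copy is [Y] itself rather than
    disjoint from it. *)
Definition layer2 (rc : seq (nat * state)) : seq target :=
  [:: tg (D (4, C8)) [::] (closing ++ [:: k PATH, k (dual PATH), k X14 & rc])].
(** With 8-cycles already excluded, the 6-cycles are removed from the richest patterns down, and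
    [last] remains: [Y] alone, or one incidence if [Y] is empty. In the latter case there are no
    cycles shorter than 10 left, and such a cubic bipartite graph has at least 31 points by the
    Moore bound. *)
Definition layer3 (last : state) : seq target :=
  [seq tg x.1 [:: k (4, C8)] (closing ++ map k x.2) | x <-
   [:: (D theta, [::]); (D T6, [:: theta]); (D T5, [:: theta; T6]); (D T4, [:: theta; T5]);
       (D T3, [:: theta; T4]); (D (dual T3), [:: theta; T4]); (D tri, [:: theta; T3; dual T3]);
       (D six, [:: theta; tri]); (last, [:: six])]].
End Layer.

(** Each [X14] lacks one incidence, at one point and one block. Three disjoint copies exhaust the 21
    points, and the three missing incidences form a permutation of the copies: a fixed copy closes
    up to a Fano plane ([heawood]), and a 3-cycle is [TF]. *)
Definition targets_XX : seq target :=
  [:: tg heawood [::] [::]; tg heawood2 [::] [:: (0, heawood)];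
      tg (dunion XX X14) [::] [:: (0, heawood); (0, TF)]] ++
  layer1 XX ++ layer2 XX [:: (7, heawood); (14, heawood2)] [::] ++ layer3 XX [:: (7, heawood); (14, heawood2)] XX.
Definition targets_X : seq target :=
  layer1 X14 ++
  [seq tg s [::] [:: (7, heawood); (7, XX); (7, dunion X14 PATH); (7, dunion X14 (dual PATH))] | s <- [:: RCx; RCdx]] ++
  layer2 X14 [:: (7, heawood)] [:: (7, RCx); (7, RCdx)] ++ layer3 X14 [:: (7, heawood)] X14.
Definition targets_0 : seq target :=
  layer1 (0, [::]) ++ layer2 (0, [::]) [::] [::] ++ layer3 (0, [::]) [::] (1, [:: [:: 0]]).

(* Found by an untrusted search; [replay] consumes the steps depth first. *)
Section Scripts.
Local Notation p := Point.
Local Notation b := Block.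
Local Notation c := Cycle.
Local Notation k := Known.
Local Notation m := Memo.
Local Notation s := Save.
Local Notation l := Leaf.
Definition script_pats : seq (seq step) := [::
[:: c 4 5 7 8]; [:: c 5 7 10 9]; [:: c 0 1 6 5;c 0 3 8 7]; [:: c 0 4 6 5;c 0 1 7 6]; [:: p 7]; [:: b 7;k 0;k 0;k 0;k
0;k 0]].
Definition script_XX : seq (seq step) := [::
[:: l]; [:: k 0]; [:: p 20;s;p 6;p 13;k 1;p 13;k 0;m 0;k 0]; [:: p 18;s;p 19;p 20;k 0;s;p 20;k 0;m 0;p 19;m 1;m 1];
[:: b 18;s;b 19;b 20;k 1;s;b 20;k 1;m 0;b 19;m 1;m 1]; [:: c 14 15 17 16;c 14 16 15 17;k 0;k 1;k 1;s;c 14 16 15 17;m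
0;m 0;m 0;m 0;m 0;m 0;m 0;m 0;m 0;m 0;m 0;m 0;m 0;m 0;m 0;m 0;m 0;m 0;m 0;m 0;m 0;m 0;m 0;m 0;m 0;m 0;m 0;m 0;m 0;m
0;m 0]; [:: c 14 18 16 19;k 0;c 15 18 17 19;k 0;k 1;s;c 15 18 17 19;m 0;m 0;m 0;m 0;m 0;m 0;m 0;m 0;m 0;m 0;m 0;m 0;m
0;m 0;m 0;m 0;m 0;m 0;m 0;m 0;m 0;m 0;m 0;m 0;m 0;m 0;m 0;m 0;m 0;m 0;m 0]; [:: c 14 15 16 17;k 2;k 3;s;p 17;b 14;b
15;b 16;p 19;p 19;b 17;p 18;s;c 14 16 19 18;m 0;p 20;s;c 14 16 19 20;m 0;p 18;p 18;s;b 15;b 17;p 19;c 14 16 18 19;p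
19;m 1;p 19;k 3;p 19;k 2;s;b 17;c 7 11 17 13;p 20;c 14 15 19 20;c 14 15 19 20;p 19;k 3;m 0;p 18;m 0;b 15;b 16;p 19;s;c
14 17 19 18;m 0;p 19;p 19;m 2;m 2;s;p 19;m 2;m 0;b 13;k 1;b 14;b 15;b 16;p 19;p 19;p 19;p 19;s;b 16;p 18;c 14 16 18
19;p 20;c 14 16 20 19;c 14 15 19 17;p 19;m 0;c 14 15 19 17;p 18;b 15;b 17;p 19;p 19;p 19;k 3;c 14 15 19 17;p 19;k 3;c
14 15 19 17;c 14 16 17 18;s;c 15 16 17 18;m 0;m 0;m 0;m 0;m 0;m 0;m 0;b 15;b 16;p 19;c 14 17 19 18;p 19;p 19;s;b 16;b
19;p 20;c 14 17 20 18;p 20;c 14 17 20 18;c 14 15 19 17;p 19;m 0;c 14 15 19 17;p 19;p 19;s;b 15;m 2;p 18;k 3;c 14 15 18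
17;m 0;p 20;k 3;c 14 15 20 17;p 20;k 2;c 14 15 20 17;c 14 16 17 19;p 19;m 0;c 14 16 17 19;m 0;m 0;m 0;m 0;m 0;m 0;m
0;m 0;m 0;m 0;m 0;m 0;m 0;m 0;m 0;m 0;m 0;m 0;m 0;m 0;m 0;m 0;m 0;m 0;m 0;m 0;m 0;m 0;m 0;m 0;m 0;m 0;m 0;m 0;m 0;m
0;m 0;m 0;m 0;m 0;m 0;m 0;m 0;m 0;m 0;m 0;m 0;m 0;m 0;m 0;m 0;m 0;m 0;m 0;m 0;m 0;m 0;m 0;m 0;m 0;m 0;m 0;m 0;s;p 14;p
15;s;p 16;p 17;b 16;b 18;p 19;c 16 18 17 19;p 19;c 16 18 17 19;p 19;p 19;b 16;b 18;p 19;p 19;c 14 15 19 17;c 14 15 19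
17;p 19;c 14 15 19 17;p 15;m 0;b 16;b 18;b 18;b 19;k 2;b 19;k 2;s;p 17;c 7 11 17 13;b 20;c 14 15 19 17;c 14 15 20 17;b
19;k 2;m 0;p 19;p 19;s;p 16;p 17;k 2;s;b 19;p 20;c 14 15 20 17;p 17;m 0;s;p 16;p 17;k 2;b 19;p 20;c 14 15 20 19;c 14
15 16 19;p 19;m 1;s;b 20;s;c 14 15 16 19;m 0;b 20;s;c 14 15 16 19;m 0;p 19;m 3;m 0;p 19;p 19;s;c 14 15 16 19;m 0;s;p
16;p 17;k 2;s;c 14 15 16 19;s;c 14 15 19 17;m 0;m 0;m 0;m 0;m 0;m 0;m 0;m 0;p 19;m 2;s;c 14 15 16 19;m 0;m 0;m 0;m 0;m
0;m 0;m 0;m 0;m 0;m 0;m 0;m 0;m 0;m 0;m 0;m 0;m 0;m 0;m 0;m 0;m 0;m 0;m 0;m 0;m 0;m 0;m 0;m 0;m 0;m 0;m 0;m 0;m 0;m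
0;m 0;m 0;m 0;m 0;m 0;m 0;m 0;m 0;m 0;m 0;m 0;m 0;m 0;m 0;m 0;m 0;m 0;m 0;m 0;m 0;m 0;m 0;m 0;m 0;m 0;m 0;m 0;m 0;m
0;m 0]; [:: p 15;s;p 16;p 17;s;b 14;b 15;b 16;p 18;p 18;b 18;b 18;p 19;s;p 19;m 0;p 18;p 18;s;b 16;b 18;p 19;p 19;b
15;b 16;p 18;p 18;b 18;b 18;p 19;s;p 19;m 0;p 18;p 18;s;b 16;b 18;p 19;p 19;p 18;p 18;b 15;m 0;m 2;p 19;s;p 17;m 0;s;b
13;b 14;b 15;p 18;p 18;p 18;p 18;k 1;b 14;b 15;b 16;p 18;s;b 18;p 19;p 19;p 19;p 18;b 16;m 0;p 19;p 19;p 19;b 15;b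
16;p 18;s;b 18;p 19;p 19;p 19;p 18;b 16;m 0;p 19;p 19;p 19;p 18;b 15;b 16;s;b 18;p 19;p 19;b 16;m 0;p 19;p 19;p 19;p
19;m 0;p 16;m 1;m 1;p 17;m 2;m 2;b 6;k 0;b 13;b 14;p 18;s;b 14;b 15;p 18;p 19;p 18;p 19;b 13;m 0;k 1;b 14;s;b 15;b
16;s;b 18;p 19;p 19;s;b 16;m 0;p 19;p 19;m 0;b 15;m 1;m 1;p 19;p 19;b 14;s;b 15;b 16;s;p 18;m 0;p 20;p 18;p 19;p 20;m
0;s;p 18;m 0;p 20]; [:: l]; [:: l]; [:: l]; [:: b 14;s;b 17;b 19;m 0]; [:: p 14;s;p 17;p 19;m 0]; [:: p 14;s;p 15;p
17;p 18;s;b 14;b 15;b 16;p 19;k 2;p 19;b 15;b 16;p 19;k 2;p 19;p 19;p 17;p 18;s;b 14;b 15;b 16;p 19;k 2;p 19;b 15;b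
16;p 19;k 2;p 19;p 19;p 18;b 14;b 15;b 16;p 19;p 19;b 15;b 16;p 19;p 19;p 19;m 0;p 15;s;p 17;p 18;b 14;b 15;b 16;p
19;k 2;p 19;k 2;b 15;b 16;p 19;k 2;p 19;k 2;p 19;p 18;m 1;m 0;p 17;s;p 18;m 3;m 0]; [:: p 14;s;p 15;p 16;s;b 14;s;b
15;b 16;p 17;p 17;b 17;b 17;p 18;k 3;k 3;b 20;p 20;p 17;p 17;b 16;b 17;b 17;p 18;k 3;k 3;b 20;p 20;p 18;p 18;m 0;p
17;k 2;p 17;k 2;b 15;b 16;b 17;p 18;p 18;p 18;p 18;b 16;b 17;p 18;p 18;p 18;p 18;p 18;p 18;s;p 16;m 0;s;b 13;b 14;b
15;p 17;p 17;b 16;p 18;k 2;p 17;k 2;p 17;k 2;b 15;b 16;p 18;k 2;p 18;k 1;b 14;b 15;b 16;b 18;p 18;p 18;b 18;p 19;p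
18;k 2;p 18;k 2;s;b 17;p 17;p 19;p 17;b 16;s;b 17;b 17;b 18;b 18;p 18;k 2;p 18;k 2;p 18;p 18;b 16;s;b 17;b 17;b 18;b
18;p 19;k 3;k 3;p 17;k 2;p 19;k 2;b 15;b 16;b 18;p 18;p 18;b 18;p 19;p 18;k 2;p 18;k 2;s;b 17;p 17;p 19;p 17;b 16;m
2;p 18;k 2;p 18;k 2;p 18;p 18;b 16;m 1;p 17;k 2;p 19;k 2;p 17;k 2;b 15;b 16;b 17;b 17;b 18;b 18;p 18;k 2;p 18;k 2;b
16;b 17;b 17;b 18;b 18;p 18;k 2;p 18;k 2;p 18;p 18;p 18;k 2;p 18;k 2;b 15;b 16;m 0;p 17;k 2;p 19;k 2;b 16;m 3;p 17;k
2;p 19;k 2;p 17;p 19;m 0;p 15;m 1;m 1;p 16;m 2;m 2;b 6;k 0;b 13;b 14;b 15;b 16;p 17;k 2;p 17;k 2;s;b 14;b 15;b 16;b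
19;p 19;p 19;p 18;k 2;p 18;k 2;p 17;k 2;b 15;b 16;p 18;k 2;p 18;k 2;p 18;k 2;p 18;k 2;b 13;m 0;k 1;b 14;s;b 15;b
16;s;b 17;p 18;p 18;p 18;k 2;p 18;k 2;s;b 16;m 0;p 18;k 2;p 18;k 2;p 18;k 2;p 18;k 2;m 0;b 15;m 1;m 1;p 18;k 2;p 18;k
2;p 18;k 2;p 18;k 2;b 14;s;b 15;b 16;s;p 17;k 2;s;b 17;p 18;k 3;p 19;k 3;m 0;p 19;k 2;p 19;k 2;p 17;k 2;s;b 16;m 1;p
18;k 2;p 19;k 2;p 18;k 2;s;b 16;m 2;p 17;k 2;p 19;k 2;p 19;k 2;p 19;k 2;m 0;s;p 17;k 2;b 15;m 2;m 1;p 18;k 2;p 19;k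
2;m 0;p 19;k 2;p 19;k 2]; [:: p 6;k 0;p 13;l;s;b 6;p 14;p 14;b 14;p 15;p 15;b 15;b 15;p 16;k 2;k 2;b 18;p 18;p 18;b
18;p 19;b 15;b 15;p 14;p 15;p 15;p 16;p 16;b 14;b 16;k 2;b 16;k 2;b 17;k 2;b 17;k 2;b 16;b 16;p 15;p 15;s;p 16;p
16;s;b 14;k 2;k 2;p 19;k 2;k 2;b 20;b 20;p 15;m 0;p 16;p 16;m 1;p 16;m 1;b 14;s;b 14;s;p 19;m 0;b 14;m 1;m 1;p 17;k
2;k 2;k 2;k 2;b 6;m 0;p 13;k 1;b 13;p 14;l;b 14;p 15;p 15;b 15;p 16;p 16;b 16;b 16;p 17;k 2;k 2;b 19;p 19;p 19;b 16;b
16;p 15;p 16;p 16;p 17;p 17;b 15;b 17;k 2;p 19;k 2;k 2;b 17;b 17;p 16;p 16;s;p 17;p 17;s;b 15;k 2;k 2;p 20;k 2;k 2;p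
16;m 0;p 17;p 17;m 1;p 17;m 1;p 14;p 14;s;p 15;p 15;s;b 15;p 16;p 16;s;b 16;b 16;p 17;k 2;k 2;b 19;p 19;p 19;b 16;b
16;p 15;p 16;p 16;p 17;p 17;s;b 15;s;b 17;k 2;p 19;k 2;k 2;b 17;b 17;p 16;p 16;s;p 17;p 17;s;b 15;k 2;k 2;p 20;k 2;k
2;p 16;m 0;p 17;p 17;m 1;p 17;m 1;p 14;m 0;b 14;b 15;m 5;p 16;p 16;b 15;m 6;p 17;p 17;b 16;m 3;b 16;m 4;p 15;m 2;m 2;m
2;m 2;p 15;s;p 15;b 15;p 16;b 16;b 16;p 17;k 2;k 2;b 19;p 19;p 19;p 17;p 17;b 16;b 16;s;b 17;k 2;k 2;p 19;k 2;k 2;b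
20;p 20;b 16;m 0;p 16;p 16;k 2;k 2;s;b 20;p 20;s;p 16;k 2;s;b 20;b 20;m 0;p 16;m 2;m 1;m 1;m 0;b 17;b 17;s;p 15;s;b
15;p 18;p 18;m 4;m 0;b 18;b 18;s;p 16;s;p 17;k 2;p 17;k 2;b 16;p 20;m 0;p 17;s;p 17;s;b 16;b 16;m 0;p 17;m 1;m 1;b
17;m 0;p 15;s;p 17;k 2;p 17;k 2;p 18;k 2;p 18;k 2;m 0;b 18;b 18;m 2;b 18;m 2;p 16;s;p 16;s;p 17;p 17;p 19;k 2;b 15;k
2;b 15;k 2;b 20;k 2;k 2;m 0;p 16;m 1;m 1;p 17;s;b 16;k 2;m 0;s;b 20;k 2;m 0;b 13;b 14;b 14;p 15;p 15;s;b 15;p 16;p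
16;s;b 16;b 16;p 17;k 2;k 2;b 19;p 19;p 19;b 16;b 16;p 15;p 16;p 16;p 17;p 17;b 15;b 17;k 2;p 19;k 2;k 2;b 17;b 17;p
16;p 16;s;p 17;p 17;s;b 15;k 2;k 2;p 20;k 2;k 2;p 16;m 0;p 17;p 17;m 1;p 17;m 1;p 15;p 15;s;b 14;m 2;p 16;p 16;s;b
15;m 3;b 16;b 16;s;p 17;k 2;k 2;b 19;k 2;p 19;p 19;b 16;m 0;p 14;s;p 17;k 2;k 2;p 17;k 2;k 2;s;b 17;k 2;k 2;p 20;m 0;p
17;k 2;k 2;p 17;k 2;k 2;m 1;p 17;k 2;k 2;m 1;p 15;m 0;b 14;b 15;b 15;p 16;s;p 16;b 16;p 18;p 18;b 18;b 18;s;p 17;k 2;k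
2;k 2;m 0;b 18;b 18;p 16;s;b 16;p 20;p 20;m 1;m 0;b 19;b 19;p 16;p 16;m 4;p 16;m 4;b 15;b 15;s;b 16;b 16;s;b 17;b
17;s;p 17;k 2;k 2;p 18;k 2;k 2;b 16;m 0;b 17;b 17;m 1;b 17;m 1;b 15;m 0;b 16;b 16;s;p 18;k 2;p 18;k 2;m 0;p 19;k 2;k
2;p 19;k 2;k 2;s;p 18;k 2;p 18;k 2;m 0;p 19;k 2;k 2;p 19;k 2;k 2;p 14;p 14;s;b 14;p 15;b 15;s;p 16;k 2;b 17;p 17;p
17;b 17;p 18;p 18;p 16;p 16;b 15;b 16;k 2;p 17;p 17;b 18;b 18;b 19;b 19;p 15;s;p 15;b 18;b 18;s;p 18;k 2;p 18;k 2;p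
19;k 2;m 0;b 18;p 15;b 18;s;p 18;p 18;b 18;p 15;m 0;p 15;m 2;m 2;b 19;b 19;s;p 20;p 20;b 19;m 0;b 14;b 16;b 16;p 15;p
16;k 2;b 17;p 18;p 18;b 17;p 19;p 19;p 16;b 15;p 18;p 18;s;p 16;k 2;b 20;b 20;b 17;k 2;k 2;b 18;b 18;p 18;p 18;s;p
19;p 19;p 18;m 0;p 19;p 19;p 16;p 16;s;b 15;b 17;b 17;p 15;k 2;p 17;k 2;k 2;b 19;p 19;p 19;p 17;k 2;p 17;k 2;b 16;b
16;b 18;b 18;b 19;p 18;k 2;p 18;k 2;p 16;m 0;b 15;b 15;s;b 16;p 17;p 17;b 16;b 17;k 2;p 19;s;p 19;m 0;p 15;b 16;b 19;k
2;b 19;k 2;p 17;k 2;k 2;p 18;k 2;k 2;p 18;k 2;k 2;p 18;k 2;k 2;b 16;b 17;p 19;p 15;k 2;k 2;p 19;k 2;k 2;b 15;m 0;p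
15;p 15;k 2;k 2;b 16;s;p 18;k 2;p 18;k 2;m 0;p 19;k 2;k 2;p 19;k 2;k 2;s;p 15;k 2;b 16;s;b 16;p 18;p 18;s;p 17;k 2;p
18;m 0;m 0;p 19;k 2;k 2;p 19;k 2;k 2;m 0;b 19;s;b 19;s;p 15;p 17;p 19;s;p 17;k 2;p 19;k 2;m 0;b 20;k 2;b 20;k 2;m 0;b
19;m 1;m 1;p 15;p 19;p 19;s;p 19;k 2;p 19;k 2;m 0;b 20;s;b 20;m 0;p 14;m 14;b 14;b 14;s;p 15;m 19;b 16;s;p 17;p 17;b
15;k 2;p 16;k 2;k 2;b 19;p 19;p 19;b 17;b 17;p 16;p 16;s;b 16;b 16;p 17;k 2;p 17;k 2;p 18;k 2;p 16;s;b 15;p 19;k 2;p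
19;k 2;b 16;k 2;k 2;s;p 20;k 2;k 2;p 16;m 2;m 0;b 15;s;b 16;k 2;b 16;k 2;p 17;k 2;k 2;m 1;m 0;p 19;s;p 19;s;b 20;b
20;m 0;p 19;m 1;m 1;b 14;m 0;p 15;p 15;s;p 16;p 17;p 17;b 16;p 16;k 2;b 20;b 20;s;b 17;k 2;p 17;p 17;b 17;m 22;b 18;b
18;p 16;p 17;p 17;b 16;m 0;p 17;p 17;b 16;b 16;b 19;b 19;p 15;s;b 15;s;p 16;k 2;b 17;p 18;p 18;b 17;p 19;m 0;p 18;k
2;p 18;k 2;b 16;s;p 17;k 2;p 17;k 2;m 0;p 19;k 2;k 2;p 19;k 2;k 2;p 15;m 3;m 0;b 15;s;b 16;k 2;b 16;k 2;p 16;s;p 17;k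
2;b 19;b 19;m 0;p 17;s;p 17;b 17;b 20;m 0;b 20;b 20;m 0;p 18;s;p 18;s;b 16;s;b 16;p 17;p 17;s;p 16;k 2;p 17;m 0;m 0;p
19;k 2;k 2;p 19;k 2;k 2;m 0;p 18;m 1;m 1;b 16;s;b 16;s;p 17;s;p 17;m 0;m 0;b 16;m 1;m 1;p 16;s;p 16;s;b 17;m 0;m 0;s;p
16;m 1;m 1;m 0;b 16;b 16;s;p 14;b 14;p 15;p 16;p 16;b 15;k 2;p 17;k 2;k 2;b 19;p 19;p 19;p 16;p 16;s;b 15;k 2;p 18;k
2;b 19;b 19;p 18;k 2;b 20;p 16;m 0;b 15;b 15;s;p 18;p 18;b 15;m 0;p 17;k 2;k 2;k 2;p 17;k 2;k 2;k 2;b 15;p 15;m 27;p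
16;p 16;s;b 14;k 2;p 18;k 2;b 19;b 19;p 18;k 2;b 20;p 16;m 0;b 14;b 14;s;p 18;p 18;b 14;m 0;p 17;k 2;k 2;k 2;p 17;k
2;k 2;k 2;b 17;b 17;s;p 15;p 16;p 16;s;b 14;k 2;k 2;p 17;k 2;k 2;b 19;b 19;p 16;m 0;b 14;k 2;k 2;p 17;b 15;p 20;p 20;k
2;k 2;b 20;b 20;p 16;p 16;s;b 14;k 2;k 2;p 19;k 2;b 19;b 19;p 16;m 0;b 14;s;b 14;s;p 19;p 19;m 0;b 14;m 1;m 1;p 17;k
2;k 2;k 2;b 20;s;p 19;m 0;p 16;p 16;s;b 14;k 2;k 2;p 19;k 2;b 19;b 19;s;b 14;k 2;k 2;p 19;b 15;p 19;k 2;b 20;k 2;b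
20;b 20;p 16;m 1;s;b 14;s;b 14;s;p 19;p 19;m 0;b 14;m 1;m 1;p 17;k 2;k 2;k 2;b 20;s;p 19;m 0;p 16;m 4;m 0;b 14;s;b
14;s;p 19;p 19;m 0;b 14;m 1;m 1;p 17;b 15;s;p 19;m 0;k 2;k 2;k 2;b 16;m 0;p 14;p 16;p 16;s;p 17;p 17;s;b 14;b 15;k 2;b
17;k 2;b 17;k 2;p 15;k 2;k 2;b 20;b 15;b 17;k 2;b 17;k 2;p 15;k 2;k 2;p 18;k 2;k 2;k 2;p 19;k 2;k 2;p 19;k 2;k 2;p
16;m 0;p 17;p 17;m 1;p 17;m 1;b 14;b 15;b 15;s;p 18;b 15;m 0;p 15;k 2;k 2;k 2;k 2;b 15;b 15;s;p 15;s;p 15;s;p 19;k 2;m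
0;m 0;m 0;b 15;m 2;s;p 19;b 15;m 1;m 0;p 15;s;p 15;k 2;k 2;m 0;m 0;m 0;p 16;p 16;s;p 17;p 17;s;b 14;b 17;b 17;p 15;k
2;k 2;k 2;b 15;k 2;k 2;p 20;k 2;k 2;b 17;b 17;s;p 15;k 2;k 2;k 2;b 20;k 2;p 20;b 17;m 0;p 15;p 15;k 2;k 2;s;b 20;s;p
15;k 2;s;b 20;m 0;p 15;m 2;m 1;m 1;p 16;m 0;p 17;p 17;m 1;p 17;m 1;b 14;b 14;s;b 15;p 18;p 15;p 15;s;p 18;k 2;m 0;m
0;m 0;b 14;m 0;b 15;p 15;k 2;k 2;k 2;k 2;s;p 19;m 0;p 15;s;p 15;k 2;k 2;m 0;m 0;m 0;b 17;b 17;m 19;b 17;m 19;p 15;p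
15;s;p 16;p 16;s;p 17;k 2;p 17;k 2;s;b 15;p 20;k 2;p 16;s;p 17;k 2;p 17;k 2;s;b 14;p 20;k 2;p 16;m 2;m 0;p 17;p 17;m
3;p 17;m 1;p 17;m 3;m 1;s;p 16;p 16;s;p 17;k 2;p 17;k 2;b 18;b 18;b 18;k 2;b 18;k 2;p 16;m 0;s;p 17;k 2;p 17;k 2;b
14;p 20;k 2;p 17;p 17;s;b 18;b 18;p 17;s;b 14;s;p 20;k 2;p 17;m 2;m 0;p 16;m 3;b 14;k 2;p 17;p 17;m 1;p 17;m 1;b 19;k
2;k 2;b 19;k 2;k 2;p 15;m 6;s;p 16;p 16;s;p 17;k 2;p 17;k 2;b 18;b 18;s;p 17;k 2;p 17;k 2;b 15;p 20;k 2;p 17;p 17;s;b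
18;b 18;p 17;s;b 15;s;p 20;k 2;p 17;m 2;m 0;p 16;m 4;b 18;k 2;b 18;k 2;p 16;m 3;b 15;k 2;p 17;p 17;m 1;p 17;m 1;b 19;k
2;k 2;b 19;k 2;k 2;p 15;m 6;m 0;p 16;b 14;k 2;k 2;p 16;b 15;k 2;k 2;s;b 18;k 2;k 2;m 0;b 20;k 2;k 2;b 15;k 2;k 2;p
16;b 14;k 2;k 2;s;b 18;k 2;k 2;m 0;b 20;k 2;k 2;s;b 19;k 2;b 19;k 2;m 0;b 20;k 2;k 2;b 20;k 2;k 2]].
Definition script_X : seq (seq step) := [::
[:: p 11;p 12;s;p 13;k 0;p 12;m 0;p 13;k 0;k 0]; [:: b 11;b 12;s;b 13;k 1;b 12;m 0;b 13;k 1;k 1]; [:: c 7 8 10 9;c 7 9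
8 10;k 0;k 1;k 1;s;c 7 9 8 10;m 0;m 0;m 0;m 0;m 0;m 0;m 0;k 0;m 0;m 0;m 0;m 0;m 0;m 0;m 0;m 0;k 0]; [:: c 7 11 9 12;k
0;c 8 11 10 12;k 0;k 1;s;c 8 11 10 12;m 0;m 0;m 0;m 0;m 0;m 0;m 0;k 0;m 0;m 0;m 0;m 0;m 0;m 0;m 0;m 0;k 0]; [:: p 10;b
7;b 8;b 12;s;c 8 9 10 11;k 1;m 0;p 13;p 13;b 12;s;c 8 9 10 11;m 0;p 14;p 14;b 13;s;c 7 10 13 11;m 0;b 13;s;c 7 10 13
11;m 0;b 14;s;p 11;b 10;k 3;s;c 7 11 13 15;m 0;b 14;c 9 10 13 12;s;c 7 10 13 11;s;c 7 10 13 11;s;c 7 10 14 11;m 0;b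
10;c 7 10 13 11;s;c 7 10 13 11;m 0;b 14;c 7 10 13 11;s;c 7 10 13 11;s;c 7 10 13 11;m 0;b 14;s;p 11;b 10;k 3;s;c 7 11
13 15;m 0;m 7;m 6;s;c 7 10 14 11;m 0;b 10;c 7 10 13 11;s;c 7 10 13 11;m 0;m 5;m 4;m 0;p 11;p 11;s;b 10;k 3;s;b 15;c 9
10 14 12;c 7 9 11 15;c 7 11 16 15;s;c 10 11 17 13;m 0;c 7 10 14 11;m 0;m 0;m 0;b 15;c 9 10 14 12;s;c 10 11 15 13;m 0;m
0;m 0;c 7 10 14 11;c 7 10 14 11;m 0;s;p 12;k 3;s;p 12;k 3;s;c 9 10 14 12;s;c 9 10 14 12;m 0;p 12;k 2;m 2;m 2;s;b
17;s;c 10 11 15 13;m 0;m 0;m 0;p 19;c 7 9 12 19;s;p 19;c 7 9 12 19;s;c 10 11 19 14;m 0;p 19;c 7 9 12 19;m 1;m 1;b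
10;s;p 15;s;b 15;s;c 10 13 17 15;m 0;b 16;c 10 14 16 15;s;c 13 15 14 17;m 0;m 0;c 7 8 12 15;s;c 7 11 19 15;m 0;m 0;m
0;m 0;p 20;s;p 20;c 7 8 12 20;s;c 7 11 19 20;m 0;m 0;c 9 10 20 12;s;c 7 11 19 20;m 0;p 12;k 3;m 13;m 13;m 0;s;b 17;s;p
15;b 17;s;c 10 11 17 13;m 0;c 10 11 15 13;s;c 10 11 15 13;m 0;s;c 10 11 15 13;m 0;c 10 11 15 13;m 0;m 0;m 0;p 19;p
19;s;b 17;s;c 10 11 15 13;m 0;m 0;m 0;b 15;s;c 10 13 15 19;m 0;m 0;m 0;m 0;s;c 7 8 12 19;m 0;s;b 17;s;c 10 11 15 13;m
0;m 0;m 0;c 7 9 11 19;s;p 19;m 3;s;c 8 11 19 12;m 0;s;c 10 11 19 14;m 0;s;c 8 11 19 12;m 0;p 19;m 4;m 2;m 2;s;c 8 11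
19 12;m 0;s;p 11;m 32;s;c 7 10 14 11;m 0;p 11;m 2;m 1;m 1;p 12;p 12;s;b 9;s;b 15;c 7 9 15 12;c 9 12 16 15;s;c 10 12 17
13;m 0;c 9 10 14 12;m 0;m 0;m 0;b 15;s;p 15;s;c 7 11 15 12;m 0;c 10 12 15 13;m 0;m 0;m 0;c 9 10 14 12;c 9 10 14 12;m
0;m 24;m 24;m 8;s;p 12;m 0;s;c 9 10 14 12;m 0;s;b 9;s;c 9 10 14 12;m 0;m 0;m 0;b 15;s;c 9 10 14 12;m 0;m 0;m 0;c 9 10
14 12;c 9 10 14 12;m 0;s;p 12;m 29;m 4;m 4;s;b 9;s;b 10;c 7 9 15 16;s;p 15;s;p 17;k 2;c 10 15 13 17;c 7 9 12 17;s;c 10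
15 13 17;c 7 8 12 17;s;c 10 15 13 17;m 0;c 7 10 15 11;c 7 9 15 11;p 17;m 2;m 2;c 7 9 12 17;c 10 15 13 17;c 7 8 12
17;s;c 10 15 13 17;p 17;m 2;m 2;c 7 9 12 17;m 0;c 7 8 12 17;c 10 15 13 17;m 0;p 16;s;p 16;s;p 15;c 9 12 16 15;c 9 12
16 15;c 10 14 16 15;c 9 12 16 15;s;p 15;b 15;s;c 13 15 14 17;k 2;m 0;c 10 15 16 19;c 10 14 16 15;c 7 10 15 11;c 10 14
16 15;c 10 14 16 15;s;c 9 12 16 15;s;p 15;b 15;s;c 10 14 16 15;m 0;c 10 15 16 19;c 10 14 16 15;c 7 10 15 11;c 7 9 15
11;c 10 14 16 15;m 0;p 16;m 6;m 6;s;p 15;s;c 9 12 16 15;m 0;c 9 12 16 15;c 9 12 16 15;p 16;m 6;m 6;s;c 9 12 16 15;s;b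
17;c 7 10 15 11;s;c 11 16 13 17;m 0;c 9 10 19 12;p 15;s;p 19;c 7 9 15 19;c 10 15 14 19;c 10 13 16 19;c 9 10 19 12;c 10
13 16 19;m 0;c 11 12 15 16;p 16;m 9;m 9;m 3;s;c 9 12 16 15;p 16;m 8;m 8;m 5;m 1;m 0;m 0;m 0;m 0;p 19;s;b 15;s;p 15;c 7
9 19 15;c 10 13 15 19;c 10 13 15 19;c 9 12 15 19;c 10 13 15 19;m 0;m 0;m 0;p 19;c 7 9 19 11;c 7 9 19 11;b 19;s;c 13 14
19 15;m 0;m 0;m 0;b 20;s;c 13 14 19 15;m 0;m 0;m 0;m 0;c 7 9 19 11;c 7 9 19 11;b 19;s;p 15;c 7 8 12 15;s;c 10 13 15
19;m 0;c 10 13 15 19;c 10 13 15 19;m 0;m 0;m 0;p 20;c 7 8 12 20;s;p 20;c 7 8 12 20;s;b 18;s;c 13 14 20 15;m 0;m 0;m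
0;s;p 19;b 15;s;c 10 14 20 19;m 0;m 0;m 0;c 7 9 19 11;m 0;p 20;c 7 8 12 20;m 3;m 3;s;b 18;s;c 8 11 20 12;m 0;m 0;m 0;p
20;c 7 8 12 20;m 3;m 3;m 0;b 20;s;p 15;p 19;s;c 13 14 19 15;m 0;c 7 10 19 11;c 7 10 19 11;b 20;s;c 10 13 17 19;m 0;s;c
7 9 19 15;s;c 10 13 15 19;m 0;c 10 13 15 19;c 10 13 15 19;c 10 13 15 19;m 0;m 0;m 0;b 20;s;p 15;p 19;s;c 13 14 19 15;m
0;c 7 11 19 15;c 7 11 19 15;m 3;s;c 10 13 15 19;m 0;c 10 13 15 19;c 10 13 15 19;c 10 13 15 19;m 0;m 0;m 0;m 0;p 12;m
56;m 44;m 44;m 1;m 1;b 9;s;b 10;c 7 9 15 16;s;p 15;s;p 17;k 2;c 10 15 13 17;s;c 10 15 13 17;m 0;s;c 7 8 12 17;m 0;m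
0;s;c 7 9 15 11;m 0;s;p 17;m 3;m 3;s;c 10 15 13 17;m 0;c 7 8 12 17;c 7 8 12 17;m 0;m 0;p 16;s;p 16;s;p 15;b 15;s;c 10
14 16 15;m 0;c 10 15 16 19;c 10 14 16 15;c 7 9 15 11;s;c 10 14 16 15;m 0;m 0;s;p 15;c 9 12 16 15;s;c 7 9 15 11;m 0;c
10 14 16 15;m 0;m 0;s;p 16;m 3;m 3;s;c 8 11 16 12;m 0;m 0;s;p 16;m 3;m 3;m 1;m 1;m 0;m 0;m 0;m 0;p 19;s;b 15;s;p 15;c
7 9 19 15;s;c 10 13 15 19;m 0;s;c 10 13 15 19;m 0;m 0;m 0;m 0;p 19;s;c 7 9 19 11;m 0;s;b 19;s;c 13 14 19 15;m 0;m 0;m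
0;m 0;m 0;s;c 7 9 19 11;m 0;s;b 19;s;p 15;c 7 8 12 15;s;c 10 13 15 19;m 0;s;c 8 11 15 12;m 0;m 0;m 0;m 0;p 20;c 7 8 12
20;s;p 20;c 7 8 12 20;s;c 8 11 20 12;m 0;m 0;s;c 8 11 20 12;m 0;m 0]; [:: p 7;p 8;b 9;p 12;s;c 7 8 9 12;k 1;m 0;p
12;s;c 7 8 9 12;m 0;b 13;p 13;s;c 7 10 12 13;m 0;p 13;s;c 7 10 12 13;m 0;b 13;p 14;s;c 7 10 12 14;m 0;p 14;s;c 7 10 12
14;m 0;b 14;b 14;b 11;b 11;s;p 10;k 2;s;c 7 10 12 15;m 0;m 0;m 0;p 15;c 8 9 12 15;s;c 9 12 13 15;m 0;m 0;m 0;s;c 7 10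
12 15;c 7 10 12 15;m 0;s;p 17;p 17;s;c 9 12 13 17;m 0;m 0;m 0;s;b 12;k 2;s;c 9 12 15 17;m 0;s;b 19;c 8 11 10 17;s;c 9
12 15 17;m 0;b 19;c 8 11 10 17;s;c 9 12 15 17;m 0;p 10;s;b 15;s;p 15;s;c 10 12 14 15;m 0;p 16;c 10 12 16 13;s;c 13 14
16 15;m 0;m 0;c 7 8 18 10;s;c 7 10 19 17;m 0;m 0;m 0;m 0;b 20;s;p 15;s;c 10 12 13 15;m 0;m 0;m 0;m 0;c 7 8 18 10;s;c 7
10 19 17;m 0;s;c 9 12 13 17;m 0;m 0;m 0;p 17;m 1;s;c 9 12 13 17;m 0;m 0;m 0;b 12;k 2;s;c 8 9 12 15;m 0;b 12;k 2;s;c 8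
9 12 15;m 0;s;b 19;b 19;s;c 9 12 15 17;m 0;s;c 7 8 18 17;m 0;s;c 9 11 10 17;s;c 9 12 15 17;m 0;s;c 7 8 18 17;m 0;b
19;m 2;s;c 9 12 15 17;m 0;s;c 7 8 18 17;m 0;s;p 10;c 7 10 12 15;s;c 7 10 12 15;m 0;m 0;m 0;p 15;c 8 9 12 15;s;c 7 10
12 15;m 0;m 0;m 0;b 11;m 30;c 7 10 12 15;c 7 10 12 15;m 0;b 11;m 3;s;p 10;c 7 10 12 15;s;c 7 10 12 15;m 0;m 0;m 0;c 7
10 12 15;m 0;b 12;b 12;s;p 9;s;p 15;s;c 9 11 10 15;c 8 9 13 15;s;c 10 12 14 15;m 0;s;c 8 9 12 15;m 0;m 0;m 0;p 15;s;b
15;s;c 7 8 15 17;m 0;c 10 12 13 15;m 0;m 0;m 0;s;c 8 9 12 15;s;c 8 9 12 15;m 0;s;p 17;s;c 10 12 13 17;m 0;m 0;m 0;m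
29;m 0;s;p 19;s;c 10 12 13 19;m 0;m 0;m 0;p 19;s;c 10 12 13 19;m 0;m 0;m 0;m 19;s;p 9;s;p 15;b 12;m 13;s;c 8 9 12 15;m
0;c 8 9 12 15;c 8 9 12 15;s;c 8 9 12 15;m 0;b 12;m 13;s;c 8 9 12 15;m 0;c 8 9 12 15;m 0;m 0;m 0;p 15;s;b 12;m 12;s;c 8
9 12 15;m 0;s;c 8 9 12 15;m 0;m 0;m 0;b 12;m 14;s;c 8 9 12 15;m 0;s;c 8 9 12 15;b 12;m 15;s;c 8 9 12 15;m 0;s;c 8 9 12
15;m 0;s;b 12;m 15;s;c 8 9 12 15;m 0;s;p 9;s;p 10;c 9 11 10 13;s;b 17;s;c 9 10 14 13;k 3;m 0;c 8 9 10 17;c 9 10 14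
13;c 7 8 19 10;c 9 10 14 13;m 0;b 16;s;p 15;s;b 16;c 8 9 13 17;c 9 12 15 13;c 8 9 13 19;s;c 9 12 15 13;m 0;c 10 12 13
15;b 16;c 8 9 13 17;c 9 12 15 13;c 8 9 13 19;s;c 9 12 15 13;m 0;b 15;s;c 8 9 13 17;m 0;c 8 9 13 17;b 16;s;c 9 12 15
13;m 0;s;c 8 9 13 17;c 8 9 13 17;p 17;c 7 10 9 17;s;p 18;b 17;s;c 13 14 17 18;m 0;c 13 14 17 18;c 10 12 13 18;c 13 14
17 18;m 0;c 8 9 10 17;b 16;s;c 9 12 15 13;m 0;c 8 9 13 19;s;p 18;s;p 19;c 13 18 17 19;c 7 8 19 18;c 14 18 17 19;c 7 8
19 10;m 0;c 10 12 13 18;p 19;s;c 8 9 13 19;m 0;c 7 8 19 10;c 8 9 13 19;b 16;s;p 15;m 12;m 12;c 10 12 13 15;m 10;m 0;b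
15;s;c 8 9 13 17;m 0;c 8 9 13 17;m 8;p 17;c 7 10 9 17;s;c 13 14 17 18;m 0;c 8 9 10 17;m 4;c 8 9 13 19;m 0;m 0;m 0;b
19;s;p 15;s;b 15;c 9 11 10 15;c 9 12 13 15;c 9 12 13 15;c 8 9 15 19;c 9 12 13 15;m 0;m 0;m 0;b 19;c 7 11 9 17;c 7 8 9
18;p 19;s;c 12 13 19 15;m 0;m 0;m 0;p 20;s;c 12 13 20 15;m 0;m 0;m 0;m 0;c 7 11 9 17;c 7 8 9 18;p 19;s;b 15;c 7 8 19
10;s;c 9 12 13 19;m 0;c 9 12 13 19;c 9 12 13 19;m 0;m 0;m 0;b 20;c 7 8 19 10;s;p 15;s;b 20;c 7 8 19 10;c 7 8 19 18;s;c
9 12 15 19;m 0;m 0;m 0;m 0;p 18;s;b 20;c 7 8 19 10;s;c 12 13 18 15;m 0;s;c 7 8 19 18;m 0;m 0;m 0;b 20;c 7 8 19 10;s;p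
15;m 5;m 5;m 5;m 5;m 0;p 18;m 2;m 2;m 2;m 2;p 20;s;p 20;s;c 9 12 13 20;m 0;s;b 15;b 19;s;c 12 13 20 15;m 0;c 7 10 9
17;c 7 8 9 18;c 9 12 13 20;s;c 9 12 13 20;m 0;c 9 12 13 20;c 9 12 13 20;c 9 12 13 20;m 0;m 0;m 0;p 20;m 1;m 1;m 1;m
1;m 0;b 12;m 52;s;p 9;s;c 8 9 12 15;m 0;m 0;m 0;p 15;m 47;m 47;m 47;m 47;m 44;m 42;m 0;m 3;m 3;p 9;s;p 10;c 9 11 10
13;s;b 17;s;c 9 10 14 13;k 3;m 0;s;c 9 10 14 13;m 0;s;c 7 8 19 10;m 0;m 0;b 16;s;p 15;s;b 16;s;c 9 12 15 13;m 0;s;c 8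
9 13 19;m 0;m 0;c 10 12 13 15;b 16;s;b 15;c 9 12 15 13;c 7 8 9 18;s;c 9 12 15 13;m 0;m 0;s;c 8 9 13 19;m 0;m 0;s;b
16;s;p 15;m 6;m 6;c 10 12 13 15;m 2;m 0;s;c 7 8 19 17;m 0;m 0;s;p 19;s;b 15;s;c 8 9 13 19;m 0;s;c 8 9 13 19;m 0;b
16;s;c 9 12 15 13;m 0;s;c 7 8 19 17;m 0;m 0;c 7 8 19 10;b 15;s;c 8 9 13 19;m 0;s;c 8 9 13 19;m 0;b 16;s;c 9 12 15 13;m
0;s;c 7 8 19 17;m 0;m 0;m 0;m 0;m 0;b 19;s;p 15;s;b 15;c 9 11 10 15;s;c 9 12 13 15;m 0;s;c 9 12 13 15;m 0;m 0;m 0;m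
0;b 19;s;c 7 8 9 17;m 0;s;p 19;s;c 12 13 19 15;m 0;m 0;m 0;m 0;m 0;s;c 7 8 9 17;m 0;s;p 19;s;b 15;c 7 8 19 10;s;c 9 12
13 19;m 0;s;c 7 8 19 17;m 0;m 0;m 0;m 0;b 20;c 7 8 19 10;s;p 15;s;b 20;c 7 8 19 10;s;c 7 8 19 17;m 0;m 0;m 0;m 0;m
0;s;c 7 8 19 17;m 0;m 0]; [:: c 7 8 9 10;k 1;k 2;k 4;k 4;k 4;k 4;k 4;k 4;k 4;k 4;k 1;k 4;k 4;k 4;k 4;k 4;k 4;k 4;k 4;k
1;k 4;k 4;k 4;k 4;k 4;k 4;k 4;k 4;k 1;k 4;k 4;k 4;k 4;k 4;k 4;k 4;k 4;k 1;k 5;k 5;k 5;k 5;k 5;k 5;k 5;k 5;k 1;k 5;k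
5;k 5;k 5;k 5;k 5;k 5;k 5;k 1;k 5;k 5;k 5;k 5;k 5;k 5;k 5;k 5;k 1;k 5;k 5;k 5;k 5;k 5;k 5;k 5;k 5;k 1]; [:: p 8;p
9;s;p 10;s;b 7;b 8;p 11;p 11;b 9;p 12;p 12;b 11;b 11;b 12;b 12;p 13;s;p 13;b 13;p 17;p 17;b 17;b 17;s;p 14;p 14;s;b
14;p 20;p 14;m 0;m 0;b 17;b 17;p 13;s;b 13;p 19;p 19;m 1;m 0;b 18;b 18;b 13;b 13;p 11;p 11;b 8;b 9;p 12;p 12;s;b 11;p
13;p 13;b 11;p 14;p 14;b 12;b 12;b 13;b 13;b 14;b 14;p 15;s;p 15;m 0;p 12;p 12;b 9;m 0;p 13;p 13;b 11;b 11;s;b 12;b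
12;s;b 13;p 17;p 17;b 13;p 18;b 11;m 0;b 12;b 12;m 1;b 12;m 1;b 13;b 13;p 18;p 18;s;b 14;b 14;p 19;s;p 19;m 0;p 18;p
18;b 13;m 0;p 19;p 9;m 0;p 10;m 1;b 6;k 0;b 7;b 8;p 11;s;b 9;p 12;p 12;s;b 11;p 13;p 13;b 11;p 14;p 14;b 12;p 15;p
15;p 12;p 12;s;b 9;p 11;m 1;p 13;p 13;s;b 11;p 11;b 11;p 14;p 14;s;b 12;b 12;b 13;b 13;b 18;b 18;p 15;s;p 15;m 0;p
14;p 14;b 11;p 11;m 0;p 15;p 15;p 11;b 8;m 4;p 12;p 12;s;b 9;m 5;p 13;p 13;s;b 11;b 11;b 12;b 12;b 13;b 13;p 14;p
14;s;b 14;p 19;p 19;b 19;b 19;b 14;b 14;p 14;p 14;s;b 11;b 12;b 12;b 13;b 13;m 0;p 15;p 15;p 14;m 0;b 11;b 12;b 12;b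
13;b 13;b 14;p 19;p 15;p 15;p 12;p 12;b 8;m 4;p 11;m 0;p 13;p 13;b 9;m 5;p 11;m 1;p 14;p 14;b 11;b 11;s;b 12;b 12;b
13;b 13;b 14;b 14;p 19;p 19;p 19;p 19;b 12;b 12;s;b 13;b 13;s;b 14;p 15;s;b 14;p 19;p 19;p 19;b 12;m 0;b 13;b 13;m 1;b
13;m 1;p 15;s;p 15;s;p 16;s;p 16;m 0;m 0;p 15;m 1;m 1;b 11;m 6;b 12;b 12;m 3;b 12;m 3;b 13;b 13;m 4;b 13;m 4;p 11;s;p
15;p 15;s;p 16;s;p 16;m 0;p 15;m 0;m 0;p 15;s;p 15;m 0;p 15;s;p 15;s;b 11;b 12;b 12;b 13;b 13;m 9;p 16;s;p 16;m 0;p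
11;b 12;b 12;b 13;b 13;b 14;p 19;p 16;s;p 16;m 0;p 16;p 16;m 0;p 15;m 1;m 1]; [:: p 14;p 15;s;p 16;s;b 7;b 10;p 17;p
17;p 17;p 15;m 0;p 16;m 1]; [:: p 7;p 11;s;p 14;p 15;b 7;b 10;b 12;p 17;p 17;p 16;p 16;s;b 10;b 12;p 17;p 17;p 17;p
16;m 0;p 11;m 0;p 14;p 15;s;b 7;b 10;p 16;p 16;p 16;p 16;s;b 10;b 12;p 17;p 17;p 16;m 0;p 15;m 0;b 6;k 0;b 7;b 10;p
16;s;b 12;p 17;p 17;p 17;p 16;b 10;m 0;p 17;p 17;p 17;p 17]; [:: p 7;p 10;p 11;p 13;s;p 14;b 7;b 10;b 12;p 16;p 16;p
15;p 15;p 15;p 15;b 10;b 12;p 16;p 16;p 16;p 10;p 11;p 13;s;p 14;b 7;b 10;b 12;p 16;p 16;p 15;p 15;p 15;p 15;b 10;b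
12;p 16;p 16;p 16;p 11;p 13;m 0;p 13;m 1;p 14;b 7;b 10;p 15;p 15;b 12;p 16;p 15;p 15;b 10;b 12;p 16;p 16;b 6;k 0;b 7;b
10;b 12;p 16;p 16;p 16;p 16;s;b 12;p 15;p 17;p 16;m 0;p 15;b 10;b 12;p 16;p 16;p 16;p 16;p 16]; [:: p 7;p 8;s;p 10;p
11;s;p 12;p 13;s;b 7;b 10;p 14;p 14;b 12;p 15;p 15;p 14;p 14;b 10;b 12;p 15;p 15;p 15;p 15;p 8;m 0;p 10;p 11;p 12;p
13;m 2;p 11;m 1;p 12;p 13;m 2;p 13;m 2;b 6;k 0;b 7;b 10;p 14;s;b 12;p 15;p 15;p 15;p 15;s;b 12;p 14;p 16;p 14;b 10;m
1;p 15;p 15;p 15;p 15;b 10;m 0;p 14;p 16]; [:: p 7;p 10;s;p 12;s;b 7;b 8;p 13;p 13;s;b 10;p 14;p 14;b 11;p 15;p 15;p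
13;p 13;b 8;m 0;p 14;p 14;b 10;b 11;b 12;b 13;p 17;p 17;p 15;p 15;p 10;m 0;p 12;m 1;b 6;k 0;b 7;b 8;p 13;s;b 10;p 14;p
14;b 11;p 15;p 15;p 14;p 14;s;b 10;p 13;b 11;p 15;p 15;p 15;p 15;b 11;p 13;p 16;p 13;b 8;m 1;p 14;p 14;s;b 10;b 11;b
12;b 13;p 17;p 17;p 15;p 15;p 14;p 14;b 8;m 1;p 13;m 0;p 15;p 15;b 10;b 11;b 12;b 13;p 17;p 16;k 2;k 2;p 13;p 16]; [::
p 7;p 8;p 10;p 11;s;b 7;b 8;p 12;p 12;b 9;b 10;p 14;p 14;b 12;b 12;b 13;b 13;b 14;k 1;b 14;k 1;p 13;k 2;k 2;b 19;s;b
19;m 0;p 12;p 12;b 8;b 9;b 10;p 14;p 14;b 12;b 12;b 13;b 13;p 13;k 1;p 13;k 1;b 14;b 14;p 19;s;p 19;m 0;p 13;p 13;b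
9;b 10;p 14;p 14;b 12;b 12;b 13;b 13;b 14;b 14;p 19;s;p 19;m 0;b 10;b 12;b 12;b 13;b 13;b 14;k 1;p 19;p 19;p 17;s;p
17;m 0;p 15;p 15;b 12;b 12;s;b 13;b 13;b 14;k 1;p 19;s;p 19;m 0;b 12;m 0;b 13;b 13;s;b 14;k 1;p 19;s;p 19;m 0;b 13;m
0;p 14;k 1;k 2;k 2;p 8;p 10;p 11;s;b 7;b 8;b 9;b 10;p 14;p 14;b 13;b 13;p 12;k 1;p 12;k 1;b 12;b 12;p 17;k 3;p 17;k
3;p 18;k 3;p 12;p 12;b 8;b 9;b 10;p 14;p 14;b 12;b 12;b 13;b 13;p 13;k 1;p 13;k 1;p 15;k 3;s;p 15;m 0;p 13;k 1;p 13;k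
1;b 9;b 10;p 14;p 14;b 12;b 12;b 13;b 13;b 17;b 17;b 18;b 10;b 12;b 12;b 13;b 13;b 17;k 2;p 19;p 19;b 17;k 2;p 20;p
15;p 15;b 12;b 12;s;b 13;b 13;b 17;k 2;p 19;s;p 19;m 0;b 12;m 0;b 13;b 13;s;b 17;k 2;p 19;s;p 19;m 0;b 13;m 0;p 14;k
1;k 2;k 2;p 10;p 11;m 0;p 11;m 6;b 6;k 0;b 7;b 8;b 9;b 10;p 14;p 14;b 13;b 13;b 14;b 14;p 12;k 1;b 12;b 12;p 19;k 3;p
19;k 3;p 20;k 3;p 13;k 1;p 13;k 1;b 9;b 10;p 14;p 14;b 12;b 12;b 13;b 13;b 14;b 14;p 15;k 3;p 15;k 3;b 10;p 12;b 12;b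
12;b 13;b 13;b 14;b 14;p 15;k 3;p 15;k 3;p 16;k 3;p 15;p 15;b 12;b 12;b 13;b 13;b 14;b 14;p 12;k 3;p 16;k 3;p 16;k 3;p
16;k 3;p 12;b 8;b 9;b 10;p 14;p 14;b 12;b 12;b 13;b 13;b 14;b 14;p 13;k 1;p 13;k 1;p 15;k 3;p 15;p 13;k 1;p 13;k 1;b
9;b 10;p 14;p 14;s;b 12;b 12;b 13;b 13;b 14;b 14;p 15;k 3;p 15;b 10;b 12;b 12;b 13;b 13;b 14;b 14;p 19;p 19;s;p 20;p
20;p 19;m 0;p 20;p 20;p 15;p 15;b 12;b 12;b 13;b 13;b 14;b 14;p 16;k 3;p 16;p 16;k 3;p 16;p 13;p 13;b 8;b 9;b 10;p
14;p 14;b 12;b 12;b 13;b 13;b 14;b 14;p 12;k 1;b 15;k 3;k 3;p 14;k 1;p 14;k 1;b 10;p 12;m 1;p 15;p 15;p 12;k 1;b 9;b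
10;p 14;p 14;b 12;b 12;b 13;b 13;b 14;b 14;b 15;k 3;k 3;b 10;b 12;b 12;b 13;b 13;b 14;b 14;p 14;k 1;k 2;b 19;s;b 19;m
0;p 15;p 15;p 14;k 1;k 2;p 14;k 1;p 14;k 1;b 9;b 10;p 12;b 12;b 12;b 13;b 13;b 14;b 14;b 15;k 3;k 3;p 15;p 15;b 10;b
12;b 12;b 13;b 13;b 14;b 14;p 19;s;p 19;s;p 20;p 20;m 0;p 19;m 1;m 1;p 15;p 15;b 10;b 12;b 12;s;b 13;b 13;b 14;b 14;p
19;s;p 19;s;p 20;p 20;m 0;p 19;m 1;m 1;b 12;m 0;b 13;b 13;s;b 14;b 14;p 19;s;p 19;s;p 20;p 20;m 0;p 19;m 1;m 1;b 13;m
0;b 14;b 14;s;p 12;s;p 20;p 20;s;b 20;b 20;p 20;m 0;m 0;p 20;s;p 20;m 0;b 14;m 0;p 12;b 12;b 12;s;b 13;b 13;b 14;b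
14;b 15;k 1;k 3;b 12;m 0;b 13;b 13;s;b 14;b 14;b 18;k 2;b 18;b 13;m 0;b 14;b 14;s;p 15;k 1;k 2;k 2;b 14;m 0;p 16;p
16]; [:: p 7;p 8;s;p 9;s;b 7;b 8;p 10;p 10;b 9;b 11;b 11;p 11;k 1;p 11;k 1;s;b 10;b 10;p 14;k 2;k 2;b 16;b 16;p 14;k
2;k 2;b 17;b 17;p 15;k 2;k 2;p 15;k 2;k 2;b 12;k 2;k 2;p 20;p 20;p 10;k 1;p 10;k 1;b 8;b 9;b 11;p 12;p 12;b 11;p 13;p
13;b 12;b 12;b 13;b 13;p 11;k 1;k 2;k 2;k 2;k 2;b 18;p 18;p 18;b 18;p 19;p 11;p 11;b 9;b 10;b 10;m 0;p 12;k 1;p 12;k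
1;b 10;b 10;s;b 11;b 11;s;b 12;k 2;p 16;p 16;b 12;k 2;p 17;p 17;b 10;m 0;b 11;b 11;m 1;b 11;m 1;b 12;b 12;k 2;k 2;p
17;p 17;s;b 13;k 2;k 2;p 18;s;p 18;s;p 13;k 2;k 2;k 2;m 0;p 18;m 1;m 1;k 2;k 2;p 17;p 17;b 12;m 0;k 2;k 2;p 18;p 18;p
8;m 0;p 9;m 1;b 6;k 0;b 7;b 8;b 9;b 12;p 12;p 12;b 12;p 13;p 13;b 10;k 1;p 14;p 14;b 10;k 1;p 15;p 15;b 11;k 1;p 16;p
11;k 1;p 11;k 1;s;b 9;b 10;p 12;p 12;b 10;p 13;p 13;b 12;b 12;b 11;k 1;b 11;k 1;b 15;k 2;b 15;k 2;b 16;k 2;b 16;k 2;p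
12;k 1;p 12;k 1;s;b 10;b 10;s;b 11;b 11;s;b 12;b 12;p 10;k 2;k 2;b 17;b 17;p 13;k 2;k 2;p 13;k 2;k 2;p 14;k 2;k 2;p
14;k 2;k 2;b 10;m 0;b 11;b 11;m 1;b 11;m 1;b 12;b 12;s;p 13;k 2;k 2;b 17;b 17;p 13;k 2;k 2;b 18;b 18;b 12;m 0;p 13;k
2;k 2;b 17;b 17;s;p 10;s;p 19;p 19;s;b 18;k 2;b 18;k 2;p 19;m 0;p 13;k 2;k 2;b 20;b 20;m 0;p 13;k 2;k 2;b 19;b 19;b
17;m 0;p 13;k 2;k 2;b 18;b 18;p 10;k 1;b 8;b 9;b 10;b 10;b 12;p 14;p 14;b 12;p 15;p 15;p 12;k 2;p 12;k 2;p 13;k 2;p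
13;k 2;p 11;k 1;p 11;k 1;s;b 9;b 10;b 10;b 11;b 11;b 12;b 12;p 12;k 2;b 16;b 16;p 12;k 2;b 17;b 17;p 12;k 1;p 12;k
1;s;b 10;b 10;s;b 11;b 11;s;b 12;b 12;p 13;k 2;k 2;k 2;b 18;b 18;p 18;s;p 18;s;b 19;b 19;m 0;p 18;m 1;m 1;p 19;s;p
19;m 0;b 10;m 0;b 11;b 11;m 1;b 11;m 1;b 12;b 12;s;p 13;k 2;k 2;k 2;b 18;b 18;p 18;s;p 18;s;p 19;p 19;s;b 19;k 2;b
19;k 2;p 19;m 0;m 0;p 18;m 1;m 1;p 19;s;p 19;m 0;b 12;m 0;p 13;k 2;k 2;k 2;b 18;b 18;s;p 19;s;p 19;s;b 19;b 19;s;p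
20;k 2;p 20;k 2;b 19;m 0;m 0;p 19;m 1;m 1;p 13;k 2;k 2;k 2;b 18;m 0;p 19;s;p 19;s;p 20;p 20;s;b 19;b 19;k 2;k 2;p 20;m
0;m 0;p 19;m 1;m 1;p 20;s;p 20;m 0;p 11;k 1;p 11;k 1;b 8;m 20;p 10;k 1;m 0;p 12;k 1;p 12;k 1;b 9;m 21;p 10;k 1;m 1;p
13;k 1;p 13;k 1;b 10;b 10;s;b 11;b 11;s;b 12;b 12;s;b 13;k 2;k 2;k 2;p 18;p 18;b 19;s;b 19;s;p 19;p 19;m 0;b 19;m 1;m
1;b 20;s;b 20;m 0;s;b 11;b 11;s;b 12;b 12;s;b 13;k 2;k 2;k 2;p 18;p 18;b 19;s;b 19;s;p 19;p 19;m 0;b 19;m 1;m 1;b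
20;s;b 20;m 0;b 11;m 0;s;b 12;b 12;m 1;b 12;m 1;s;p 14;k 2;k 2;k 2;k 2;b 19;b 19;s;p 10;s;p 19;p 19;s;b 20;b 20;p 19;m
0;m 0;p 19;s;p 19;m 0;b 19;m 0;p 19;s;p 19;s;p 20;p 20;m 0;p 19;m 1;m 1;b 10;m 14;s;b 11;b 11;m 9;b 11;m 9;s;b 12;b
12;m 10;b 12;m 10;s;p 10;k 2;k 2;k 2;k 2;b 19;b 19;s;p 19;s;p 19;s;b 20;b 20;s;p 20;k 2;b 20;m 0;m 0;p 19;m 1;m 1;b
19;m 0;p 19;s;p 19;s;p 20;p 20;m 0;p 19;m 1;m 1;b 10;m 9;m 0;b 11;b 11;m 24;m 10;b 11;m 24;m 1;b 11;m 10;m 1;b 12;b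
12;m 25;m 11;b 12;m 25;m 2;b 12;m 11;m 2;p 14;k 2;k 2;k 2;k 2;b 19;b 19;s;p 10;s;p 14;k 2;k 2;k 2;k 2;b 20;b 20;m 0;p
14;k 2;k 2;k 2;k 2;s;p 20;s;p 20;s;b 20;b 20;s;p 10;k 2;b 20;m 0;m 0;p 20;m 1;m 1;b 19;m 4;s;p 10;s;p 20;p 20;s;b 20;b
20;k 2;k 2;p 20;m 0;m 0;p 20;s;p 20;m 0;b 19;m 4;m 0]; [:: p 6;k 0;b 6;p 7;p 7;b 7;p 8;p 8;b 8;b 8;p 9;k 1;k 1;b 11;p
11;p 11;b 11;p 12;p 12;b 12;k 1;b 12;k 1;b 13;k 1;b 13;k 1;p 9;k 1;k 1;p 10;k 1;k 1;k 1;k 1;b 17;b 17;p 17;k 1;p 17;k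
1;p 18;k 1;p 18;k 1;b 8;b 8;p 7;p 8;p 8;p 9;p 9;b 7;b 9;k 1;b 9;k 1;b 10;k 1;b 10;k 1;p 10;k 1;k 1;b 13;p 15;p 15;b
13;p 16;p 16;p 10;k 1;k 1;b 18;b 18;p 17;k 1;k 1;k 1;k 1;p 17;k 1;k 1;k 1;k 1;p 18;k 1;k 1;k 1;k 1;b 9;b 9;p 8;p 8;s;p
9;p 9;s;b 7;k 1;k 1;p 12;k 1;k 1;b 13;b 13;p 13;k 1;p 13;k 1;p 14;k 1;p 14;k 1;p 12;k 1;k 1;b 18;b 18;b 11;k 1;k 1;b
11;k 1;k 1;b 12;k 1;k 1;b 12;k 1;k 1;p 10;k 1;s;b 14;k 1;k 1;m 0;m 0;m 0;b 19;s;b 19;m 0;p 8;m 0;p 9;p 9;m 1;p 9;m 1;b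
7;s;b 7;s;p 12;p 12;b 14;k 1;b 14;k 1;b 15;k 1;b 15;k 1;p 10;k 1;k 1;k 1;k 1;p 11;k 1;k 1;k 1;k 1;b 17;b 17;p 17;k 1;p
17;k 1;p 18;k 1;p 18;k 1;m 0;b 7;m 1;m 1;p 10;k 1;k 1;k 1;k 1;b 14;s;p 12;b 14;p 14;p 14;s;b 15;k 1;b 15;k 1;p 10;k
1;k 1;k 1;k 1;b 18;k 1;k 1;k 1;p 17;k 1;k 1;b 19;k 1;b 19;k 1;p 17;k 1;k 1;b 20;k 1;b 20;k 1;m 0;p 14;p 14;b 14;s;p
12;m 1;m 0;p 15;p 15;b 15;k 1;s;b 15;k 1;s;b 16;k 1;k 1;b 16;k 1;k 1;s;p 10;k 1;k 1;k 1;k 1;p 13;s;p 13;k 1;k 1;b 20;k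
1;b 20;k 1;s;b 10;k 1;k 1;m 0;m 0;m 0;b 20;p 13;k 1;b 20;p 13;k 1;p 13;m 1;m 1;m 1;m 1;m 0;b 15;k 1;m 1;m 1;b 16;k
1;s;b 16;k 1;m 2;m 0;b 16;k 1;m 3;m 3;p 10;k 1;k 1;k 1;k 1;p 11;k 1;k 1;k 1;k 1;k 1;k 1;b 20;s;p 12;k 1;m 0;p 20;k 1]].
Definition script_0 : seq (seq step) := [::
[:: p 4;p 5;p 6;k 0]; [:: b 4;b 5;b 6;k 1]; [:: c 0 1 3 2;c 0 2 1 3;k 0;k 1;k 1;k 0;k 0]; [:: c 0 4 2 5;k 0;c 1 4 3
5;k 0;k 1;k 0;k 0]; [:: c 0 1 2 3;k 0;k 1;k 0;k 0;k 0;k 0;k 0;k 0;k 0;k 0]; [:: p 1;p 2;p 3;b 0;p 4;p 4;b 1;p 5;p 5;b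
2;p 6;p 6;b 4;b 4;b 5;b 5;b 6;b 6;p 7;s;p 7;b 7;p 13;p 13;b 13;b 13;s;p 8;p 8;s;b 8;p 16;p 16;b 16;b 16;p 9;s;p 9;s;b
9;s;p 17;s;p 10;p 10;s;b 10;s;p 14;b 14;p 19;s;p 19;m 0;m 0;p 19;p 19;p 10;s;b 19;b 19;b 15;s;b 10;b 10;b 10;m 0;p
10;m 2;m 0;b 14;s;b 10;p 18;p 19;p 19;m 0;b 17;s;p 11;s;p 18;p 18;p 18;m 0;m 0;p 20;p 20;s;p 20;m 0;m 0;s;b 14;s;p
14;s;p 15;p 15;s;b 20;b 20;b 12;s;b 11;s;p 19;s;p 11;b 19;m 0;m 0;m 0;p 15;s;p 10;b 10;p 10;s;b 17;p 18;p 18;s;b 18;p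
18;m 0;m 0;s;p 10;b 10;m 0;m 0;p 15;m 4;m 0;m 0;s;p 15;s;p 15;s;b 15;p 19;p 19;m 0;p 15;m 1;m 1;m 0;p 19;s;p 19;s;b
19;p 20;p 20;s;b 11;s;p 12;s;p 12;m 0;m 0;p 20;m 0;s;b 20;b 20;s;b 11;s;b 19;b 19;m 0;b 20;m 0;m 0;p 19;m 4;m 4;s;b
19;s;p 11;s;b 20;b 20;s;p 12;s;b 17;m 0;b 20;m 0;m 0;m 0;p 20;s;p 20;m 0;p 19;m 7;m 7;m 0;m 0;b 14;s;p 14;s;p 15;p
15;s;b 19;b 19;p 15;s;p 19;s;p 19;s;p 10;p 10;m 0;p 19;m 1;m 1;p 15;m 3;m 0;p 19;p 19;s;p 19;m 0;m 0;s;p 15;s;p 15;s;b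
15;p 20;p 20;s;b 11;s;p 11;s;p 12;p 12;m 0;m 0;p 20;m 0;s;b 20;b 20;m 0;p 15;m 2;m 2;s;p 19;s;p 19;s;p 10;p 10;m 0;p
19;m 1;m 1;p 15;m 4;m 4;m 0;m 0;p 20;s;p 20;s;p 14;p 14;s;b 10;p 10;s;p 15;p 15;p 15;m 0;p 14;s;p 15;p 15;p 15;p
14;s;p 15;p 15;p 15;p 14;m 2;m 1;m 0;m 0;p 20;m 1;m 1;p 14;p 14;s;p 14;s;p 15;p 15;p 15;m 0;p 14;m 1;m 1;m 0;m 0;m 0;b
9;s;p 14;s;b 14;s;p 11;s;b 11;s;p 17;s;b 17;p 10;b 10;p 19;p 19;s;p 18;p 18;p 19;m 0;b 20;b 20;p 12;p 12;p 12;p 10;p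
10;s;b 10;p 19;b 18;p 20;p 20;p 20;p 20;s;p 12;p 12;p 12;p 10;m 1;s;p 12;p 12;p 12;p 10;m 1;m 0;m 0;b 20;p 10;b 20;s;p
19;p 19;b 20;p 10;m 0;b 15;p 12;p 15;m 0;p 10;p 10;s;b 10;p 20;p 20;s;p 15;p 15;p 15;p 20;m 0;m 0;s;p 15;p 15;p 15;s;p
10;m 1;s;b 20;b 20;s;p 19;b 15;p 12;p 12;p 12;b 20;m 0;m 0;p 10;m 3;m 1;m 1;m 0;m 57;m 0;m 25;m 0;s;b 20;s;b 20;s;p
11;s;p 19;p 19;s;b 10;p 15;s;b 14;p 20;p 20;m 0;p 10;s;p 10;m 0;p 10;m 0;s;p 19;m 0;s;b 19;p 15;s;p 10;p 10;m 0;p 10;p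
10;s;b 14;m 0;s;p 10;m 0;m 0;m 0;p 19;m 1;m 1;m 0;s;p 19;p 19;s;p 10;s;p 10;m 0;p 19;m 0;s;b 19;p 10;p 10;s;b 14;b
15;b 15;m 0;s;p 10;m 0;m 0;b 17;s;p 17;m 0;p 19;m 0;m 0;m 0;b 20;m 1;m 1;b 14;b 14;s;b 14;s;p 11;s;p 15;b 10;s;p
19;s;p 10;p 10;p 10;m 0;m 0;b 15;p 12;m 0;m 0;b 14;m 1;m 1;m 0;m 0;m 0;p 19;s;p 19;s;p 10;p 10;s;b 10;s;p 14;m 0;p
20;p 20;m 0;s;p 10;m 0;m 0;m 0;m 0;m 0;p 19;m 1;m 1;m 1;m 1;m 0;s;p 9;m 47;m 47;b 14;s;p 14;m 74;m 74;m 7;m 0;p 19;s;p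
19;s;b 19;s;b 19;s;p 20;p 20;b 20;p 17;s;p 20;b 20;b 20;m 0;p 20;b 20;m 0;b 19;m 1;m 1;m 0;p 19;m 1;m 1;m 0;m 0;m 0;b
19;s;b 19;s;p 9;s;b 9;p 15;s;p 14;s;b 11;s;b 14;b 15;b 15;m 0;b 14;s;p 11;b 15;b 15;m 0;m 0;p 10;p 10;s;b 10;p 20;p
20;m 0;s;p 10;m 0;m 0;m 0;p 14;s;b 11;s;p 11;s;b 20;p 19;b 20;p 19;m 0;m 0;p 20;s;p 20;m 0;m 0;s;p 10;p 10;s;b 10;p
20;p 20;p 20;m 0;s;p 10;m 0;m 0;m 0;s;p 17;s;b 10;b 10;s;p 10;s;b 14;m 0;b 20;p 18;b 10;s;p 10;s;p 10;m 0;b 10;m 2;p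
18;m 0;m 0;b 10;b 10;s;b 20;s;b 20;p 19;m 0;p 19;s;b 20;m 0;b 10;s;p 18;s;b 17;s;p 11;s;b 20;b 20;b 20;m 0;m 0;m 0;b
10;m 4;m 0;m 0;b 10;b 10;s;p 10;s;b 14;m 0;b 20;b 20;m 0;s;b 10;m 0;m 0;m 0;s;b 17;s;p 17;s;p 14;s;p 19;p 19;m 115;p
19;s;p 18;s;p 18;m 0;p 18;p 19;m 117;m 0;m 0;p 19;p 19;p 19;m 0;m 55;m 0;p 20;s;p 20;m 39;m 0;p 20;m 40;m 40;m 0;p
14;s;p 19;p 19;s;b 11;s;p 11;m 0;p 20;p 20;m 0;s;p 19;m 0;m 0;m 0;s;p 19;s;p 19;s;p 10;s;p 10;s;p 15;p 15;p 15;s;b 9;p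
20;p 20;p 20;m 0;p 10;m 2;m 2;p 10;m 1;m 1;m 0;m 0;s;p 19;m 1;m 1;m 0;m 0;m 0;m 0;m 0;b 19;m 1;m 1;m 1;m 1;b 9;b 9;s;p
14;s;b 15;s;b 15;s;p 15;b 20;b 20;m 0;b 15;m 1;m 1;m 0;b 10;b 10;s;p 10;s;b 14;m 0;m 0;b 10;s;b 10;m 0;m 0;m 0;m 0;m
0;b 9;s;p 10;s;p 14;s;b 14;s;p 9;b 10;s;b 17;m 0;b 18;s;b 10;b 10;b 10;m 0;p 11;s;p 15;p 15;p 15;m 0;m 0;m 0;b 20;s;b
20;m 0;m 0;p 14;s;b 14;s;p 11;s;p 9;p 15;p 15;p 15;s;b 17;s;b 10;p 15;b 10;m 0;m 0;m 0;m 0;m 0;m 0;m 0;m 0;s;b 9;m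
13;m 0;m 0;m 0;m 0;p 8;m 0;b 8;b 8;p 16;s;p 16;s;p 17;p 17;s;b 16;s;b 16;s;b 17;b 17;s;p 14;s;p 15;s;b 9;s;p 9;s;b
18;p 18;p 10;p 10;p 10;p 20;p 20;s;b 20;b 20;p 20;m 0;m 0;b 20;b 20;s;b 10;b 10;b 20;m 0;m 0;b 11;s;b 12;b 12;b 12;m
0;m 0;s;b 9;s;p 9;s;p 10;p 10;p 10;m 0;m 0;p 20;s;p 20;m 0;m 0;m 0;m 0;p 15;m 1;m 1;m 1;m 1;b 17;m 0;s;b 14;s;b 15;s;p
9;s;p 10;p 10;s;p 11;s;p 12;p 12;p 12;m 0;p 10;s;p 11;s;p 12;p 12;p 12;m 0;p 10;m 2;m 0;m 0;p 11;s;p 12;p 12;p 12;m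
0;m 0;m 0;m 0;m 0;m 0;b 16;m 1;m 1;b 17;s;b 17;m 2;m 0;b 17;m 3;m 3;p 17;m 0;s;b 16;s;b 16;s;b 17;b 17;s;p 14;s;p
15;s;b 9;s;p 9;p 10;p 10;p 10;s;b 19;p 18;p 19;p 19;p 18;b 10;p 18;b 10;m 0;m 0;b 11;s;b 12;b 12;b 12;m 0;m 0;m 0;m
0;m 0;b 17;m 0;s;p 14;s;b 9;s;p 9;b 18;p 10;p 10;p 10;s;b 19;b 10;b 10;b 10;m 0;m 0;m 0;m 0;m 0;m 0;b 16;m 1;m 1;b
17;s;b 17;m 2;m 0;b 17;m 3;m 3;m 0;p 16;m 1;m 1;p 17;s;p 17;m 2;m 0;p 17;m 3;m 3;m 0;b 13;b 13;p 7;s;b 7;p 15;p 15;m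
1;m 0;b 14;b 14;b 7;p 8;b 7;p 17;p 17;s;b 8;b 8;p 18;s;p 18;s;p 19;p 19;s;b 15;s;b 15;m 33;m 33;m 24;m 0;m 0;m 0;b
15;m 25;m 25;m 25;m 25;p 19;m 0;s;b 15;s;b 15;m 16;m 16;m 12;m 0;m 0;m 0;b 15;m 13;m 13;m 13;m 13;m 0;p 18;m 1;m 1;p
19;s;p 19;m 2;m 0;p 19;m 3;m 3;p 17;p 17;b 7;p 8;m 0;p 18;p 18;p 8;p 8;s;b 8;p 19;s;p 19;m 6;m 6;m 4;m 0;m 0;m 0;p
19;m 5;m 5;m 5;m 5;p 8;m 0;b 8;b 8;p 19;s;p 20;p 19;m 0;m 0;m 0]; [:: p 7;p 8;p 9;b 0;b 3;b 5;b 6;b 7;b 8;b 9;b 10;b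
11;p 10;p 10;s;p 11;p 11;s;p 12;p 12;s;b 12;s;p 15;b 13;p 17;b 14;p 14;p 13;p 13;s;b 15;p 16;b 16;p 18;l;s;b 17;s;p
19;p 19;p 18;p 18;m 1;b 19;b 19;b 16;b 17;m 0;p 19;p 19;s;p 18;p 18;p 19;p 19;s;p 18;s;p 19;p 19;b 20;b 20;p 16;p
16;s;p 19;p 19;p 16;m 0;p 19;p 19;s;b 15;p 16;b 16;b 16;p 19;p 19;p 19;m 3;p 19;m 4;b 16;b 16;p 19;p 19;p 19;p 19;p
19;p 16;p 16;s;p 19;p 16;m 0;p 13;m 2;s;b 15;b 15;p 19;p 19;p 19;p 19;s;p 16;p 16;p 19;m 0;p 13;m 2;m 0;b 15;p 16;b
15;p 19;p 19;p 19;p 19;s;b 15;p 20;p 19;m 0;s;b 18;p 19;p 19;p 19;p 19;s;b 19;b 19;p 19;m 0;p 16;p 16;s;p 14;p 14;p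
14;p 16;m 0;b 14;p 14;m 2;m 2;b 18;p 13;p 19;p 19;p 18;p 18;s;b 16;p 13;b 15;p 16;m 10;b 17;p 20;p 20;p 20;s;b 20;p
20;m 0;p 14;p 14;p 14;b 17;p 16;p 20;p 20;b 20;b 20;p 14;p 14;p 14;s;p 13;p 13;s;b 15;p 16;b 17;p 20;b 20;p 20;p 20;p
20;p 20;p 13;m 0;p 13;p 18;m 2;s;p 16;p 16;s;b 15;p 13;b 16;p 20;b 20;p 20;p 20;p 20;p 20;p 16;m 0;p 16;p 18;m 2;m 0;p
19;p 19;s;b 18;b 19;b 19;s;b 16;b 16;b 19;m 0;b 19;b 19;p 19;m 0;p 13;p 13;s;p 17;p 17;s;b 17;b 18;p 17;m 0;p 13;m 0;p
13;m 0;p 19;p 19;p 15;p 15;s;p 18;p 18;s;b 15;p 17;b 16;b 14;b 13;b 17;p 20;p 18;m 0;s;p 18;p 18;m 1;p 18;m 1;p 15;m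
1;s;p 18;p 18;p 15;m 1;m 0;p 12;m 0;s;b 12;p 15;b 13;p 17;b 14;b 14;s;p 19;p 19;b 14;m 0;s;b 15;b 15;s;p 13;b 16;p
16;s;p 18;b 18;b 18;p 14;p 14;s;b 18;p 14;m 0;m 0;p 14;s;p 14;s;b 17;m 0;p 14;m 1;m 1;p 16;s;b 16;p 14;b 16;p 18;b
16;p 18;m 0;b 15;m 0;b 14;b 14;s;p 19;p 19;b 14;m 0;s;b 15;p 13;b 15;s;b 16;p 16;s;p 18;b 18;b 18;m 0;b 15;p 13;m 0;p
19;p 19;s;p 13;p 13;s;p 17;s;p 17;m 0;p 13;m 0;p 19;m 0;p 18;b 14;b 14;s;p 19;p 19;s;b 20;b 20;p 19;m 0;b 14;m 0;b
13;p 13;m 9;m 5;p 17;p 13;p 13;s;b 16;s;b 15;p 15;p 15;p 15;s;b 16;p 14;s;p 16;b 17;s;p 19;b 18;p 20;l;m 0;m 0;p 15;m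
0;p 13;m 4;p 13;m 0;p 19;p 19;p 15;p 15;s;p 18;s;p 18;m 0;p 15;m 0;p 11;m 0;s;p 12;p 12;m 1;p 12;m 1;s;b 12;b 12;s;p
19;p 19;s;p 15;s;b 13;p 17;p 20;m 0;p 19;m 0;b 12;s;p 19;p 19;s;p 18;s;b 14;p 15;p 15;s;b 17;b 13;p 13;p 15;m 0;b 17;b
17;m 0;p 19;m 0;b 12;m 4;m 0;b 13;p 13;p 17;p 17;s;b 15;b 18;b 19;b 19;m 0;s;p 17;m 0;m 0;p 17;p 13;p 13;s;b 15;p 15;b
17;p 15;b 17;m 0;s;p 13;m 0;m 0;p 10;m 0;p 11;p 11;m 1;p 11;m 1;p 12;p 12;m 2;p 12;m 2;b 12;s;b 12;s;p 15;s;p 19;p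
19;s;b 13;p 17;s;p 13;p 13;s;b 16;b 14;b 15;p 14;s;p 16;b 19;p 18;b 18;p 20;l;m 0;p 13;m 0;m 0;b 14;b 17;b 18;b 18;p
19;m 0;m 0;m 0;b 12;m 1;m 1;p 15;s;p 15;s;b 15;b 17;b 16;p 13;m 0;m 0;s;p 15;m 1;m 1;m 0]; [:: p 0;p 4;p 7;p 8;b 0;b
3;b 5;p 11;p 11;b 6;b 7;b 8;b 9;b 10;b 10;p 9;p 9;s;p 10;p 10;s;b 12;p 14;b 11;k 1;k 1;b 11;k 1;k 1;b 13;s;p 16;b 18;p
12;p 12;k 1;s;b 16;p 13;s;p 15;k 1;p 17;p 17;m 0;p 15;k 1;k 1;b 17;k 1;k 1;p 12;k 1;s;b 19;b 19;s;p 20;p 20;b 19;m 0;p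
12;m 2;m 0;p 13;s;p 17;p 17;k 0;m 0;p 12;b 16;p 12;k 1;s;b 19;s;b 19;m 0;p 12;k 1;s;b 19;b 19;p 12;b 16;m 1;m 0;p
20;s;p 20;m 0;b 18;p 12;b 18;s;p 20;s;p 20;m 0;b 18;s;p 20;p 20;b 18;p 12;m 1;m 0;m 0;p 20;p 20;s;b 18;b 19;s;b 19;m
0;p 20;m 0;p 12;p 12;s;b 16;b 17;s;p 18;s;b 14;k 1;m 0;m 0;p 12;m 0;p 12;p 18;p 18;s;p 14;p 14;k 1;s;b 19;b 19;s;p
19;k 0;p 19;k 0;b 19;m 0;b 11;k 1;k 1;p 14;k 1;s;b 11;k 1;k 1;p 19;s;p 19;s;b 20;b 20;m 0;p 19;m 1;m 1;p 14;m 3;m 0;b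
11;k 1;k 1;p 19;s;p 19;k 0;m 0;k 0;p 18;m 0;p 14;p 14;s;b 17;b 11;k 1;k 1;p 19;s;p 19;s;b 14;p 15;s;p 13;k 1;k 0;m 0;b
20;b 20;m 0;p 19;m 1;m 1;b 11;k 1;k 1;b 11;k 1;k 1;s;b 20;b 20;s;p 19;k 0;b 20;m 0;b 11;k 1;k 1;p 14;m 2;s;b 11;k 1;k
1;p 19;s;p 19;m 0;p 14;m 2;m 0;p 10;m 0;b 12;b 12;s;p 18;p 18;p 14;s;b 18;b 18;b 13;s;p 16;m 0;m 0;b 12;m 0;p 14;p
14;s;p 15;s;p 15;s;b 14;s;p 16;k 1;b 13;p 12;k 1;p 20;p 20;m 0;p 20;p 20;k 1;s;p 13;p 13;b 18;b 17;b 18;b 17;p 20;k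
1;s;p 13;p 13;p 13;p 20;m 1;m 0;m 0;p 15;m 1;m 1;p 13;s;p 13;b 18;b 18;b 17;s;p 20;p 20;m 0;b 18;b 18;b 17;p 13;m 1;m
1;m 0;s;p 15;s;p 15;s;b 14;s;p 16;k 1;m 0;p 20;p 20;s;p 13;p 13;s;b 15;s;p 17;p 17;m 0;p 13;p 13;m 0;m 0;s;p 20;m 0;m
0;m 0;p 15;m 1;m 1;s;p 14;m 8;s;p 15;s;p 15;s;b 14;p 20;p 20;s;b 13;p 12;k 1;b 16;s;p 16;m 0;s;b 16;p 12;b 17;p 16;k
1;m 0;s;b 13;p 12;k 1;s;p 16;k 1;m 0;p 20;m 2;s;p 13;k 1;p 13;b 17;p 20;m 1;m 0;s;b 14;s;p 16;k 1;m 0;p 20;p 20;s;p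
13;p 13;b 17;p 13;b 17;p 20;m 0;m 0;p 15;m 4;m 4;s;b 20;s;b 20;s;p 18;p 19;p 19;p 19;p 19;m 0;b 20;m 1;m 1;p 15;m 4;m
4;m 0;m 0;p 14;m 16;m 1;m 1;p 15;s;p 15;s;b 14;p 20;p 20;s;b 13;p 12;s;p 13;k 1;p 13;m 0;s;b 16;p 12;b 18;m 0;m 0;s;p
20;m 0;m 0;m 0;p 15;m 1;m 1;p 9;m 0;p 10;p 10;s;b 12;p 14;b 11;k 1;k 1;b 11;k 1;k 1;b 13;s;b 13;s;p 20;p 20;s;p 16;s;b
16;p 15;s;p 17;k 0;k 1;m 0;m 0;p 20;m 0;m 0;b 13;m 1;m 1;p 18;p 18;s;b 11;k 1;k 1;p 14;s;p 14;s;b 18;p 13;s;p 19;p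
19;s;b 20;b 20;p 19;m 0;m 0;p 19;s;p 19;m 0;b 16;s;b 13;b 13;k 1;m 0;s;b 20;b 20;s;p 20;p 20;p 20;b 20;m 0;m 0;p 14;m
3;m 3;s;p 19;s;p 19;m 0;p 14;m 3;m 3;m 0;p 18;m 0;p 14;s;p 14;s;b 18;b 11;k 1;k 1;p 19;s;p 19;m 0;b 11;k 1;k 1;p
20;s;p 20;m 0;m 0;p 14;m 1;m 1;p 10;m 0;b 12;b 12;s;p 18;p 18;s;p 14;s;b 19;b 19;b 13;s;p 16;s;b 18;p 12;k 1;p 12;p
12;p 12;m 0;m 0;m 0;p 18;m 0;b 12;m 0;p 13;s;p 13;s;b 19;b 19;s;b 18;s;p 18;p 19;p 19;s;p 14;s;p 15;k 1;p 15;k 1;m 0;p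
19;m 0;p 19;p 19;m 0;b 19;m 0;m 0;s;p 15;p 15;s;b 15;b 14;s;p 16;k 1;m 0;m 0;s;p 15;m 0;m 0;m 0;s;b 19;b 19;s;b 18;s;p
18;p 19;p 19;s;p 14;s;b 11;k 1;k 1;m 0;p 19;m 0;p 19;p 19;m 0;b 19;m 0;m 0;p 13;m 6;m 6;s;b 19;b 19;s;p 14;s;p 15;s;p
15;m 0;m 0;b 19;m 0;m 0]; [:: p 0;p 3;p 4;p 6;p 7;b 0;p 8;p 8;b 3;b 5;p 10;p 10;b 6;b 7;b 8;b 8;b 9;b 9;p 9;p 9;s;b
10;k 1;k 1;b 10;k 1;k 1;b 11;k 1;k 1;b 11;k 1;k 1;p 11;s;p 11;k 1;s;p 12;s;p 12;k 1;s;b 12;s;b 13;s;p 19;k 1;p 15;k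
1;k 1;m 0;m 0;m 0;m 0;m 0;p 12;k 1;k 1;s;b 19;s;b 19;m 0;p 12;m 3;m 3;m 0;s;b 12;s;p 16;p 16;k 0;k 0;m 0;s;p 17;k
1;s;b 19;m 0;m 0;m 0;p 11;k 1;k 1;s;b 18;s;b 18;m 0;p 11;m 3;m 3;m 0;p 12;s;p 12;k 1;m 4;m 0;p 12;k 1;k 1;s;b 20;s;b
20;m 0;p 12;m 7;m 7;m 0;p 9;m 0;b 10;k 1;k 1;b 10;k 1;k 1;b 11;k 1;k 1;b 11;k 1;k 1;b 12;s;b 12;m 0;m 0;m 0]; [:: p
0;p 1;p 3;p 4;p 5;p 6;b 0;p 7;p 7;b 3;p 8;p 8;b 5;p 9;p 9;b 6;b 6;b 7;b 7;b 8;b 8;b 9;k 1;k 1;b 9;k 1;k 1;b 10;k 1;k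
1;b 10;k 1;k 1;b 11;k 1;k 1;b 11;k 1;k 1]; [:: p 0;p 3;p 5;b 0;p 6;p 6;b 1;p 7;p 7;b 3;p 8;p 8;b 4;b 5;b 6;b 7;b 7;b
8;b 8;b 9;b 9;p 9;k 1;k 1;p 9;k 1;k 1;p 10;k 1;k 1;p 10;k 1;k 1;p 11;k 1;k 1;p 11;k 1;k 1]; [:: p 0;p 1;p 3;p 4;b 0;p
5;p 5;b 1;b 2;b 3;p 8;p 8;b 6;b 6;b 7;b 7;p 6;k 0;p 6;k 0;b 5;b 5;p 7;k 0;k 1;k 1;b 15;s;b 15;p 7;k 1;k 1;b 16;k 0;b
16;k 0;p 11;s;p 16;p 16;p 17;p 17;p 12;p 12;k 1;k 1;k 1;k 1;m 0;p 15;s;p 15;s;p 12;k 1;k 1;p 12;k 1;k 1;p 16;p 16;p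
16;m 0;p 15;m 1;m 1;s;b 8;k 2;k 2;b 8;k 2;k 2;b 13;s;b 13;s;b 14;k 0;m 0;b 13;m 1;m 1;m 0;p 15;s;p 15;s;b 16;b 16;b
15;s;p 11;p 7;k 1;k 1;p 12;k 1;k 1;k 0;p 12;k 1;k 1;k 0;b 17;k 2;k 2;p 18;p 18;p 7;k 1;k 1;p 12;k 1;k 1;k 0;p 12;k 1;k
1;k 0;b 18;s;p 16;m 0;p 18;p 18;m 0;p 18;p 18;s;b 17;b 17;p 11;s;p 11;s;p 12;k 0;p 12;k 0;s;p 7;k 0;k 1;k 1;k 1;k 1;m
0;p 11;m 1;m 1;p 12;s;p 12;m 2;m 0;p 12;m 3;m 3;p 18;m 0;s;p 7;k 0;k 1;k 1;p 11;p 11;s;b 11;p 12;k 0;k 1;p 12;k 0;k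
1;m 0;s;b 20;b 20;p 12;s;p 12;m 0;p 12;s;p 11;m 2;s;p 12;p 12;k 0;k 0;k 1;m 0;p 11;s;p 12;p 12;k 1;k 1;k 1;k 1;p 11;m
3;m 2;m 2;m 0;m 0;p 15;m 1;m 1;b 15;s;p 7;k 1;k 1;b 18;k 0;b 18;k 0;p 11;s;p 16;s;p 16;s;p 17;k 0;p 17;k 0;m 0;p 16;m
1;m 1;p 17;s;p 17;m 0;m 0;m 21;m 0;p 16;s;p 16;s;b 18;b 18;m 7;m 0;p 16;m 1;m 1;p 7;k 0;k 1;k 1;b 8;k 2;k 2;b 8;k 2;k
2;b 13;s;b 13;s;b 14;k 0;b 14;k 0;m 0;b 13;m 1;m 1;b 14;s;b 14;m 0]; [:: p 0;p 1;p 2;b 0;b 1;b 2;p 3;k 0;b 6;b 6;p 3;k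
0;b 5;p 8;p 8;b 5;p 9;p 9;b 7;b 7;p 4;k 0;k 1;k 1;k 1;k 1;b 12;b 12;p 12;k 1;p 12;k 1;p 13;k 1;p 13;k 1;b 13;s;b 14;b
13;s;b 14;s;b 4;k 0;k 1;k 1;p 16;p 16;b 4;k 0;k 1;k 1;p 17;p 17;p 5;k 1;k 1;k 1;k 1;b 14;m 0;s;b 13;s;b 4;k 0;k 1;k
1;p 16;p 16;b 4;k 0;k 1;k 1;p 17;p 17;p 5;k 1;k 1;k 1;k 1;m 0;s;b 4;k 0;k 1;k 1;k 1;p 17;p 17;b 4;k 0;k 1;k 1;k 1;p
18;p 18;p 5;k 1;k 1;k 1;k 1;m 0;m 0;m 0;b 13;s;b 14;m 4;b 14;m 5;m 2;m 0;m 0;m 0;b 14;m 2;m 2;m 2;m 2;b 14;m 3;m 3;m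
3;m 3;p 4;k 0;k 1;k 1;k 1;k 1;b 17;s;p 14;k 0;k 0;b 17;k 0;k 0;p 18;k 1;p 18;k 1;s;p 5;k 0;k 1;k 1;k 1;k 1;m 0;m 0;m
0;p 18;k 1;s;p 18;s;b 17;p 19;k 1;k 0;p 19;k 1;k 0;s;p 5;k 0;k 1;k 1;k 1;k 1;m 0;p 18;k 1;m 1;m 1;b 17;s;p 14;k 0;k
0;m 4;m 0;m 0;m 0;p 19;k 1;s;p 19;m 3;m 0;p 19;k 1;m 4;m 4]; [:: p 0;p 0;b 0;p 1;p 1;b 0;p 2;p 2;b 1;b 1;b 2;b 2;p 3;k
0;k 0;k 0;k 0;b 7;k 0;k 0;p 7;p 7;b 8;k 0;b 8;k 0;b 9;k 0;b 9;k 0;b 7;k 0;k 0;p 12;p 12;p 3;k 0;k 0;k 0;k 0;p 5;k 0;k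
0;k 0;k 0;k 0;p 5;k 0;k 0;k 0;k 0;k 0;p 6;k 0;k 0;k 0;k 0;k 0;p 6;k 0;k 0;k 0;k 0;k 0;b 12;k 0;k 0;k 0;k 0;p 13;k 0;k
0;b 17;k 0;b 17;k 0;p 13;k 0;k 0;b 18;k 0;b 18;k 0;b 12;k 0;k 0;k 0;k 0;p 18;k 0;k 0;p 18;k 0;k 0;b 10;k 0;k 0;k 0;k
0;k 0;b 10;k 0;k 0;k 0;k 0;k 0;b 11;k 0;k 0;k 0;k 0;k 0]].
End Scripts.

(** * Assembling the refutations *)

Lemma embedding_dual_flip (P Q : finType) (inc : P -> Q -> bool) s phi psi :
  all uniq s.2 -> all (all (fun i => i < s.1)) s.2 ->
  embedding inc (dual s) phi psi -> embedding (flipi inc) s psi phi.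
Proof.
move=> /allP un /allP rng e.
have sz : size (dual s).2 = s.1 by rewrite size_map size_iota.
split.
- by move=> i j li lj; apply: (emb_inj_bl e); rewrite sz.
- by move=> i j li lj; apply: (emb_inj_pt e).
- move=> j; case: (ltnP j (size s.2)) => lj; last by rewrite nth_default.
  by apply: un; apply: mem_nth.
- move=> i j ij; have lj := nth_in_size ij.
  have li : i < s.1 by have /rng/allP/(_ i ij) : nth [::] s.2 j \in s.2 by apply: mem_nth.
  split=> //; rewrite /flipi.
  have : j \in nth [::] (dual s).2 i by rewrite (nth_map 0) ?size_iota // nth_iota // mem_pblocks.
  by case/(emb_inc e).
Qed.

Definition starts (ss : seq stage) := [seq s.1.1 | s <- ss].

Section Classify.
Variables (P Q : finType) (inc : P -> Q -> bool) (n : nat) (Goal : Prop).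
Hypothesis G : good inc n.

Lemma run_stage_sound fuel pats s auto known : n \in orders -> all pat_ok pats -> outcome_complete inc Goal pats ->
  (forall k, k \in auto -> refuted_es inc Goal k.1) -> (forall k, k \in known -> refuted_es inc Goal k.1) ->
  run_stage fuel pats s auto known -> refuted inc Goal s.1.1.
Proof.
move=> no pok oc ha hk; rewrite /run_stage; case E: replay => [[m sc]|] // _.
by have [] := replay_sound G no ha hk pok oc E.
Qed.

Lemma pipeline_cons pats done s ss : pipeline pats done (s :: ss) ->
  [/\ {subset [seq k.2 | k <- s.1.2.1 ++ s.1.2.2] <= done},
      all (fun k => all (fun y => cover y.1 k.2) (edge_reps k.1 k.2)) s.1.2.1,
      all (fun k => cover (anchored k.1 k.2).1 k.2) s.1.2.2,
      run_stage 100 pats s (flatten [seq edge_reps k.1 k.2 | k <- s.1.2.1]) [seq anchored k.1 k.2 | k <- s.1.2.2] &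
      pipeline pats (s.1.1 :: done) ss].
Proof.
have zipE (T S : Type) (f : T -> S) xs : zip xs [seq f x | x <- xs] = [seq (x, f x) | x <- xs].
  by elim: xs => //= x xs ->.
have lazyE (a b : bool) : a &&& b = a && b by case: a.
rewrite [pipeline _ _ _]/pipeline -/pipeline !zipE !all_map !lazyE => /andP[/andP[/andP[/andP[/allP h1 h2] h3] h4] h5].
by split=> // _ /mapP[k kk ->]; apply: h1.
Qed.

Lemma pipeline_sound pats done ss : n \in orders -> all pat_ok pats -> outcome_complete inc Goal pats ->
  pipeline pats done ss -> (forall s, s \in done -> refuted inc Goal s) ->
  forall s, s \in starts ss ++ done -> refuted inc Goal s.
Proof.
move=> no pok oc; elim: ss done => [|s0 ss IH] done //.
case/pipeline_cons=> kd /allP ac /allP kc r0 /IH h rd s.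
have r1 : refuted inc Goal s0.1.1.
  apply: run_stage_sound no pok oc _ _ r0 => [k /flatten_mapP[x xa kx]|k /mapP[x xa ->]].
    by apply: cover_refuted (allP (ac _ xa) _ kx) (rd _ (kd _ _)); rewrite map_cat mem_cat map_f.
  by apply: cover_refuted (kc _ xa) (rd _ (kd _ _)); rewrite map_cat mem_cat (map_f _ xa) orbT.
rewrite inE => hs; apply: h.
  by move=> s'; rewrite inE => /orP[/eqP->|/rd].
by rewrite mem_cat inE; move: hs; rewrite mem_cat => /orP[->|/orP[->|->]]; rewrite ?orbT.
Qed.

Lemma refuted_edge : 0 < n -> refuted inc Goal (1, [:: [:: 0]]) -> Goal.
Proof.
move=> n0 r; have /card_gt0P[p _] : 0 < #|P| by rewrite (good_card G).
have /card_gt0P[q] : 0 < #|bls inc p| by rewrite (good_cubic G).2.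
rewrite inE => pq; apply: (r (fun=> p) (fun=> q)); split=> /=.
- by move=> [|i] [|j].
- by move=> [|i] [|j].
- by case=> //= j; rewrite nth_nil.
- by move=> i [|j]; rewrite /= ?nth_nil // inE => /eqP->.
Qed.

Hypothesis smaller : forall (P' Q' : finType) (inc' : P' -> Q' -> bool), ~ good inc' (n - 6).
Lemma refuted_DX13 : refuted inc Goal DX13.
Proof. by move=> phi psi /(contract_good G)/smaller. Qed.
End Classify.

Lemma refuted_DX13s (P Q : finType) (inc : P -> Q -> bool) n Goal : good inc n ->
  (forall (P' Q' : finType) (inc' : P' -> Q' -> bool), ~ good inc' (n - 6)) ->
  forall s, s \in [:: DX13; DX13d] -> refuted inc Goal s.
Proof.
move=> G sm s; rewrite !inE => /orP[/eqP->|/eqP->]; first exact: refuted_DX13 G sm.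
move=> phi psi h; have e := embedding_dual_flip (s := DX13) isT isT h.
by case: (sm _ _ _ (contract_good (good_dual G) e)).
Qed.

Lemma search_violators : violator_search leaf_pats leaf_known 20 [:: None].
Proof. vm_cast_no_check (erefl true). Qed.
Lemma patterns_reduce : reduction_check leaf_pats pats4.
Proof. vm_cast_no_check (erefl true). Qed.
Lemma leaf_pats_ok : all (fun pt => cover (pat_es pt) (pat_state pt) && all align_ok (pat_al pt)) leaf_pats.
Proof. by vm_compute. Qed.
Lemma leaf_known_ok : all (fun es => cover es DX13 || cover es DX13d) leaf_known.
Proof. by vm_compute. Qed.
Lemma pats_ok4 : all pat_ok pats4. Proof. by vm_compute. Qed.
Lemma pats_ok2 : all pat_ok pats2. Proof. by vm_compute. Qed.

(** [TF] is quoted like a refuted state: for 21 points its occurrence is the goal, and smaller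
    orders have no room for it. [DX13] and its dual fall to contraction. *)
Definition done0 := [:: TF; DX13; DX13d].
Definition stages_pats : seq stage := zip targets_pats script_pats.
Definition stages : seq stage := zip (targets_XX ++ targets_X ++ targets_0) (script_XX ++ script_X ++ script_0).
Definition done1 := starts stages_pats ++ done0.

Lemma pipeline_pats : pipeline pats4 done0 stages_pats.
Proof. vm_cast_no_check (erefl true). Qed.
Lemma pipeline_stages : pipeline pats2 done1 stages.
Proof. vm_cast_no_check (erefl true). Qed.

Lemma spurious_starts : all (fun s => s \in starts stages_pats) [:: T2; cdual T2; X11b; cdual X11b; UX; cdual UX].
Proof. by vm_compute. Qed.
Lemma edge_start : (1, [:: [:: 0]]) \in starts stages.
Proof. by vm_compute. Qed.

(** Two rounds. With all patterns of [pats4] the first eliminates [T2], [X11b], [UX] and their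
    duals; the second then branches over [pats2] only and goes down to a single incidence, which
    every graph contains. *)
Lemma good_goal (P Q : finType) (inc : P -> Q -> bool) n (Goal : Prop) : good inc n -> n \in orders ->
  (forall (P' Q' : finType) (inc' : P' -> Q' -> bool), ~ good inc' (n - 6)) ->
  (n = 21 -> refuted inc Goal TF) -> Goal.
Proof.
move=> G no sm rTF.
have n21 : n <= 21 by move: no; rewrite !inE => /or3P[]/eqP->.
have rk (P' Q' : finType) (inc' : P' -> Q' -> bool) : good inc' n ->
    forall es, es \in leaf_known -> refuted_es inc' Goal es.
  move=> G' es /(allP leaf_known_ok) /orP[]c; apply: cover_refuted c _; apply: (refuted_DX13s Goal G' sm).
    by rewrite inE eqxx.
  by rewrite in_cons mem_head orbT.
have oc4 : outcome_complete inc Goal pats4.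
  exact: (cycle_outcome G n21 leaf_pats_ok (rk _ _ _ G) (rk _ _ _ (good_dual G)) search_violators patterns_reduce).
have r0 s : s \in done0 -> refuted inc Goal s.
  rewrite /done0 in_cons => /orP[/eqP->|h]; last exact: (refuted_DX13s Goal G sm).
  have [/rTF //|ne] := eqVneq n 21; move=> phi psi /(embedding_card_pt G) h.
  by case/negP: ne; rewrite eqn_leq n21; apply: h.
have r1 := pipeline_sound G no pats_ok4 oc4 pipeline_pats r0.
(* A pattern outside [pats2] is a state refuted in the first round, so its occurrence at a cycle
   already gives [Goal]. *)
have oc2 : outcome_complete inc Goal pats2.
  move=> x b /oc4[]; last by right.
  case=> pt ptp h; have [p2|np2] := boolP (pt \in pats2); first by left; exists pt.
  right; move: ptp; rewrite /pats4 mem_cat (negbTE np2) orFb => /mapP[s sp ept].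
  case: h => r [alpha [beta [_ e _ _]]]; rewrite ept in e; apply: (r1 s) e.
  by rewrite mem_cat (allP spurious_starts _ sp).
have r2 := pipeline_sound G no pats_ok2 oc2 pipeline_stages r1.
by apply: (refuted_edge G _) (r2 _ _); [move: no; case: (n)|rewrite mem_cat edge_start].
Qed.

(** With three points every point lies on every block, and two points with two blocks form a
    4-cycle. *)
Lemma no_good3 (P Q : finType) (inc : P -> Q -> bool) : ~ good inc 3.
Proof.
move=> G; have cub := good_cubic G; have cP := good_card G.
have all_inc p q : inc p q.
  have /setP/(_ p) : pts inc q = setT by apply/eqP; rewrite eqEcard subsetT cardsT cP cub.1.
  by rewrite !inE.
have /card_gt1P[x [y [_ _ xy]]] : 1 < #|P| by rewrite cP.
have /card_gt1P[q [q' [_ _ qq']]] : 1 < #|Q| by rewrite -(card_sides cub) cP.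
exact: (good_linear G xy qq').
Qed.

Lemma no_good9 (P Q : finType) (inc : P -> Q -> bool) : ~ good inc 9.
Proof. by move=> G; apply: (good_goal G isT (@no_good3)). Qed.

Lemma no_good15 (P Q : finType) (inc : P -> Q -> bool) : ~ good inc 15.
Proof. by move=> G; apply: (good_goal G isT (@no_good9)). Qed.

Lemma good21 (P Q : finType) (inc : P -> Q -> bool) : good inc 21 ->
  exists phi psi, embedding inc TF phi psi.
Proof. by move=> G; apply: (good_goal G isT (@no_good15)) => _ phi psi e; exists phi, psi. Qed.

(** * The three Fano planes *)

Section Configuration.
Variables (T : finType) (B : {set {set T}}).
Definition blk := {b : {set T} | b \in B}.
Definition on_block (x : T) (q : blk) := x \in val q.

(** A colouring that makes every block bichromatic is the indicator function of a blocking set. For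
    connectedness, [Y] is determined by [X], as every block has a point. *)
Lemma config_good : sym_config3 B -> conf_connected B -> ~ has_blocking_set B -> good on_block #|T|.
Proof.
case=> cB b3 x3 _ con nb.
have pE (q : blk) : pts on_block q = val q by apply/setP=> x; rewrite inE.
have c1 (q : blk) : #|pts on_block q| = 3 by rewrite pE; apply: b3; apply: (valP q).
split=> //.
- split=> // x; rewrite -(x3 x) -(card_imset _ val_inj); congr #|pred_of_set _|.
  apply/setP=> b; apply/imsetP/idP => [[q h ->]|]; first by rewrite inE (valP q); move: h; rewrite inE.
  by rewrite inE => /andP[bB xb]; exists (Sub b bB); rewrite ?SubK // inE /on_block SubK.
- move=> X Y h ne.
  have pt (q : blk) : exists x, on_block x q.
    by have /card_gt0P[x] : 0 < #|pts on_block q|; [rewrite c1|rewrite inE => ?; exists x].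
  have [b bB|X0|XT] := con X.
  + have [bY|bY] := boolP (Sub b bB \in Y); apply/orP; [left|right]; apply/subsetP=> x xb.
      by rewrite (h x (Sub b bB)) // /on_block SubK.
    by rewrite inE (h x (Sub b bB)) // /on_block SubK.
  + case/orP: ne; first by rewrite X0 eqxx.
    by case/set0Pn=> q qY; have [x xq] := pt q; have := h x q xq; rewrite X0 qY inE.
  + split=> //; apply/setP=> q; rewrite inE; have [x xq] := pt q.
    by rewrite -(h x q xq) XT inE.
- case=> f hf; apply: nb; exists [set x | f x] => b bB.
  have /bichromP[u [v [_ _]]] := hf (Sub b bB); rewrite /on_block SubK => ub vb fuv.
  wlog fu : u v ub vb fuv / f u.
    by move=> w; case fu: (f u); [apply: (w u v)|apply: (w v u); rewrite // 1?eq_sym //; move: fuv; rewrite fu; case: (f v)].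
  split; apply/set0Pn; [exists u|exists v]; rewrite !inE ?ub ?vb ?fu //.
  by move: fuv; rewrite fu andbT; case: (f v).
Qed.
End Configuration.

(** The numbering that [TF] uses, so that statements about [three_fano] become computations on lists
    of numbers below 21. *)
Definition dec (k : nat) : 'I_3 * 'I_7 := (inord (k %/ 7), inord (k %% 7)).
Definition enc (x : 'I_3 * 'I_7) : nat := 7 * x.1 + x.2.

Lemma enc_lt x : enc x < 21.
Proof. by rewrite /enc; have := ltn_ord x.1; have := ltn_ord x.2; lia. Qed.
Lemma encK : cancel enc dec.
Proof.
case=> i p; rewrite /enc /dec /= mulnC divnMDl // divn_small // addn0 modnMDl modn_small //.
by rewrite !inord_val.
Qed.
Lemma decK k : k < 21 -> enc (dec k) = k.
Proof.
move=> lk; rewrite /enc /dec /= !inordK; [lia| |]; first by rewrite ltn_mod.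
by rewrite ltn_divLR.
Qed.

Definition tfset (b : seq nat) : {set 'I_3 * 'I_7} := [set x | enc x \in b].

Lemma in_tfset x b : (x \in tfset b) = (enc x \in b). Proof. by rewrite in_set. Qed.

Lemma fano_blockE (j : 'I_7) (p : 'I_7) :
  (p \in [set fano_pt j; fano_pt (j + 1); fano_pt (j + 3)]) = (val p \in [:: val j; (j + 1) %% 7; (j + 3) %% 7]).
Proof.
rewrite !inE /fano_pt -!(inj_eq val_inj) /= !inordK ?ltn_mod // -orbA.
by rewrite (modn_small (ltn_ord j)).
Qed.

Lemma mem_copy (i : 'I_3) (d : {set 'I_7}) x :
  (x \in [set (i, p) | p in d]) = (x.1 == i) && (x.2 \in d).
Proof.
apply/imsetP/andP => [[p pd ->]|[/eqP<- xd]] //.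
by exists x.2 => //; case: x {xd}.
Qed.

Lemma enc_copy (i : nat) (l : seq nat) x : all (gtn 7) l ->
  (enc x \in [seq 7 * i + a | a <- l]) = (val x.1 == i) && (val x.2 \in l).
Proof.
move/allP=> l7; apply/mapP/andP => [[a al]|[/eqP<- h]]; last by exists (val x.2).
have := l7 _ al; have := ltn_ord x.2; rewrite /enc /= => h1 h2 e.
have ei : nat_of_ord x.1 = i by lia.
by rewrite ei eqxx; split=> //; have -> : nat_of_ord x.2 = a by lia.
Qed.

Lemma tf_fano_block (i : 'I_3) (j : 'I_7) :
  [set (i, p) | p in [set fano_pt j; fano_pt (j + 1); fano_pt (j + 3)]] =
  tfset [:: 7 * i + j; 7 * i + (j + 1) %% 7; 7 * i + (j + 3) %% 7].
Proof.
apply/setP=> x; rewrite mem_copy fano_blockE in_tfset.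
have := @enc_copy i [:: val j; (j + 1) %% 7; (j + 3) %% 7] x; rewrite /= !ltn_mod ltn_ord => /(_ isT) ->.
by rewrite -val_eqE.
Qed.

Lemma tf_link_block (i : 'I_3) :
  [set (i, p) | p in fano_b0 :\ fano_x0] :|: [set (ordS i, fano_x0)] =
  tfset [:: 7 * i + 1; 7 * i + 3; 7 * ((i + 1) %% 3)].
Proof.
apply/setP=> x; rewrite in_setU mem_copy in_set1 in_tfset.
have -> : [:: 7 * i + 1; 7 * i + 3; 7 * ((i + 1) %% 3)] =
    [seq 7 * i + a | a <- [:: 1; 3]] ++ [seq 7 * ((i + 1) %% 3) + a | a <- [:: 0]] by rewrite /= addn0.
rewrite mem_cat !enc_copy //; congr (_ || _).
  congr (_ && _); have := fano_blockE ord0 x.2; rewrite !inE => h; rewrite h /fano_x0 /fano_pt -val_eqE /= inordK //.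
  by case: (nat_of_ord x.2) => [|[|[|[|]]]].
case: x => y z; rewrite xpair_eqE inE -!val_eqE /= addn1; congr (_ && _).
by rewrite inordK.
Qed.

(** Only one line passes through the points 0 and 1. Removing [fano_b0] therefore amounts to letting
    the index run from 1 to 6, as in [TF]. *)
Lemma fano_block0 (j : 'I_7) : [set fano_pt j; fano_pt (j + 1); fano_pt (j + 3)] = fano_b0 -> val j = 0.
Proof.
have b0E : fano_b0 = [set fano_pt (ord0 : 'I_7); fano_pt ((ord0 : 'I_7) + 1); fano_pt ((ord0 : 'I_7) + 3)] by [].
move/setP=> h; have := h ord0; have := h (inord 1); rewrite b0E !fano_blockE /= inordK //.
by case: j {h} => [[|[|[|[|[|[|[|]]]]]]]].
Qed.

Lemma three_fanoP c : (c \in three_fano) = (c \in map tfset TF.2).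
Proof.
rewrite inE; apply/orP/mapP.
  case=> [/imset2P[i d _ /setD1P[d0 /imsetP[j _ dj]] ->]|/imsetP[i _ ->]].
    exists [:: 7 * i + j; 7 * i + (j + 1) %% 7; 7 * i + (j + 3) %% 7]; last by rewrite dj tf_fano_block.
    have j0 : 0 < val j.
      rewrite lt0n; apply/eqP=> ej; case/eqP: d0; rewrite dj (_ : j = ord0) //; exact: val_inj.
    apply/flatten_mapP; exists (val i); first by rewrite mem_iota /= add0n ltn_ord.
    rewrite mem_cat; apply/orP; left; apply/mapP; exists (val j) => //.
    by rewrite mem_iota j0 /= ltn_ord.
  exists [:: 7 * i + 1; 7 * i + 3; 7 * ((i + 1) %% 3)]; last by rewrite tf_link_block.
  apply/flatten_mapP; exists (val i); first by rewrite mem_iota /= add0n ltn_ord.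
  by rewrite mem_cat mem_seq1 eqxx orbT.
case=> b /flatten_mapP[i]; rewrite mem_iota add0n => /andP[_ i3].
rewrite mem_cat => /orP[/mapP[j]|]; last first.
  rewrite mem_seq1 => /eqP-> ->; right; apply/imsetP; exists (Ordinal i3) => //.
  by rewrite tf_link_block.
rewrite mem_iota => /andP[j1 j7] -> ->; left.
apply/imset2P; exists (Ordinal i3) [set fano_pt (Ordinal j7); fano_pt (Ordinal j7 + 1); fano_pt (Ordinal j7 + 3)] => //.
  apply/setD1P; split; last by apply/imsetP; exists (Ordinal j7).
  by apply/eqP=> /fano_block0 /= ej; rewrite ej in j1.
by rewrite tf_fano_block.
Qed.

Lemma TF_closed : closed_state TF. Proof. by vm_compute. Qed.

(** The embedding is injective on 21 points, hence bijective. [TF] is closed, so every block of [B]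
    is an image and consists precisely of the images of three points. *)
Lemma TF_iso (T : finType) (B : {set {set T}}) n : good (@on_block T B) n -> #|T| = 21 ->
  (exists phi psi, embedding (@on_block T B) TF phi psi) -> conf_iso B three_fano.
Proof.
move=> G c21 [phi [psi e]]; have [_ onto] := closed_onto G TF_closed e.
have /andP[_ /allP sz] := TF_closed.
pose g x := phi (enc x).
have g_inj : injective g.
  by move=> x y /(emb_inj_pt e (enc_lt x) (enc_lt y)) h; rewrite -(encK x) h encK.
have [f fg gf] : bijective g by apply: inj_card_bij g_inj _; rewrite card_prod !card_ord c21.
exists f; split; first by exists g.
have pre b : f @: b = [set x | g x \in b].
  apply/setP=> x; rewrite inE; apply/imsetP/idP => [[y yb ->]|h]; first by rewrite gf.
  by exists (g x); rewrite ?fg.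
have blkE j : j < size TF.2 -> [set x | g x \in val (psi j)] = tfset (nth [::] TF.2 j).
  move=> lj; apply/setP=> x; rewrite in_tfset inE; apply/idP/idP => [h|/(emb_inc e)[]//].
  have [|i ij /(emb_inj_pt e (enc_lt x))->] // := full_block G e _ h.
    by apply/eqP/sz; apply: mem_nth.
  by have [] := emb_inc e ij.
apply/setP=> c; rewrite three_fanoP; apply/mapP/imsetP => [[b /(nthP [::])[j lj <-] ->]|[b bB ->]].
  by exists (val (psi j)); [exact: (valP (psi j))|rewrite pre blkE].
have [j lj ej] := onto (Sub b bB); exists (nth [::] TF.2 j); first exact: mem_nth.
by rewrite pre -blkE // ej SubK.
Qed.

(** * The combination of three Fano planes is a connected configuration without blocking sets *)

Lemma tfset_inj : {in TF.2 &, injective tfset}.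
Proof.
have h : all (fun b : seq nat => all (fun b' : seq nat => all (fun k => (k \in b) == (k \in b')) (iota 0 21) ==> (b == b')) TF.2) TF.2 by vm_compute.
move=> b b' bT b'T /setP eb; apply/eqP; apply: (implyP (allP (allP h _ bT) _ b'T)).
apply/allP=> k; rewrite mem_iota add0n => /= k21; have := eb (dec k).
by rewrite !in_tfset decK // => ->.
Qed.

(** Reduces cardinalities of sets of blocks to [count] on a list, which can be evaluated. *)
Lemma card_three_fano (R : pred {set 'I_3 * 'I_7}) (r : pred (seq nat)) :
  {in TF.2, forall b, R (tfset b) = r b} -> #|[set c in three_fano | R c]| = count r TF.2.
Proof.
move=> hr; have -> : [set c in three_fano | R c] = [set c in filter R (map tfset TF.2)].
  by apply/setP=> c; rewrite in_set three_fanoP in_set mem_filter andbC.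
have u : uniq (map tfset TF.2) by rewrite map_inj_in_uniq; [vm_compute|exact: tfset_inj].
rewrite cardsE (card_uniqP _) ?filter_uniq // size_filter count_map.
exact: eq_in_count.
Qed.

Lemma three_fano_config : sym_config3 three_fano.
Proof.
split.
- rewrite card_prod !card_ord -[3 * 7]/(count predT TF.2) -(@card_three_fano predT) //.
  by apply: eq_card => c; rewrite [RHS]in_set andbT.
- move=> c; rewrite three_fanoP => /mapP[b bT ->].
  have h : all (fun b : seq nat => (size b == 3) && uniq b && all (gtn 21) b) TF.2 by vm_compute.
  have /andP[/andP[/eqP sb ub] /allP b21] := allP h _ bT.
  have -> : tfset b = [set x in map dec b].
    apply/setP=> x; rewrite in_tfset in_set; apply/idP/mapP => [h'|[k kb ->]]; last by rewrite decK //; apply: b21.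
    by exists (enc x); rewrite ?encK.
  rewrite cardsE (card_uniqP _) ?size_map // map_inj_in_uniq // => k l kb lb /(congr1 enc).
  by rewrite !decK //; apply: b21.
- move=> x; rewrite (@card_three_fano _ (fun b : seq nat => enc x \in b)); last by move=> b _; rewrite /= in_tfset.
  have h : all (fun k => count (fun b : seq nat => k \in b) TF.2 == 3) (iota 0 21) by vm_compute.
  by apply/eqP; apply: (allP h); rewrite mem_iota add0n enc_lt.
- move=> x y xy; rewrite (@card_three_fano _ (fun b : seq nat => (enc x \in b) && (enc y \in b))); last by move=> b _; rewrite /= !in_tfset.
  have h : all (fun k => all (fun l => (k != l) ==> (count (fun b : seq nat => (k \in b) && (l \in b)) TF.2 <= 1)) (iota 0 21)) (iota 0 21) by vm_compute.
  have m z : enc z \in iota 0 21 by rewrite mem_iota add0n enc_lt.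
  apply: (implyP (allP (allP h _ (m x)) _ (m y))).
  by apply: contra xy => /eqP ee; rewrite -(encK x) ee encK.
Qed.

(** Closure under passing to blocks that are touched; eight rounds from point 0 reach all 21
    points. *)
Fixpoint reach m (s : seq nat) : seq nat :=
  if m is m'.+1 then reach m' (s ++ flatten [seq b <- TF.2 | has (fun k => k \in s) b]) else s.

Lemma three_fano_connected : conf_connected three_fano.
Proof.
move=> X hX; pose c k := dec k \in X.
have hb b k l : b \in TF.2 -> k \in b -> l \in b -> c k = c l.
  move=> bT kb lb; have h : all (fun b : seq nat => all (gtn 21) b) TF.2 by vm_compute.
  have b21 := allP (allP h _ bT).
  have mk z : z \in b -> dec z \in tfset b by move=> zb; rewrite in_tfset decK //; apply: b21.
  have : tfset b \in three_fano by rewrite three_fanoP map_f.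
  case/hX/orP=> /subsetP sub; rewrite /c.
    by rewrite !sub ?mk.
  by have := sub _ (mk _ kb); have := sub _ (mk _ lb); rewrite !inE => /negbTE-> /negbTE->.
have hr m s : (forall k, k \in s -> c k = c 0) -> forall k, k \in reach m s -> c k = c 0.
  elim: m s => // m IH s hs; apply: IH => k; rewrite mem_cat => /orP[/hs//|/flattenP[b]].
  by rewrite mem_filter => /andP[/hasP[l lb ls] bT] kb; rewrite (hb b k l) // hs.
have call x : (x \in X) = c 0.
  rewrite -(encK x); apply: (hr 8 [:: 0]) => [k|]; first by rewrite inE => /eqP->.
  have h : all (fun k => k \in reach 8 [:: 0]) (iota 0 21) by vm_compute.
  by apply: (allP h); rewrite mem_iota add0n enc_lt.
by case c0: (c 0); [right|left]; apply/setP=> x; rewrite call c0 inE.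
Qed.

(** Along the prefixes of a proper colouring [col] the search is never pruned, so failure on [TF]
    proves that no colouring exists. *)
Lemma find_colouring_complete bs (col : nat -> bool) m c :
  (forall b, b \in bs -> has col b && has (fun i => ~~ col i) b) ->
  c = mkseq col (size c) -> find_colouring bs m c <> None.
Proof.
move=> hb; elim: m c => [|m IH] c ec /=.
  case: ifP => //; rewrite lhasE => /hasP[b bB]; case: ifP => // /allP lb.
  have e i : i \in b -> nth false c i = col i by move=> /lb li; rewrite ec nth_mkseq.
  rewrite /two_coloured; have /andP[h1 h2] := hb b bB.
  rewrite (eq_in_has (a2 := col)) ?h1 //= (eq_in_has (a2 := fun i => ~~ col i)) ?h2 // => i ib; by rewrite e.
case: ifP => [|_].
  rewrite lhasE => /hasP[b bB]; case: ifP => // /allP lb.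
  have e i : i \in b -> nth false c i = col i by move=> /lb li; rewrite ec nth_mkseq.
  rewrite /two_coloured; have /andP[h1 h2] := hb b bB.
  rewrite (eq_in_has (a2 := col)) ?h1 //= (eq_in_has (a2 := fun i => ~~ col i)) ?h2 // => i ib; by rewrite e.
have := IH (rcons c (col (size c))); rewrite size_rcons.
have -> : mkseq col (size c).+1 = rcons c (col (size c)) by rewrite mkseqS -ec.
move=> /(_ erefl); case: (col (size c)); case E: find_colouring => [c'|] //.
by case: find_colouring.
Qed.

Lemma three_fano_unblocked : ~ has_blocking_set three_fano.
Proof.
case=> S hS.
have none : find_colouring TF.2 21 [::] = None by vm_compute.
apply: (@find_colouring_complete TF.2 (fun k => dec k \in S) 21 [::]) none => // b bT.
have : tfset b \in three_fano by rewrite three_fanoP map_f.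
case/hS=> /set0Pn[x /[!inE] /andP[xb xS]] /set0Pn[y /[!inE] /andP[yS yb]].
by apply/andP; split; apply/hasP; [exists (enc x)|exists (enc y)]; rewrite ?encK.
Qed.

Theorem mainTheorem9 :
  (sym_config3 three_fano /\ conf_connected three_fano /\ ~ has_blocking_set three_fano) /\
  (forall (T : finType) (B : {set {set T}}),
      #|T| = 21 -> sym_config3 B -> conf_connected B -> ~ has_blocking_set B ->
      conf_iso B three_fano).
Proof.
split; first by split; [exact: three_fano_config|split; [exact: three_fano_connected|exact: three_fano_unblocked]].
move=> T B c21 sc con nb; have G := config_good sc con nb; rewrite c21 in G.
exact: TF_iso G c21 (good21 G).
Qed.
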